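(* In the setting described in the context, the matrix $\mathfrak P_Q$ is well-defined and it is stochastic. Moreover, $$ \text{\bf T}(a_1,\dots,a_N;\text{\bf M};\Psi)\, \mathfrak P_Q=\text{\bf T}(a_1,\dots,a_N;\text{\bf M};Q\Psi). $$
   Context: A signature of length $n$ is an $n$-tuple $\lambda=(\lambda_1\ge\dots\ge\lambda_n)$ of integers; $\mathbb{GT}_n$ denotes the set of all signatures of length $n$, $|\lambda|=\sum_i\lambda_i$, and $\varnothing$ is the unique signature of length $0$. A doubly-infinite Toeplitz matrix $M=[M_{i-j}]_{i,j\in\mathbb Z}$ is called admissible if $$H(M;u):=\sum_{n\in\mathbb Z}M_nu^n=e^{\gamma^+(u-1)+\gamma^-(u^{-1}-1)}\prod_{i\ge1}\frac{1+\beta_i^+(u-1)}{1-\alpha_i^+(u-1)}\,\frac{1+\beta_i^-(u^{-1}-1)}{1-\alpha_i^-(u^{-1}-1)}$$ with nonnegative parameters, $\sum(\alpha_i^\pm+\beta_i^\pm)<\infty$, $\beta_i^\pm\le1$ (the Laurent series of a function holomorphic in an annulus containing the unit circle, its analyticity annulus). For $\lambda,\mu$ of length $n$ set $s_{\lambda/\mu}(M)=\det[M_{\lambda_i-i-\mu_j+j}]_{i,j=1}^n$. For a constant $c$, $\lambda$ of length $n+1$ and $\mu$ of length $n$, set $s_{\lambda/\mu}(c)=c^{|\lambda|-|\mu|}$ if $\lambda_{n+1}\le\mu_n\le\lambda_n\le\dots\le\mu_1\le\lambda_1$ and $0$ otherwise ($0^0=1$). Fix $N\ge1$, reals $a_1,\dots,a_N>0$,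 nonnegative integers $c(1),\dots,c(N)$ (with $c(0):=0$), admissible Toeplitz matrices $\text{\bf M}=\{M^{(k,l)}:1\le k\le N,1\le l\le c(k)\}$, and a totally nonnegative matrix $\Psi=[\Psi_{ij}]_{i\in\mathbb Z,\,-1\ge j\ge -N}$ whose generating functions $\Psi_j(u)=\sum_n\Psi_{n,-j}u^{n+j}$ are holomorphic in an open set containing the unit circle; assume each $a_j$ lies in the common analyticity annulus of $\{H(M^{(k,l)};u^{-1})\}_{k\ge j}$ and $\{\Psi_i(u)\}_{i=1}^N$. The two-sided Schur process $\text{\bf T}(a_1,\dots,a_N;\text{\bf M};\Psi)$ is the probability measure on sequences $\vec\lambda^{(k)}=(\lambda^{(k,0)},\dots,\lambda^{(k,c(k))})$, $k=1,\dots,N$, with $\lambda^{(k,\cdot)}\in\mathbb{GT}_k$, proportional to $$\det\big[\Psi_{\lambda_i^{(N,c(N))}-i,-j}\big]_{i,j=1}^N\prod_{k=1}^N\Big(s_{\lambda^{(k,0)}/\lambda^{(k-1,c(k-1))}}(a_k)\prod_{l=1}^{c(k)}s_{\lambda^{(k,l)}/\lambda^{(k,l-1)}}(M^{(k,l)})\Big),\quad \lambda^{(0,c(0))}=\varnothing.$$ Let $\mathcal X$ be the set of such sequences for which the product over $k$ above (without the determinant) is positive. For admissible $M_1,M_2$ and $\lambda,\mu\in\mathbb{GT}_n$, $P_{M_1,M_2}(\lambda,\mu\Vert\nu)=\mathrm{const}\cdot s_{\nu/\lambda}(M_1)s_{\nu/\mu}(M_2)$, $\nu\in\mathbb{GT}_n$;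 for admissible $M$, $a>0$ in the analyticity annulus of $H(M;u)$, $\lambda\in\mathbb{GT}_{n-1}$, $\mu\in\mathbb{GT}_n$, $P_{a,M}(\lambda,\mu\Vert\nu)=\mathrm{const}\cdot s_{\nu/\lambda}(a)s_{\nu/\mu}(M)$, $\nu\in\mathbb{GT}_n$ (constants normalize to probability distributions in $\nu$). Let $Q$ be an additional admissible matrix such that all $a_j$ lie in the analyticity annulus of $H(Q;u)$, and define the matrix $\mathfrak P_Q$ with rows and columns indexed by $\mathcal X$: $$\mathfrak P_Q\big((\vec\lambda^{(1)},\dots,\vec\lambda^{(N)}),(\vec\mu^{(1)},\dots,\vec\mu^{(N)})\big)=\prod_{k=1}^N\Big(P_{a_k,Q}\big(\mu^{(k-1,c(k-1))},\lambda^{(k,0)}\Vert\mu^{(k,0)}\big)\prod_{l=1}^{c(k)}P_{M^{(k,l)},Q}\big(\mu^{(k,l-1)},\lambda^{(k,l)}\Vert\mu^{(k,l)}\big)\Big)$$ (sequential update: $\mu^{(1,0)}$ from $\lambda^{(1,0)}$, then $\mu^{(1,1)}$ from $\lambda^{(1,1)}$ and $\mu^{(1,0)}$, etc.). *)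

(* Defs.v *)
From HB Require Import structures.
From mathcomp Require Import all_boot all_order all_algebra.
From mathcomp Require Import complex.
From mathcomp Require Import all_classical all_reals all_analysis.

Set Implicit Arguments.
Unset Strict Implicit.
Unset Printing Implicit Defensive.

Import Order.TTheory GRing.Theory Num.Theory.
Import numFieldNormedType.Exports.

Local Open Scope classical_set_scope.
Local Open Scope ring_scope.

(* Typing R[i] as a [numFieldType] gives it the norm topology. *)
Definition Cx (R : realType) : numFieldType := R[i]%C.

Definition toCx (R : realType) (x : R) : Cx R := x%:C%C.

Definition cexp (R : realType) (z : Cx R) : Cx R :=
  let: (x +i* y)%C := z in
  ((expR x * cos y) +i* (expR x * sin y))%C.

(* Sums over the integers; [Negz n] is the integer -(n + 1). *)
Definition bicvg (K : numFieldType) (f : int -> K) : Prop :=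
  cvgn (series (fun n => f (Posz n))) /\ cvgn (series (fun n => f (Negz n))).

Definition bisum (K : numFieldType) (f : int -> K) : K :=
  limn (series (fun n => f (Posz n))) + limn (series (fun n => f (Negz n))).

Definition laurent_term (R : realType) (h : int -> R) (u : Cx R) (n : int)
  : Cx R := toCx (h n) * u ^ n.

Definition laurent (R : realType) (h : int -> R) (u : Cx R) : Cx R :=
  bisum (laurent_term h u).

Definition laurent_holomorphic (R : realType) (U : set (Cx R)) (h : int -> R)
  : Prop :=
  forall u, U u -> bicvg (laurent_term h u) /\ derivable (laurent h) u 1.

Definition annulus (R : realType) (r1 r2 : R) : set (Cx R) :=
  [set u | toCx r1 < `|u| < toCx r2].

(* [a > 0] lies in the analyticity annulus of the Laurent series [h], the
   largest annulus containing the unit circle on which it is holomorphic. *)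
Definition in_analyticity_annulus (R : realType) (h : int -> R) (a : R)
  : Prop :=
  exists r1 r2 : R, [/\ 0 <= r1, r1 < 1 < r2, r1 < a < r2 &
    laurent_holomorphic (annulus r1 r2) h].

Definition admissible_factor (R : realType) (ap am bp bm : R) (u : Cx R)
  : Cx R :=
  (1 + toCx bp * (u - 1)) / (1 - toCx ap * (u - 1)) *
  ((1 + toCx bm * (u^-1 - 1)) / (1 - toCx am * (u^-1 - 1))).

(* A Toeplitz matrix [M_(i - j)] is given by the sequence [M : int -> R]. *)
Definition admissible (R : realType) (M : int -> R) : Prop :=
  exists (gp gm : R) (ap am bp bm : nat -> R),
    [/\ 0 <= gp, 0 <= gm,
        (forall i, [/\ 0 <= ap i, 0 <= am i, 0 <= bp i <= 1 & 0 <= bm i <= 1]),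
        cvgn (series (fun i => ap i + am i + bp i + bm i)) &
        exists r1 r2 : R, [/\ 0 <= r1, r1 < 1 < r2,
          laurent_holomorphic (annulus r1 r2) M &
          forall u, annulus r1 r2 u ->
            (fun n => cexp (toCx gp * (u - 1) + toCx gm * (u^-1 - 1)) *
               \prod_(0 <= i < n)
                 admissible_factor (ap i) (am i) (bp i) (bm i) u)
            @ \oo --> laurent M u]].

(* A signature of length n is a sequence of n integers; [la`_i] is its
   (i + 1)-st part. *)
Definition GT (n : nat) : set (seq int) :=
  [set la | size la = n /\ sorted >=%R la].

Definition sig_sum (la : seq int) : int := \sum_(x <- la) x.

(* The shifts -i and +j do not depend on whether indices start at 0 or 1. *)
Definition skew_schur (R : realType) (M : int -> R) (la mu : seq int) : R :=
  \det (\matrix_(i < size la, j < size la)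
          M (la`_i - i%:Z - mu`_j + j%:Z)).

Definition interlaces (la mu : seq int) : bool :=
  [forall i : 'I_(size mu), la`_i.+1 <= mu`_i <= la`_i].

Definition skew_schur1 (R : realType) (c : R) (la mu : seq int) : R :=
  if interlaces la mu then c ^ (sig_sum la - sig_sum mu) else 0.

(* All minors, with rows in Z and columns in {-N, ..., -1}. *)
Definition totally_nonneg (R : realType) (N : nat) (Psi : int -> int -> R)
  : Prop :=
  forall (n : nat) (r s : 'I_n -> int),
    (forall i j : 'I_n, (i < j)%N -> r i < r j) ->
    (forall i j : 'I_n, (i < j)%N -> s i < s j) ->
    (forall j, - N%:Z <= s j <= -1) ->
    0 <= \det (\matrix_(i < n, j < n) Psi (r i) (s j)).

(* Coefficients of Psi_j(u) = sum_n Psi_(n,-j) u^(n+j). *)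
Definition Psi_gen (R : realType) (Psi : int -> int -> R) (j : nat) (m : int)
  : R := Psi (m - j%:Z) (- j%:Z).

Definition Psi_valid (R : realType) (N : nat) (a : nat -> R)
    (Psi : int -> int -> R) : Prop :=
  [/\ totally_nonneg N Psi,
      (forall j, (1 <= j <= N)%N ->
         exists U : set (Cx R),
           [/\ open U, (forall u, `|u| = 1 -> U u) &
               laurent_holomorphic U (Psi_gen Psi j)]) &
      forall i j, (1 <= i <= N)%N -> (1 <= j <= N)%N ->
        in_analyticity_annulus (Psi_gen Psi i) (a j)].

Definition Psi_det (R : realType) (N : nat) (Psi : int -> int -> R)
    (la : seq int) : R :=
  \det (\matrix_(i < N, j < N) Psi (la`_i - i.+1%:Z) (- j.+1%:Z)).

Definition mulQPsi (R : realType) (Q : int -> R) (Psi : int -> int -> R)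
    (i j : int) : R := bisum (fun m => Q (i - m) * Psi m j).

(* A sequence of vectors of signatures; [part lam k l] is lambda^(k,l), with k
   starting at 1, and lambda^(0,l) is the empty signature. *)
Definition config : Type := seq (seq (seq int)).

Definition part (lam : config) (k l : nat) : seq int :=
  nth [::] (nth [::] ([::] :: lam) k) l.

Definition configs (N : nat) (c : nat -> nat) : set config :=
  [set lam | size lam = N /\
     forall k, (1 <= k <= N)%N ->
       size (nth [::] ([::] :: lam) k) = (c k).+1 /\
       forall l, (l <= c k)%N -> GT k (part lam k l)].

Definition chain_weight (R : realType) (N : nat) (a : nat -> R)
    (c : nat -> nat) (M : nat -> nat -> int -> R) (lam : config) : R :=
  \prod_(1 <= k < N.+1)
    (skew_schur1 (a k) (part lam k 0) (part lam k.-1 (c k.-1)) *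
     \prod_(1 <= l < (c k).+1)
       skew_schur (M k l) (part lam k l) (part lam k l.-1)).

Definition schur_weight (R : realType) (N : nat) (a : nat -> R)
    (c : nat -> nat) (M : nat -> nat -> int -> R) (Psi : int -> int -> R)
    (lam : config) : R :=
  Psi_det N Psi (part lam N (c N)) * chain_weight N a c M lam.

Definition calX (R : realType) (N : nat) (a : nat -> R) (c : nat -> nat)
    (M : nat -> nat -> int -> R) : set config :=
  [set lam | configs N c lam /\ 0 < chain_weight N a c M lam].

(* [normalized S w] is the probability distribution on S proportional to w; it
   is meaningful when [normalizable S w] holds. *)
Definition normalizable (R : realType) (T : choiceType) (S : set T)
    (w : T -> R) : Prop :=
  (forall x, S x -> 0 <= w x) /\
  (0 < \esum_(x in S) (w x)%:E < +oo)%E.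

Definition normalized (R : realType) (T : choiceType) (S : set T) (w : T -> R)
    (x : T) : R := w x / fine (\esum_(y in S) (w y)%:E).

Definition distribution_on (R : realType) (T : choiceType) (S : set T)
    (p : T -> R) : Prop :=
  (forall x, S x -> 0 <= p x) /\ \esum_(x in S) (p x)%:E = 1%E.

Definition stochastic (R : realType) (T : choiceType) (S : set T)
    (P : T -> T -> R) : Prop := forall x, S x -> distribution_on S (P x).

Definition schur_process (R : realType) (N : nat) (a : nat -> R)
    (c : nat -> nat) (M : nat -> nat -> int -> R) (Psi : int -> int -> R)
  : config -> R := normalized (configs N c) (schur_weight N a c M Psi).

(* Unnormalized P_(a,M)(la, mu || nu) and P_(M1,M2)(la, mu || nu). *)
Definition weight_aM (R : realType) (a : R) (M : int -> R)
    (la mu nu : seq int) : R := skew_schur1 a nu la * skew_schur M nu mu.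

Definition weight_MM (R : realType) (M1 M2 : int -> R)
    (la mu nu : seq int) : R := skew_schur M1 nu la * skew_schur M2 nu mu.

Definition P_aM (R : realType) (n : nat) (a : R) (M : int -> R)
    (la mu : seq int) : seq int -> R := normalized (GT n) (weight_aM a M la mu).

Definition P_MM (R : realType) (n : nat) (M1 M2 : int -> R)
    (la mu : seq int) : seq int -> R :=
  normalized (GT n) (weight_MM M1 M2 la mu).

Definition frakP (R : realType) (N : nat) (a : nat -> R) (c : nat -> nat)
    (M : nat -> nat -> int -> R) (Q : int -> R) (lam mu : config) : R :=
  \prod_(1 <= k < N.+1)
    (P_aM k (a k) Q (part mu k.-1 (c k.-1)) (part lam k 0) (part mu k 0) *
     \prod_(1 <= l < (c k).+1)
       P_MM k (M k l) Q (part mu k l.-1) (part lam k l) (part mu k l)).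

(* [frakP] is a sequential update: it is well-defined when, started from any
   lam in X, every step reached with positive probability can be performed.
   At steps that cannot be reached the normalizing sum may vanish; an earlier
   factor of [frakP] is then 0. *)
Definition step_weight (R : realType) (a : nat -> R) (c : nat -> nat)
    (M : nat -> nat -> int -> R) (Q : int -> R) (lam mu : config) (k l : nat)
  : seq int -> R :=
  if l == 0%N then weight_aM (a k) Q (part mu k.-1 (c k.-1)) (part lam k 0)
  else weight_MM (M k l) Q (part mu k l.-1) (part lam k l).

Definition frakP_well_defined (R : realType) (N : nat) (a : nat -> R)
    (c : nat -> nat) (M : nat -> nat -> int -> R) (Q : int -> R) : Prop :=
  forall lam mu, calX N a c M lam -> configs N c mu ->
  forall k l, (1 <= k <= N)%N -> (l <= c k)%N ->
    (forall k' l', (1 <= k')%N -> (l' <= c k')%N ->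
       (k' < k)%N || (k' == k) && (l' < l)%N ->
       0 < normalized (GT k') (step_weight a c M Q lam mu k' l')
             (part mu k' l')) ->
    normalizable (GT k) (step_weight a c M Q lam mu k l).

(* Main.v *)
Require Import Defs.
From HB Require Import structures.
From mathcomp Require Import all_boot all_order all_algebra.
From mathcomp Require Import perm cyclic separable cyclotomic complex finmap.
From mathcomp Require Import all_classical all_reals all_analysis.
From mathcomp Require Import zify ring lra.

Set Implicit Arguments.
Unset Strict Implicit.
Unset Printing Implicit Defensive.

Import Order.TTheory GRing.Theory Num.Theory.
Import numFieldNormedType.Exports.

Local Open Scope classical_set_scope.
Local Open Scope ring_scope.

(** All weights are minors: reading a signature [la] through the decreasing
    sequence [la_i - i] turns [s_(la/mu)(M)] into a minor of the Toeplitz matrix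
    of [M], and the single-variable [s_(la/mu)(a)] into a minor of a geometric
    matrix with one additional "virtual" row.  The Cauchy-Binet formula, passed
    to the limit along finite windows of Z, then gives the two skew Cauchy
    identities
      [sum_nu s_(nu/la)(M1) s_(nu/mu)(M2) = sum_ka s_(mu/ka)(M1) s_(la/ka)(M2)],
      [sum_nu s_(nu/la)(a) s_(nu/mu)(Q) = H(Q;a) sum_ka s_(mu/ka)(a) s_(la/ka)(Q)].
    They say that the normalizing constant of an update step is the
    [s_(./.)(Q)]-weighted sum over the previous level, so the constants telescope
    along the chain: the total mass is 1, and [T(Psi) P_Q] acquires the weight
    [sum_la s_(mu/la)(Q) det Psi_la = det (Q Psi)_mu], again by Cauchy-Binet.

    Two analytic facts are needed.  Admissible matrices are totally nonnegative:
    truncating the product and replacing [exp z] by [(1 + z/p)^p] gives products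
    of elementary totally nonnegative factors, whose coefficients converge
    because a Laurent coefficient is a limit of averages over roots of unity.
    The partition function is finite: weights [prod_i max(P^(la_i), q^(la_i))]
    are propagated along the chain up to a constant, with radii [P] and [q]
    inside the analyticity annuli. *)

(** Sums over signatures are sums of nonnegative extended reals, so they can be exchanged without a
    prior proof of convergence. Finiteness is needed only for the normalizing sum of one step and
    for the partition function. The price is that every summand must be known to be nonnegative;
    single determinants are signed, so this always comes from total nonnegativity of both factors.

    Away from the support a normalizing sum may vanish. The relation between a normalized weight,
    its normalizing sum and the weight survives there, because a vanishing sum forces vanishing
    weights. Hence the intertwining is proved for all arrays, and the restriction to X is made only
    at the end.

    The partition function for Q Psi is not computed separately: summing the unnormalized
    intertwining over the target, with rows of mass 1, expresses it through the one for Psi.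

    The growth weights need two radii because parts of both signs occur. The number of signatures
    interlacing with a given one is unbounded, so each new length costs a small enlargement of the
    radii, for which the open annuli leave room. *)

(** * Sums of nonnegative families over arbitrary sets *)

Section esum_extra.
Context {R : realType} {T : choiceType}.
Implicit Types (S A B : set T).

Lemma subset_esum A B (f : T -> \bar R) : A `<=` B ->
  (\esum_(x in A) f x <= \esum_(x in B) f x)%E.
Proof.
move=> AB; apply: ereal_sup_le => _ [X [Xfin XA] <-].
by exists X => //; split=> //; exact: subset_trans AB.
Qed.

Lemma esum_ge_term S (f : T -> \bar R) x : S x -> (0 <= f x)%E ->
  (f x <= \esum_(y in S) f y)%E.
Proof.
move=> Sx fx; rewrite -[leLHS](esum_set1 fx); apply: subset_esum.
by move=> _ ->.
Qed.

Lemma esum_le_seq S (f : T -> R) (B : \bar R) :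
  (forall s : seq T, uniq s -> (forall x, x \in s -> S x) ->
     ((\sum_(x <- s) f x)%:E <= B)%E) ->
  (\esum_(x in S) (f x)%:E <= B)%E.
Proof.
move=> H; apply: ge_ereal_sup => _ [X [Xfin XS] <-].
rewrite fsbig_finite//= sumEFin; apply: H; first exact: fset_uniq.
by move=> x; rewrite in_fset_set// inE => /XS.
Qed.

Lemma esum_ge_seq S (f : T -> R) (s : seq T) :
  uniq s -> (forall x, x \in s -> S x) ->
  ((\sum_(x <- s) f x)%:E <= \esum_(x in S) (f x)%:E)%E.
Proof.
move=> us sS; apply: esum_ge; exists [set` s].
  by split; [exact: finite_seq|move=> x /= /sS].
by rewrite -fsbig_seq//= sumEFin.
Qed.

Lemma ge0_esumZl S (c : R) (f : T -> \bar R) : 0 <= c ->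
  (forall x, S x -> 0 <= f x)%E ->
  (\esum_(x in S) (c%:E * f x) = c%:E * \esum_(x in S) f x)%E.
Proof.
move=> c0 f0; rewrite /esum -ereal_supZl//; last first.
  by apply/set0P; exists (\sum_(x \in set0) f x)%E, set0 => //; exact: fsets_set0.
rewrite image_comp; congr ereal_sup; apply: eq_imagel => X [Xfin XS].
rewrite /= !fsbig_finite//= [X in (_ * X)%E]big_seq ge0_sume_distrr//=.
  by rewrite -big_seq.
by move=> x; rewrite in_fset_set// inE => /XS/f0.
Qed.

Lemma sum_subset_uniq (s t : seq T) (f : T -> R) : uniq s -> uniq t ->
  {subset s <= t} -> (forall x, x \in t -> 0 <= f x) ->
  \sum_(x <- s) f x <= \sum_(x <- t) f x.
Proof.
move=> us ut st f0.
rewrite [leRHS](bigID (mem s))/= -[X in _ <= X + _]big_filter.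
rewrite [X in _ <= X + _](perm_big s)/=; last first.
  apply: uniq_perm => //; first exact: filter_uniq.
  by move=> x; rewrite mem_filter andb_idr// => /st.
rewrite lerDl big_seq_cond; apply: sumr_ge0 => x /andP[/f0//].
Qed.

(** Nonnegativity turns the supremum over finite subsets into a limit along any lists that
    eventually contain each point; the lists need not be nested. *)
Lemma esum_seq_lim S (f : T -> R) (s : nat -> seq T) (L : R) :
  (forall x, S x -> 0 <= f x) ->
  (forall K, uniq (s K)) -> (forall K x, x \in s K -> S x) ->
  (forall x, S x -> exists K0, forall K, (K0 <= K)%N -> x \in s K) ->
  (fun K => \sum_(x <- s K) f x) @ \oo --> L ->
  \esum_(x in S) (f x)%:E = L%:E.
Proof.
move=> f0 us sS ex cv; apply/eqP; rewrite eq_le; apply/andP; split.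
  apply: esum_le_seq => t ut tS; rewrite lee_fin.
  have [K0 HK0] : exists K0, forall K, (K0 <= K)%N -> {subset t <= s K}.
    elim: t {ut} tS => [|x t IH] tS; first by exists 0%N.
    have [|K1 H1] := IH; first by move=> y yt; apply: tS; rewrite inE yt orbT.
    have [|K2 H2] := ex x; first by apply: tS; rewrite inE eqxx.
    exists (maxn K1 K2) => K; rewrite geq_max => /andP[k1 k2] y.
    by rewrite inE => /orP[/eqP->|]; [exact: H2|exact: H1].
  apply: (cvgr_to_ge cv).
  exists K0 => // K /= KK; apply: sum_subset_uniq => //; first exact: HK0.
  by move=> x /sS/f0.
case E : (\esum_(x in S) (f x)%:E)%E => [r| |]; last 2 first.
- by rewrite leey.
- have := esum_ge0 (S := S) (a := fun x => (f x)%:E).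
  by rewrite E => /(_ _)/wrap[]// x /f0; rewrite lee_fin.
rewrite lee_fin; apply: (cvgr_to_le cv); near=> K.
by rewrite -lee_fin -E; apply: esum_ge_seq => // x; exact: sS.
Unshelve. all: by end_near. Qed.
End esum_extra.

(** * Two-sided series over the integers *)

Section bisum_basic.
Context {K : numFieldType}.
Implicit Types f g : int -> K.

Definition window (n : nat) : seq int :=
  [seq Posz i | i <- iota 0 n] ++ [seq Negz i | i <- iota 0 n].

Lemma window_uniq n : uniq (window n).
Proof.
rewrite cat_uniq !map_inj_uniq ?iota_uniq//=; try by move=> ? ? [].
by rewrite andbT; apply/hasPn => x /mapP[i _ ->]; apply/mapP => -[].
Qed.

Lemma mem_window n (x : int) : (x \in window n) = (- n%:Z <= x < n%:Z).
Proof.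
rewrite mem_cat; case: x => m.
  rewrite mem_map; last by move=> ? ? [].
  rewrite mem_iota add0n /= (_ : (_ \in _) = false) ?orbF.
    by apply/idP/idP; lia.
  by apply/negbTE/mapP => -[].
rewrite orbC mem_map; last by move=> ? ? [].
rewrite mem_iota add0n /= (_ : (_ \in _) = false) ?orbF.
  by apply/idP/idP; lia.
by apply/negbTE/mapP => -[].
Qed.

Lemma sum_window f n : \sum_(x <- window n) f x =
  series (fun k => f (Posz k)) n + series (fun k => f (Negz k)) n.
Proof. by rewrite big_cat !big_map /series/= /index_iota subn0. Qed.

Lemma window_cvg f : bicvg f -> (fun n => \sum_(x <- window n) f x) @ \oo --> bisum f.
Proof.
move=> [c1 c2]; under eq_fun do rewrite sum_window.
by apply: cvgD.
Qed.

Lemma bicvg_bisum_lim f g (l : K) : bicvg f -> (forall x, f x = g x) ->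
  (fun n => \sum_(x <- window n) f x) @ \oo --> l -> bisum g = l.
Proof.
move=> cf fg fl; have -> : g = f by apply/funext => x; rewrite fg.
exact: cvg_unique (window_cvg cf) fl.
Qed.

Lemma bicvgD f g : bicvg f -> bicvg g -> bicvg (f \+ g).
Proof.
by move=> [f1 f2] [g1 g2]; split; [exact: is_cvg_seriesD f1 g1|exact: is_cvg_seriesD f2 g2].
Qed.

Lemma bisumD f g : bicvg f -> bicvg g -> bisum (f \+ g) = bisum f + bisum g.
Proof.
move=> cf cg; apply: bicvg_bisum_lim (bicvgD cf cg) _ _ => //.
under eq_fun do rewrite big_split/=.
by apply: cvgD; exact: window_cvg.
Qed.

Lemma bicvgZ (a : K) f : bicvg f -> bicvg (fun x => a * f x).
Proof.
by move=> [f1 f2]; split; [exact: is_cvg_seriesZ f1|exact: is_cvg_seriesZ f2].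
Qed.

Lemma bisumZ (a : K) f : bicvg f -> bisum (fun x => a * f x) = a * bisum f.
Proof.
move=> cf; apply: bicvg_bisum_lim (bicvgZ a cf) _ _ => //.
under eq_fun do rewrite -mulr_sumr.
by apply: cvgMr; exact: window_cvg.
Qed.

Lemma bicvg0 : bicvg (fun=> 0 : K).
Proof.
have H : series (fun=> 0 : K) = fun=> 0 by apply/funext => n; rewrite /series/= big1.
by split; rewrite H; exact: is_cvg_cst.
Qed.

Lemma bisum0 : bisum (fun=> 0 : K) = 0.
Proof.
apply: bicvg_bisum_lim bicvg0 _ _ => //.
by under eq_fun do rewrite big1//; exact: cvg_cst.
Qed.

Lemma bicvg_sum (I : Type) (r : seq I) (F : I -> int -> K) :
  (forall i, bicvg (F i)) -> bicvg (fun x => \sum_(i <- r) F i x).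
Proof.
move=> cF; elim: r => [|i r IH].
  by under eq_fun do rewrite big_nil; exact: bicvg0.
by under eq_fun do rewrite big_cons; exact: (bicvgD (cF i) IH).
Qed.

Lemma bisum_sum (I : Type) (r : seq I) (F : I -> int -> K) :
  (forall i, bicvg (F i)) ->
  bisum (fun x => \sum_(i <- r) F i x) = \sum_(i <- r) bisum (F i).
Proof.
move=> cF; elim: r => [|i r IH].
  by rewrite big_nil; under eq_fun do rewrite big_nil; exact: bisum0.
rewrite big_cons -IH; under eq_fun do rewrite big_cons.
by rewrite -bisumD//; exact: bicvg_sum.
Qed.

End bisum_basic.

Section bisum_real.
Context {R : realType}.
Implicit Types f g : int -> R.

Lemma ge0_bisum_esum f : (forall x, 0 <= f x) -> bicvg f ->
  \esum_(x in [set: int]) (f x)%:E = (bisum f)%:E.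
Proof.
move=> f0 cf; apply: (@esum_seq_lim _ _ _ _ window).
- by move=> x _; exact: f0.
- exact: window_uniq.
- by [].
- move=> x _; exists `|x|.+1%N => n; rewrite mem_window; lia.
- exact: window_cvg.
Qed.

Lemma ge0_bicvg f : (forall x, 0 <= f x) ->
  (\esum_(x in [set: int]) (f x)%:E < +oo)%E -> bicvg f.
Proof.
move=> f0 flt.
have ffin : \esum_(x in [set: int]) (f x)%:E \is a fin_num.
  by rewrite ge0_fin_numE// esum_ge0// => x _; rewrite lee_fin.
have H (e : nat -> int) : injective e -> cvgn (series (fun n => f (e n))).
  move=> ei; apply: nondecreasing_is_cvgn.
    by apply/nondecreasing_seqP => n; rewrite seriesSr lerDl.
  exists (fine (\esum_(x in [set: int]) (f x)%:E)) => _ [n _ <-].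
  rewrite -lee_fin fineK// /series/= /index_iota subn0 -(big_map e xpredT f).
  by apply: esum_ge_seq => //; rewrite map_inj_uniq// iota_uniq.
by split; apply: H => ? ? [].
Qed.

(** Unlike [bicvg], which looks at two half-series in their given order, this notion is invariant
    under bijections of Z. Shifts and reflections of series are justified through it. *)
Definition asummable f := (\esum_(x in [set: int]) `|f x|%:E < +oo)%E.

Lemma le_asummable f g : (forall x, `|f x| <= `|g x|) -> asummable g -> asummable f.
Proof. by move=> fg; apply: le_lt_trans; apply: le_esum => x _; rewrite lee_fin. Qed.

Lemma asummable_bicvg f : asummable f -> bicvg f.
Proof.
move=> cf; have [c1 c2] : bicvg (fun x => `|f x|) by exact: ge0_bicvg.
by split; apply: normed_cvg.
Qed.

Lemma ge0_asummable f : (forall x, 0 <= f x) -> bicvg f -> asummable f.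
Proof.
move=> f0 cf; rewrite /asummable (eq_esum (b := fun x => (f x)%:E)).
  by rewrite ge0_bisum_esum// ltry.
by move=> x _; rewrite ger0_norm.
Qed.

Lemma asummableZ (a : R) f : asummable f -> asummable (fun x => a * f x).
Proof.
rewrite /asummable => cf.
under eq_esum do rewrite normrM EFinM.
by rewrite ge0_esumZl// lte_mul_pinfty ?lee_fin.
Qed.

Lemma asummable_reindex (e : int -> int) f : set_bij setT setT e ->
  asummable f -> asummable (f \o e).
Proof. by move=> eb; rewrite /asummable (reindex_esum _ _ _ _ eb). Qed.

Lemma set_bij_reflect (c : int) : set_bij [set: int] [set: int] (fun x => c - x).
Proof.
split=> //; first by move=> x y _ _; lia.
by move=> x _; exists (c - x) => //; lia.
Qed.

Lemma set_bij_shift (c : int) : set_bij [set: int] [set: int] (fun x => x - c).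
Proof.
split=> //; first by move=> x y _ _; lia.
by move=> x _; exists (x + c) => //; lia.
Qed.

Lemma ge0_bisum_reindex (e : int -> int) f : (forall x, 0 <= f x) -> bicvg f ->
  set_bij setT setT e -> bicvg (f \o e) /\ bisum (f \o e) = bisum f.
Proof.
move=> f0 cf eb.
have ce : bicvg (f \o e).
  apply: asummable_bicvg; apply: asummable_reindex => //; exact: ge0_asummable.
split=> //; apply: EFin_inj; rewrite -!ge0_bisum_esum//; last by move=> x /=.
by rewrite [RHS](reindex_esum _ _ _ _ eb).
Qed.

Lemma bisum_ge0 f : (forall x, 0 <= f x) -> bicvg f -> 0 <= bisum f.
Proof.
move=> f0 cf; rewrite -lee_fin -ge0_bisum_esum//.
by apply: esum_ge0 => x _; rewrite lee_fin.
Qed.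

End bisum_real.

(** * Determinants and the finite Cauchy-Binet formula *)

Section determinants.
Context {R : comNzRingType}.

(** Multilinearity in the rows. [B] may depend on the row index: Cauchy-Binet takes it constant in
    [i], while [tn_two] shifts each row from its own position. *)
Lemma det_sum_rows (I : finType) n (w : 'I_n -> I -> R) (B : 'I_n -> I -> 'I_n -> R) :
  \det (\matrix_(i, j) \sum_k w i k * B i k j) =
  \sum_(f : {ffun 'I_n -> I})
    (\prod_i w i (f i)) * \det (\matrix_(i, j) B i (f i) j).
Proof.
rewrite /determinant.
under eq_bigr => s _ do under eq_bigr => i _ do rewrite mxE.
under eq_bigr => s _ do rewrite bigA_distr_bigA/= mulr_sumr.
rewrite exchange_big/=; apply: eq_bigr => f _; rewrite mulr_sumr.
apply: eq_bigr => s _; rewrite big_split/= mulrCA; congr (_ * (_ * _)).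
by apply: eq_bigr => i _; rewrite mxE.
Qed.

Lemma det_eq_rows n (A : 'M[R]_n) i1 i2 : i1 != i2 ->
  (forall j, A i1 j = A i2 j) -> \det A = 0.
Proof. by move=> ne e; apply: (determinant_alternate ne) => j. Qed.

Lemma det_row0 n (A : 'M[R]_n) i : (forall j, A i j = 0) -> \det A = 0.
Proof. by move=> e; rewrite (expand_det_row _ i) big1// => j _; rewrite e mul0r. Qed.

Lemma det_scale_cols n (A : 'I_n -> 'I_n -> R) (c : 'I_n -> R) :
  \det (\matrix_(i, j) (A i j * c j)) = \det (\matrix_(i, j) A i j) * \prod_j c j.
Proof.
rewrite (_ : \matrix_(i, j) (A i j * c j) =
             (\matrix_(i, j) A i j) *m diag_mx (\row_j c j)).
  by rewrite det_mulmx det_diag; congr (_ * _); apply: eq_bigr => j _; rewrite mxE.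
by apply/matrixP => i j; rewrite mul_mx_diag !mxE.
Qed.

(** Signatures give decreasing sequences, whereas total nonnegativity is about increasing ones. The
    signs of the two reversals cancel here, and across the two factors in [det_rev_rows2]. *)
Lemma det_rev n (A : 'I_n -> 'I_n -> R) :
  \det (\matrix_(i, j) A (rev_ord i) (rev_ord j)) = \det (\matrix_(i, j) A i j).
Proof.
pose s := perm (@rev_ord_inj n).
have -> : (\matrix_(i, j) A (rev_ord i) (rev_ord j)) =
   row_perm s (col_perm s (\matrix_(i, j) A i j)).
  by apply/matrixP => i j; rewrite !mxE !permE.
by rewrite row_permE col_permE !det_mulmx !det_perm mulrCA -[RHS]mulr1 odd_permV
  -signr_addb addbb.
Qed.

Lemma det_rev_rows2 n (A B : 'I_n -> 'I_n -> R) :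
  \det (\matrix_(i, j) A (rev_ord i) j) * \det (\matrix_(i, j) B (rev_ord i) j) =
  \det (\matrix_(i, j) A i j) * \det (\matrix_(i, j) B i j).
Proof.
pose s := perm (@rev_ord_inj n).
have H C : (\matrix_(i, j) C (rev_ord i) j) = row_perm s (\matrix_(i, j) C i j : 'M[R]_n).
  by apply/matrixP => i j; rewrite !mxE !permE.
by rewrite !H !row_permE !det_mulmx !det_perm mulrACA -signr_addb addbb mul1r.
Qed.

End determinants.

Lemma incr_ord_id n (f : 'I_n -> 'I_n) :
  (forall i j : 'I_n, (i < j)%N -> (f i < f j)%N) -> forall i, f i = i.
Proof.
move=> fi.
have ge : forall k (i : 'I_n), (i : nat) = k -> (k <= f i)%N.
  elim=> // k IH i ik.
  have kn : (k < n)%N by have := ltn_ord i; rewrite ik; lia.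
  apply: leq_ltn_trans (IH (Ordinal kn) erefl) _.
  by apply: fi; rewrite /= ik.
have le : forall k (i : 'I_n), (n - i.+1)%N = k -> (f i <= i)%N.
  elim=> [|k IH] i ik; first by have := ltn_ord (f i); have := ltn_ord i; lia.
  have kn : (i.+1 < n)%N by lia.
  have := IH (Ordinal kn); rewrite /= => /(_ _)/wrap[]; first by lia.
  by have := fi i (Ordinal kn) => /= /(_ (ltnSn _)); lia.
by move=> i; apply/val_inj/eqP; rewrite eqn_leq (le _ _ erefl) (ge _ _ erefl).
Qed.

Section cauchy_binet.
Context {R : comNzRingType} {n m : nat}.
Implicit Types f : {ffun 'I_n -> 'I_m}.

Definition incrb (f : {ffun 'I_n -> 'I_m}) :=
  [forall i : 'I_n, forall j : 'I_n, (i < j)%N ==> (f i < f j)%N].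

Lemma incrbP (f : {ffun 'I_n -> 'I_m}) :
  reflect (forall i j : 'I_n, (i < j)%N -> (f i < f j)%N) (incrb f).
Proof.
apply: (iffP forallP) => [H i j ij|H i]; first by have /forallP/(_ j)/implyP := H i; exact.
by apply/forallP => j; apply/implyP; exact: H.
Qed.

Lemma incrb_inj f : incrb f -> injective f.
Proof.
move=> /incrbP fi i j e; apply/val_inj/eqP; case: (ltngtP i j) => // /fi; rewrite e ltnn//.
Qed.

Let srt (f : {ffun 'I_n -> 'I_m}) := sort (fun x y : 'I_m => (x <= y)%N) (codom f).
(** Increasing enumeration of the image when [f] is injective. The default [f i] only supplies an
    element of ['I_m], the sorted list having size [n]. *)
Let incr_part (f : {ffun 'I_n -> 'I_m}) : {ffun 'I_n -> 'I_m} :=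
  [ffun i => nth (f i) (srt f) i].

Let size_srt f : size (srt f) = n.
Proof. by rewrite size_sort size_codom card_ord. Qed.

Let mem_srt f x : (x \in srt f) = (x \in codom f).
Proof. by rewrite mem_sort. Qed.

Let srt_sorted f : injective f -> sorted (fun x y : 'I_m => (x < y)%N) (srt f).
Proof.
move=> fi.
have s1 : sorted (fun x y : 'I_m => (x <= y)%N) (srt f).
  by apply: sort_sorted => x y; exact: leq_total.
have : sorted ltn [seq val i | i <- srt f].
  rewrite ltn_sorted_uniq_leq (map_inj_uniq val_inj) sort_uniq sorted_map s1 andbT.
  by rewrite map_inj_uniq ?enum_uniq.
by rewrite sorted_map.
Qed.

Let incr_part_incr f : injective f -> incrb (incr_part f).
Proof.
move=> fi; apply/incrbP => i j ij; rewrite !ffunE.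
rewrite (set_nth_default (f i) (f j)) ?size_srt//.
apply: (sorted_ltn_nth _ _ (srt_sorted fi)); rewrite ?inE ?size_srt//.
by move=> y x z; exact: ltn_trans.
Qed.

Let incr_partE f : incrb f -> forall s : 'S_n, incr_part [ffun i => f (s i)] = f.
Proof.
move=> fi s; apply/ffunP => i; rewrite ffunE.
have -> : srt [ffun i => f (s i)] = codom f.
  have ps : perm_eq (codom [ffun i => f (s i)]) (codom f).
    apply: uniq_perm.
    - rewrite map_inj_uniq ?enum_uniq// => x y.
      by rewrite !ffunE => /(incrb_inj fi)/perm_inj.
    - by rewrite map_inj_uniq ?enum_uniq//; exact: incrb_inj.
    - move=> x; apply/codomP/codomP => -[y ->].
        by exists (s y); rewrite ffunE.
      by exists ((s^-1)%g y); rewrite ffunE permKV.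
  have tot : total (fun x y : 'I_m => (x <= y)%N) by move=> x y; exact: leq_total.
  have tr : transitive (fun x y : 'I_m => (x <= y)%N) by move=> x y z; exact: leq_trans.
  apply: (sorted_eq tr) => //; first by move=> x y; rewrite -eqn_leq => /eqP/val_inj.
  - exact: sort_sorted.
  - apply: (homo_sorted (e := fun x y : 'I_n => (x < y)%N)).
      by move=> x y xy; rewrite ltnW//; exact: (incrbP _ fi).
    by have := iota_ltn_sorted 0 n; rewrite -val_enum_ord sorted_map.
  - by rewrite perm_sort.
by rewrite (nth_map i) ?size_enum_ord// nth_ord_enum.
Qed.

Let perm_part (f : {ffun 'I_n -> 'I_m}) : 'S_n :=
  odflt 1%g [pick s : 'S_n | [forall i, incr_part f (s i) == f i]].

Let perm_partE f : injective f -> forall i, incr_part f (perm_part f i) = f i.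
Proof.
move=> fi; rewrite /perm_part; case: pickP => [s /forallP H i|/=]; first exact/eqP.
have ind i : (index (f i) (srt f) < n)%N by rewrite -[ltnRHS](size_srt f) index_mem mem_srt codom_f.
pose s i := Ordinal (ind i).
have si : injective s.
  move=> i j /(congr1 val)/= e; apply: fi.
  by rewrite -[LHS](nth_index (f i) (s := srt f)) ?mem_srt ?codom_f// e nth_index ?mem_srt ?codom_f.
move=> /(_ (perm si))/negbT/negP[]; apply/forallP => i.
rewrite permE ffunE /= (set_nth_default (f i)) ?size_srt// nth_index//.
by rewrite mem_srt codom_f.
Qed.

(** In the row expansion over all maps [f], a map that is not injective produces two equal rows, and
    an injective one factors uniquely as an increasing map after a permutation. The signed sum over
    the permutations rebuilds the first minor. *)
Lemma cauchy_binet (A : 'I_n -> 'I_m -> R) (B : 'I_m -> 'I_n -> R) :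
  \det (\matrix_(i, j) \sum_k A i k * B k j) =
  \sum_(f : {ffun 'I_n -> 'I_m} | incrb f)
    \det (\matrix_(i, j) A i (f j)) * \det (\matrix_(i, j) B (f i) j).
Proof.
rewrite (det_sum_rows A (fun _ k j => B k j)).
rewrite (bigID (fun f : {ffun 'I_n -> 'I_m} => injectiveb f))/=.
rewrite [X in _ + X]big1 ?addr0; last first.
  move=> f /injectivePn[i [j ij e]]; rewrite (@det_eq_rows _ _ _ i j) ?mulr0//.
  by move=> k; rewrite !mxE e.
pose h (p : {ffun 'I_n -> 'I_m} * 'S_n) := [ffun i => p.1 (p.2 i)].
rewrite (reindex_onto h (fun f => (incr_part f, perm_part f)))/=; last first.
  move=> f /injectiveP fi; apply/ffunP => i; rewrite ffunE /=; exact: perm_partE.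
under [RHS]eq_bigr => f _ do rewrite {1}/determinant mulr_suml.
rewrite pair_big_dep/=; apply: eq_big.
  move=> [f s]; rewrite andbT /=; apply/andP/idP => [[/injectiveP hi /eqP[<- _]]|fi].
    exact: incr_part_incr.
  have hi : injective (h (f, s)).
    by move=> x y; rewrite !ffunE => /(incrb_inj fi)/perm_inj.
  split; first exact/injectiveP.
  have e : incr_part (h (f, s)) = f by exact: incr_partE.
  apply/eqP; congr (_, _) => //; apply/permP => i; apply: (incrb_inj fi).
  by have := perm_partE hi i; rewrite e => ->; rewrite ffunE.
move=> [f s] _ /=; rewrite mulrC -mulrA mulrC.
have -> : \matrix_(i, j) B (h (f, s) i) j = row_perm s (\matrix_(i, j) B (f i) j).
  by apply/matrixP => i j; rewrite !mxE ffunE.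
rewrite row_permE det_mulmx det_perm mulrCA; congr (_ * (_ * _)).
by apply: eq_bigr => i _; rewrite !mxE ffunE.
Qed.

End cauchy_binet.

(* The interlacing condition of [skew_schur1] as the nonvanishing of a determinant. *)
Lemma det_staircase (R : comNzRingType) n (d : 'I_n -> nat) (u : 'I_n -> R) :
  (forall i j : 'I_n, (i <= j)%N -> (d i <= d j)%N) ->
  \det (\matrix_(i, j) (if (d j <= i)%N then u i else 0)) =
  if [forall j, d j == j] then \prod_i u i else 0.
Proof.
move=> dh.
have [/forallP dj|/forallPn[j0 dj0]] := ifPn.
  rewrite det_trig; last first.
    by apply/is_trig_mxP => i j ij; rewrite mxE (eqP (dj j)) leqNgt ij.
  by apply: eq_bigr => i _; rewrite mxE (eqP (dj i)) leqnn.
(* When the diagonal pattern fails, some column vanishes ([d j >= n]) or two columns agree;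
   otherwise [d] would be a strictly increasing self-map of 0, ..., n - 1, hence the identity. *)
rewrite -det_tr.
have [/forallP dn|/forallPn[j jn]] := boolP [forall j, (d j < n)%N]; last first.
  apply: (@det_row0 _ _ _ j) => i; rewrite !mxE ifF//.
  by apply/negbTE; rewrite -ltnNge; apply: leq_trans (ltn_ord i) _; rewrite leqNgt.
have [/injectiveP di|/injectivePn[j [j' ne e]]] := boolP (injectiveb d); last first.
  by apply: (@det_eq_rows _ _ _ j j') => // i; rewrite !mxE e.
case/negP: dj0; apply/eqP.
rewrite -[in RHS](@incr_ord_id n (fun j => Ordinal (dn j)) _ j0)// => i j ij /=.
rewrite ltn_neqAle dh ?(ltnW ij)// andbT; apply: contraTneq ij => /di ->.
by rewrite ltnn.
Qed.

Lemma cvgn_prod (K : numFieldType) (I : Type) (r : seq I) (u : I -> nat -> K) (l : I -> K) :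
  (forall i, u i @ \oo --> l i) ->
  (fun n => \prod_(i <- r) u i n) @ \oo --> \prod_(i <- r) l i.
Proof.
move=> ul; elim: r => [|i r IH].
  by rewrite big_nil; under eq_fun do rewrite big_nil; exact: cvg_cst.
by rewrite big_cons; under eq_fun do rewrite big_cons; exact: (cvgM (ul i) IH).
Qed.

Lemma cvg_det (R : realType) n (A : nat -> 'I_n -> 'I_n -> R) (B : 'I_n -> 'I_n -> R) :
  (forall i j, A ^~ i ^~ j @ \oo --> B i j) ->
  (fun k => \det (\matrix_(i, j) A k i j)) @ \oo --> \det (\matrix_(i, j) B i j).
Proof.
move=> AB; rewrite /determinant.
apply: (cvg_big (op := +%R)); first exact: add_continuous.
move=> s _; apply: cvgMr.
rewrite (_ : \prod_i _ = \prod_i B i (s i)); last by apply: eq_bigr => i _; rewrite mxE.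
rewrite (_ : (fun k => _) = fun k => \prod_i A k i (s i)); last first.
  by apply/funext => k; apply: eq_bigr => i _; rewrite mxE.
by apply: cvgn_prod => i; exact: AB.
Qed.

(** * Signatures as decreasing sequences, and Cauchy-Binet over Z *)

Definition pos (la : seq int) (i : nat) : int := la`_i - i%:Z.

Lemma GT_nth n la i j : GT n la -> (i <= j < n)%N -> la`_j <= la`_i.
Proof.
move=> [sz so] /andP[ij jn].
apply: (sorted_leq_nth _ _ 0 so) => //; rewrite ?inE ?sz//.
- by move=> x y z; rewrite /= => /[swap]; exact: le_trans.
- exact: lexx.
- exact: leq_ltn_trans jn.
Qed.

Lemma GT_pos n la i j : GT n la -> (i < j < n)%N -> pos la j < pos la i.
Proof.
move=> la_GT /andP[ij jn]; have := @GT_nth n la i j la_GT.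
by rewrite jn (ltnW ij) /pos => /(_ erefl); lia.
Qed.

Section signature_windows.
Variables (n K : nat).

(** Enumerates the window [-K, K) downwards, so that increasing maps index decreasing positions. *)
Definition wpos (k : 'I_(K + K)) : int := K%:Z - 1 - (k : nat)%:Z.

Definition wsig (f : {ffun 'I_n -> 'I_(K + K)}) : seq int :=
  [seq wpos (f i) + (i : nat)%:Z | i <- enum 'I_n].

Lemma pos_wsig f (i : 'I_n) : pos (wsig f) i = wpos (f i).
Proof.
by rewrite /pos (nth_map i) ?size_enum_ord// nth_ord_enum addrK.
Qed.

Lemma wsig_inj : injective wsig.
Proof.
move=> f g e; apply/ffunP => i; apply/val_inj.
by have := pos_wsig f i; rewrite e pos_wsig /wpos => /addrI/oppr_inj[].
Qed.

Lemma wsig_GT f : incrb f -> GT n (wsig f).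
Proof.
move=> /incrbP fi; split; first by rewrite size_map size_enum_ord.
apply/(sortedP 0) => i; rewrite size_map size_enum_ord => ni.
have := pos_wsig f (Ordinal ni); have := pos_wsig f (Ordinal (ltnW ni)).
rewrite /pos /= => /eqP; rewrite subr_eq => /eqP -> /eqP; rewrite subr_eq => /eqP ->.
by have := fi (Ordinal (ltnW ni)) (Ordinal ni) (ltnSn i); rewrite /wpos /=; lia.
Qed.

(* The signatures all of whose values [la_i - i] lie in [-K, K); they exhaust
   [GT n] as K grows. *)
Definition sigwin : seq (seq int) := [seq wsig f | f <- enum (@incrb n (K + K))].

Lemma sigwin_uniq : uniq sigwin.
Proof. by rewrite map_inj_uniq ?enum_uniq//; exact: wsig_inj. Qed.

Lemma sigwin_GT la : la \in sigwin -> GT n la.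
Proof. by move=> /mapP[f]; rewrite mem_enum => /wsig_GT + ->. Qed.

Lemma sum_sigwin (V : zmodType) (F : ('I_n -> int) -> V) :
  \sum_(la <- sigwin) F (fun i => pos la i) = \sum_(f | incrb f) F (fun i => wpos (f i)).
Proof.
rewrite big_map big_enum_cond/= big_mkcondr/=.
apply: eq_bigr => f _; congr F; apply/funext => i; exact: pos_wsig.
Qed.

Lemma sum_wpos (V : zmodType) (F : int -> V) :
  \sum_(k < K + K) F (wpos k) = \sum_(x <- window K) F x.
Proof.
rewrite -(big_map wpos xpredT F); apply: perm_big; apply: uniq_perm.
- by rewrite map_inj_uniq ?enum_uniq ?index_enum_uniq// => x y; rewrite /wpos => ?; apply/val_inj => /=; lia.
- exact: window_uniq.
move=> x; rewrite mem_window; apply/mapP/idP => [[k _ ->]|xK].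
  by rewrite /wpos; have := ltn_ord k; lia.
have kb : (absz (K%:Z - 1 - x)%R < K + K)%N by lia.
exists (Ordinal kb); first by rewrite mem_index_enum.
by rewrite /wpos /=; lia.
Qed.

End signature_windows.

Lemma mem_sigwin n la : GT n la -> exists K0, forall K, (K0 <= K)%N -> la \in sigwin n K.
Proof.
move=> la_GT; have [sz _] := la_GT.
(* Every la_i lies between the last and the first part, and i < n; this bounds all the values la_i -
   i. *)
exists (n + absz (la`_0)%R + absz (la`_n.-1)%R + 2)%N => K KK.
have b (i : 'I_n) : (absz (K%:Z - 1 - pos la i)%R < K + K)%N /\ pos la i < K%:Z.
  have := @GT_nth n la 0 i la_GT; have := @GT_nth n la i n.-1 la_GT.
  have := ltn_ord i; rewrite /pos => ni H1 H2.
  have {}H1 : la`_n.-1 <= la`_i by apply: H1; lia.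
  have {}H2 : la`_i <= la`_0 by apply: H2; lia.
  by split; lia.
pose f : {ffun 'I_n -> 'I_(K + K)} := [ffun i => Ordinal (b i).1].
apply/mapP; exists f.
  rewrite mem_enum; apply/incrbP => i j ij; rewrite !ffunE /=.
  have := @GT_pos n la i j la_GT; rewrite ij ltn_ord => /(_ erefl).
  have := b i; have := b j; lia.
apply: (@eq_from_nth _ 0); first by rewrite size_map size_enum_ord.
move=> i; rewrite sz => ni.
have := pos_wsig f (Ordinal ni); rewrite /wpos ffunE /= /pos /=.
have := b (Ordinal ni); rewrite /pos /=; lia.
Qed.

Section infinite_cauchy_binet.
Context {R : realType}.

(** The finite formula on the windows [-K, K), followed by K to infinity. The second factor is a
    linear combination because a bordered determinant expands into one; its terms carry Laplace
    signs, so nonnegativity is asked only of the whole combination. *)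
Lemma cauchy_binet_sum n (I : finType) (f : 'I_n -> int -> R) (c : I -> R)
    (g : I -> 'I_n -> int -> R) :
  (forall i k j, bicvg (fun x => f i x * g k j x)) ->
  (forall la, GT n la -> 0 <= \det (\matrix_(i, j) f i (pos la j)) *
     \sum_k c k * \det (\matrix_(i, j) g k j (pos la i))) ->
  \esum_(la in GT n) (\det (\matrix_(i < n, j < n) f i (pos la j)) *
     \sum_k c k * \det (\matrix_(i < n, j < n) g k j (pos la i)))%:E =
  (\sum_k c k * \det (\matrix_(i < n, j < n) bisum (fun x => f i x * g k j x)))%:E.
Proof.
move=> cv ge0; apply: (@esum_seq_lim _ _ _ _ (sigwin n)) => //.
- exact: sigwin_uniq.
- by move=> K x; exact: sigwin_GT.
- by move=> la; exact: mem_sigwin.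
have -> : (fun K => \sum_(la <- sigwin n K) \det (\matrix_(i < n, j < n) f i (pos la j)) *
     \sum_k c k * \det (\matrix_(i < n, j < n) g k j (pos la i))) =
   (fun K => \sum_k c k * \det (\matrix_(i < n, j < n)
       (\sum_(x <- window K) f i x * g k j x))).
  apply/funext => K.
  rewrite (sum_sigwin _ (fun p => \det (\matrix_(i < n, j < n) f i (p j)) *
     \sum_k c k * \det (\matrix_(i < n, j < n) g k j (p i)))).
  under eq_bigr do rewrite mulr_sumr; rewrite exchange_big/=.
  apply: eq_bigr => k _.
  under eq_bigr do rewrite mulrCA; rewrite -mulr_sumr; congr (_ * _).
  rewrite -(cauchy_binet (fun i x => f i (wpos x)) (fun x j => g k j (wpos x))).
  congr (\det _); apply/matrixP => i j; rewrite !mxE.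
  by rewrite -(sum_wpos _ (fun x => f i x * g k j x)).
apply: (cvg_big (op := +%R)); first exact: add_continuous.
move=> k _; apply: cvgMr.
apply: (cvg_det (A := fun K i j => \sum_(x <- window K) f i x * g k j x)) => i j.
exact: window_cvg.
Qed.

Lemma cauchy_binet_esum n (f g : 'I_n -> int -> R) :
  (forall i j, bicvg (fun x => f i x * g j x)) ->
  (forall la, GT n la -> 0 <= \det (\matrix_(i, j) f i (pos la j)) *
     \det (\matrix_(i, j) g j (pos la i))) ->
  \esum_(la in GT n) (\det (\matrix_(i < n, j < n) f i (pos la j)) *
     \det (\matrix_(i < n, j < n) g j (pos la i)))%:E =
  (\det (\matrix_(i < n, j < n) bisum (fun x => f i x * g j x)))%:E.
Proof.
move=> cv ge0.
have := @cauchy_binet_sum n unit f (fun=> 1) (fun=> g).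
rewrite big_const/= card_unit /= addr0 mul1r.
under eq_esum do rewrite big_const/= card_unit /= addr0 mul1r.
apply => // la la_GT.
by rewrite big_const/= card_unit /= addr0 mul1r; exact: ge0.
Qed.

(** The row [v] acts as a further position at minus infinity: for [g j x = ladder a x (pos la j)] it
    is the row at x rescaled by a^x, which no longer changes once x is small enough. *)
Definition bordered n (g : 'I_n.+1 -> int -> R) (v : 'I_n.+1 -> R) (p : nat -> int) :=
  \matrix_(i < n.+1, j < n.+1) (if (i < n)%N then g j (p i) else v j).

Lemma det_bordered n g v p : \det (@bordered n g v p) =
  \sum_k (v k * (-1) ^+ (n + k)) *
    \det (\matrix_(i < n, j < n) g (lift k j) (p i)).
Proof.
rewrite (expand_det_row _ ord_max); apply: eq_bigr => k _.
rewrite mxE /= ltnn -mulrA /cofactor; congr (_ * (_ * \det _)).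
apply/matrixP => i j; rewrite !mxE.
by rewrite lift_max ltn_ord.
Qed.

(** Expansion along the last row on both sides reduces this to [cauchy_binet_sum]. The [insub] views
    a row index below [n] as an element of ['I_n]; it fails exactly on the border row. *)
Lemma cauchy_binet_bordered n (f : 'I_n -> int -> R) (g : 'I_n.+1 -> int -> R)
    (v : 'I_n.+1 -> R) :
  (forall i j, bicvg (fun x => f i x * g j x)) ->
  (forall la, GT n la -> 0 <= \det (\matrix_(i, j) f i (pos la j)) *
     \det (bordered g v (pos la))) ->
  \esum_(la in GT n) (\det (\matrix_(i < n, j < n) f i (pos la j)) *
     \det (bordered g v (pos la)))%:E =
  (\det (\matrix_(i < n.+1, j < n.+1)
     (if insub (i : nat) is Some i' then bisum (fun x => f i' x * g j x) else v j)))%:E.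
Proof.
move=> cv ge0.
under eq_esum do rewrite det_bordered.
rewrite (cauchy_binet_sum (g := fun k j => g (lift k j))); last 2 first.
- by move=> i k j; exact: cv.
- by move=> la la_GT; rewrite -det_bordered; exact: ge0.
congr EFin; rewrite [RHS](expand_det_row _ ord_max); apply: eq_bigr => k _.
rewrite mxE insubN /= ?ltnn// -mulrA /cofactor; congr (_ * (_ * \det _)).
apply/matrixP => i j; rewrite !mxE.
rewrite lift_max insubT//= => ni.
by congr (bisum _); apply/funext => x; congr (f _ _ * _); apply/val_inj.
Qed.

End infinite_cauchy_binet.

(** * Total nonnegativity *)

(** Brings a threshold condition along a monotone sequence into the form [d j <= i] of
    [det_staircase], with [d j] the size of an initial segment. *)
Lemma card_initial n (b : pred 'I_n) :
  (forall i j : 'I_n, (i <= j)%N -> b j -> b i) ->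
  forall i : 'I_n, (#|b| <= i)%N = ~~ b i.
Proof.
move=> bi i.
have card_lt k : (k <= n)%N -> #|[pred j : 'I_n | (j < k)%N]| = k.
  move=> kn; rewrite -sum1_card -(big_ord_widen n (fun=> 1%N))//.
  by rewrite sum1_card card_ord.
apply/idP/idP => [|nbi]; last first.
  rewrite -[leqRHS](card_lt i (ltnW (ltn_ord i))); apply: subset_leq_card.
  apply/fintype.subsetP => j; rewrite !inE => bj; rewrite ltnNge.
  by apply: contra nbi => ij; exact: bi bj.
apply: contraTN => bi'; rewrite -ltnNge -[ltnLHS]/(i.+1.-1).
rewrite prednK// -[leqLHS](card_lt i.+1 (ltn_ord i)); apply: subset_leq_card.
by apply/fintype.subsetP => j; rewrite !inE ltnS => ji; exact: bi bi'.
Qed.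

Section total_nonnegativity.
Context {R : realType}.
Implicit Types (S : set int) (A B : int -> int -> R) (M : int -> R).

Definition incr n (r : 'I_n -> int) := forall i j : 'I_n, (i < j)%N -> r i < r j.

(** [S] constrains the columns only: those of [Psi] are -N, ..., -1, while Toeplitz matrices take
    [setT]. *)
Definition tn S A := forall n (r s : 'I_n -> int),
  incr r -> incr s -> (forall j, S (s j)) ->
  0 <= \det (\matrix_(i < n, j < n) A (r i) (s j)).

Definition toep M (x y : int) : R := M (x - y).

Lemma incr_rev n (r : 'I_n -> int) :
  (forall i j : 'I_n, (i < j)%N -> r j < r i) -> incr (fun i => r (rev_ord i)).
Proof. by move=> ri i j ij; apply: ri => /=; have := ltn_ord j; lia. Qed.

Lemma tn_decr S A : tn S A -> forall n (r s : 'I_n -> int),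
  (forall i j : 'I_n, (i < j)%N -> r j < r i) ->
  (forall i j : 'I_n, (i < j)%N -> s j < s i) -> (forall j, S (s j)) ->
  0 <= \det (\matrix_(i < n, j < n) A (r i) (s j)).
Proof.
move=> tA n r s ri si Ss; rewrite -(det_rev (fun i j => A (r i) (s j))).
by apply: (tA _ (fun i => r (rev_ord i)) (fun i => s (rev_ord i))) => //; exact: incr_rev.
Qed.

Lemma tn_entry S A x y : tn S A -> S y -> 0 <= A x y.
Proof.
move=> tA Sy; have := tA 1%N (fun=> x) (fun=> y).
rewrite det_mx11 mxE; apply=> // i j; rewrite !ord1//.
Qed.

Lemma tn_det2_ge0 S A B n (r s : 'I_n -> int) la : tn setT A -> tn S B ->
  incr r -> incr s -> (forall j, S (s j)) -> GT n la ->
  0 <= \det (\matrix_(i < n, j < n) A (r i) (pos la j)) *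
       \det (\matrix_(i < n, j < n) B (pos la i) (s j)).
Proof.
move=> tA tB ri si Ss la_GT.
have dec : incr (fun i : 'I_n => pos la (rev_ord i)).
  apply: (@incr_rev n (fun i => pos la i)) => i j ij.
  by apply: (GT_pos la_GT); rewrite ij ltn_ord.
rewrite -det_tr (_ : _^T = \matrix_(j, i) A (r i) (pos la j)); last first.
  by apply/matrixP => i j; rewrite !mxE.
rewrite -det_rev_rows2; apply: mulr_ge0; last exact: tB.
rewrite -det_tr (_ : _^T = \matrix_(i, j) A (r i) (pos la (rev_ord j))); last first.
  by apply/matrixP => i j; rewrite !mxE.
exact: tA.
Qed.

(** By Cauchy-Binet over Z, each minor is a sum of products of a minor of [A] and a minor of [B]. *)
Lemma tn_mul S A B : tn setT A -> tn S B ->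
  (forall x y, S y -> bicvg (fun m => A x m * B m y)) ->
  tn S (fun x y => bisum (fun m => A x m * B m y)).
Proof.
move=> tA tB cv n r s ri si Ss; rewrite -lee_fin.
rewrite -(cauchy_binet_esum (f := fun i x => A (r i) x) (g := fun j x => B x (s j))).
- by apply: esum_ge0 => la la_GT; rewrite lee_fin; exact: (tn_det2_ge0 tA tB).
- by move=> i j; exact: cv.
- by move=> la la_GT; exact: (tn_det2_ge0 tA tB).
Qed.

Lemma tn_lim S (A_ : nat -> int -> int -> R) A :
  (forall k, tn S (A_ k)) -> (forall x y, A_ ^~ x ^~ y @ \oo --> A x y) -> tn S A.
Proof.
move=> tA cA n r s ri si Ss.
have := cvg_det (A := fun k i j => A_ k (r i) (s j)) (B := fun i j => A (r i) (s j)).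
move=> /(_ (fun i j => cA _ _)) cd; apply: (cvgr_to_ge cd).
by near=> k; exact: tA.
Unshelve. all: by end_near. Qed.

Lemma tn_flip M : tn setT (toep M) -> tn setT (toep (fun x => M (- x))).
Proof.
move=> tM n r s ri si _; rewrite -det_tr.
rewrite (_ : _^T = \matrix_(i, j) toep M (s i) (r j)); first exact: tM.
by apply/matrixP => i j; rewrite !mxE /toep opprB.
Qed.

Definition delta (x : int) : R := (x == 0)%:R.

Lemma tn_delta : tn setT (toep delta).
Proof.
move=> n r s ri si _.
have [/forallP H|/forallPn[i /existsPn Hi]] :=
    boolP [forall i, exists j, r i == s j]; last first.
  rewrite (det_row0 (i := i)) // => j.
  by rewrite mxE /toep /delta subr_eq0 (negbTE (Hi j)).
have {}H i : {j | r i = s j} by apply: cid; have /existsP[j /eqP] := H i; exists j.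
have e i : r i = s i.
  rewrite (svalP (H i)); congr s; apply: (incr_ord_id (f := fun i => sval (H i))).
  move=> {}i j ij; rewrite ltnNge; apply/negP => ji.
  have := ri _ _ ij; rewrite (svalP (H i)) (svalP (H j)) ltNge => /negP; apply.
  by move: ji; rewrite leq_eqVlt => /orP[/eqP/val_inj->//|/si/ltW].
rewrite (_ : \matrix_(i, j) _ = 1%:M) ?det1 ?ler01//.
apply/matrixP => i j; rewrite !mxE /toep /delta subr_eq0 e; congr (_%:R).
rewrite inj_eq// => x y xy; apply/val_inj/eqP; case: (ltngtP x y) => // /si; rewrite xy ltxx//.
Qed.

(** Expanding the rows shifts each r_i by 0 or 1. Since the r_i are strictly increasing integers,
    the shifted sequence stays weakly increasing: it gives either a minor of the identity or two
    equal rows. *)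
Lemma tn_two (b c : R) : 0 <= b -> 0 <= c ->
  tn setT (toep (fun x => c * delta x + b * delta (x - 1))).
Proof.
move=> b0 c0 n r s ri si _.
have -> : \matrix_(i < n, j < n) toep (fun x => c * delta x + b * delta (x - 1)) (r i) (s j) =
   \matrix_(i < n, j < n) \sum_(e : bool) (if e then b else c) * delta (r i - e%:R - s j).
  apply/matrixP => i j; rewrite !mxE big_bool /toep /= addrC subr0.
  by rewrite -addrA [- s j - 1]addrC addrA.
rewrite (det_sum_rows (fun _ e => if e then b else c)
   (fun i (e : bool) j => delta (r i - e%:R - s j))).
apply: sumr_ge0 => f _; apply: mulr_ge0; first by apply: prodr_ge0 => i _; case: ifP.
have [/forallP H|/forallPn[i /forallPn[j]]] := boolP [forall i : 'I_n, forall j : 'I_n,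
    (i < j)%N ==> (r i - (f i)%:R < r j - (f j)%:R)].
  apply: (@tn_delta n (fun i => r i - (f i)%:R)) => // i j ij.
  by have /forallP/(_ j)/implyP := H i; exact.
rewrite negb_imply => /andP[ij]; rewrite -leNgt => rij.
rewrite (@det_eq_rows _ _ _ i j)//; first by rewrite -val_eqE /= neq_ltn ij.
move=> k; rewrite !mxE; congr (delta (_ - _)).
by have := ri _ _ ij; move: rij; case: (f i); case: (f j) => /=; lia.
Qed.

Lemma det_ge_indicator n (r s : 'I_n -> int) (u : 'I_n -> R) : incr r -> incr s ->
  (forall i, 0 <= u i) ->
  0 <= \det (\matrix_(i < n, j < n) (if s j <= r i then u i else 0)).
Proof.
move=> ri si u0; pose d j := #|[pred i | r i < s j]|.
have mono (i j : 'I_n) : (i <= j)%N -> r i <= r j.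
  by rewrite leq_eqVlt => /orP[/eqP/val_inj->//|/ri/ltW].
have dE (i j : 'I_n) : (d j <= i)%N = (s j <= r i).
  rewrite /d card_initial /= ?leNgt// => {}i i' ii' /=.
  by apply: le_lt_trans; exact: mono.
rewrite (_ : \matrix_(i, j) _ = \matrix_(i, j) (if (d j <= i)%N then u i else 0)).
  rewrite det_staircase; first by case: ifP => // _; apply: prodr_ge0.
  move=> j j'; rewrite leq_eqVlt => /orP[/eqP/val_inj->//|/si jj'].
  by apply/subset_leq_card/fintype.subsetP => i; rewrite !inE => /lt_trans; exact.
by apply/matrixP => i j; rewrite !mxE dE.
Qed.

(** The power q^(r_i - s_j) splits into a row factor and a column factor, leaving the indicator of
    s_j <= r_i, which is a staircase. *)
Lemma tn_geom (p q : R) : 0 <= p -> 0 < q ->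
  tn setT (toep (fun x => if 0 <= x then p * q ^ x else 0)).
Proof.
move=> p0 q0 n r s ri si _.
rewrite (_ : \matrix_(i, j) _ = \matrix_(i, j)
   ((if s j <= r i then p * q ^ r i else 0) * q ^ (- s j))).
  rewrite (det_scale_cols (fun i j => if s j <= r i then p * q ^ r i else 0)).
  apply: mulr_ge0; last by apply: prodr_ge0 => j _; rewrite exprz_ge0// ltW.
  apply: det_ge_indicator => // i; rewrite mulr_ge0// exprz_ge0// ltW//.
apply/matrixP => i j; rewrite !mxE /toep subr_ge0; case: ifP => _; last by rewrite mul0r.
by rewrite -mulrA -expfzDr// gt_eqF.
Qed.

End total_nonnegativity.

(** * The two skew Cauchy identities *)

Section skew_schur_identities.
Context {R : realType}.
Implicit Types (M Q : int -> R) (la mu nu ka : seq int).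

Lemma skew_schurE n M la mu : size la = n ->
  skew_schur M la mu = \det (\matrix_(i < n, j < n) M (pos la i - pos mu j)).
Proof.
move=> <-; congr (\det _); apply/matrixP => i j; rewrite !mxE /pos; congr M.
by rewrite opprB; lia.
Qed.

Lemma skew_schur_ge0 n M la mu : tn setT (toep M) -> GT n la -> GT n mu ->
  0 <= skew_schur M la mu.
Proof.
move=> tM la_GT mu_GT; rewrite (skew_schurE _ _ (proj1 la_GT)).
apply: (@tn_decr _ setT (toep M) tM n (fun i => pos la i) (fun j => pos mu j)) => // i j ij.
  by apply: (GT_pos la_GT); rewrite ij ltn_ord.
by apply: (GT_pos mu_GT); rewrite ij ltn_ord.
Qed.

Lemma skew_schur1_ge0 (a : R) la mu : 0 < a -> 0 <= skew_schur1 a la mu.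
Proof. by move=> a0; rewrite /skew_schur1; case: ifP => // _; rewrite exprz_ge0// ltW. Qed.

(** The coefficient of u^(y - x) in 1/(1 - a u). *)
Definition ladder (a : R) (x y : int) : R := if x <= y then a ^ (y - x) else 0.

Lemma ladder_ge0 a x y : 0 < a -> 0 <= ladder a x y.
Proof. by move=> a0; rewrite /ladder; case: ifP => // _; rewrite exprz_ge0// ltW. Qed.

Lemma ladder_le a x y : 0 < a -> ladder a x y <= a ^ (y - x).
Proof. by move=> a0; rewrite /ladder; case: ifP => // _; rewrite exprz_ge0// ltW. Qed.

Lemma prod_expz (I : Type) (r : seq I) (a : R) (F : I -> int) : a != 0 ->
  \prod_(i <- r) a ^ F i = a ^ (\sum_(i <- r) F i).
Proof.
move=> a0; elim: r => [|i r IH]; first by rewrite !big_nil expr0z.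
by rewrite !big_cons IH expfzDr.
Qed.

Lemma sig_sumE n la : size la = n -> sig_sum la = \sum_(i < n) la`_i.
Proof. by move=> <-; rewrite /sig_sum (big_nth 0) big_mkord. Qed.

(** After scaling rows and columns by powers of [a], the bordered matrix is a staircase in which
    [d j] counts the parts of [mu] positioned above that of la_j; interlacing says exactly that d j
    = j. The virtual row n is full because d j <= n. The factor a^n restores the shifts: those of
    [la] add up to n more than those of [mu]. *)
Lemma skew_schur1E n (a : R) la mu : 0 < a -> GT n.+1 la -> GT n mu ->
  skew_schur1 a la mu = a ^ n *
   \det (@bordered _ n (fun j x => ladder a x (pos la j)) (fun j => a ^ pos la j) (pos mu)).
Proof.
move=> a0 la_GT mu_GT; have an0 : a != 0 by rewrite gt_eqF.
pose d (j : 'I_n.+1) := #|[pred i : 'I_n | pos la j < pos mu i]|.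
have dle j : (d j <= n)%N by rewrite -[leqRHS]card_ord; exact: max_card.
have dE (i : 'I_n) j : (d j <= i)%N = (pos mu i <= pos la j).
  rewrite /d card_initial /= ?leNgt// => {}i i' ii' /= /lt_le_trans; apply.
  by move: ii'; rewrite leq_eqVlt => /orP[/eqP->//|ii']; apply/ltW/(GT_pos mu_GT); rewrite ii' /=.
pose u (i : 'I_n.+1) : R := if (i < n)%N then a ^ (- pos mu i) else 1.
rewrite (_ : bordered _ _ _ =
    \matrix_(i, j) ((if (d j <= i)%N then u i else 0) * a ^ pos la j)); last first.
  apply/matrixP => i j; rewrite !mxE /u; case: ifPn => [ni|].
    rewrite (dE (Ordinal ni)) /ladder /=; case: ifP => _; last by rewrite mul0r.
    by rewrite -expfzDr// addrC.
  by rewrite -leqNgt => /(leq_trans (dle j)) ->; rewrite mul1r.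
rewrite (det_scale_cols (fun i j => if (d j <= i)%N then u i else 0)) det_staircase; last first.
  move=> j j'; rewrite leq_eqVlt => /orP[/eqP/val_inj->//|jj'].
  apply/subset_leq_card/fintype.subsetP => i; rewrite !inE; apply: lt_trans.
  by apply: (GT_pos la_GT); rewrite jj' ltn_ord.
rewrite /skew_schur1.
have -> : interlaces la mu = [forall j, d j == j].
  apply/forallP/forallP => [H j|H].
    rewrite eqn_leq; apply/andP; split.
      have [jn|] := ltnP j n; last exact: leq_trans.
      have ni : (j < size mu)%N by rewrite (proj1 mu_GT).
      by rewrite (dE (Ordinal jn)) /pos /=; have /andP[_ /=] := H (Ordinal ni); lia.
    case: j => -[//|j] jn /=; rewrite ltnNge.
    have ni : (j < size mu)%N by rewrite (proj1 mu_GT).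
    rewrite (dE (Ordinal (jn : (j < n)%N))) /pos /= -ltNge.
    by have /andP[/= + _] := H (Ordinal ni); lia.
  rewrite (proj1 mu_GT) => i; have ni := ltn_ord i.
  have /eqP := H (widen_ord (leqnSn n) i); have /eqP := H (lift ord0 i).
  rewrite lift0 /= => e1 e2; apply/andP; split.
    have : ~~ (d (lift ord0 i) <= i)%N by rewrite e1 ltnn.
    by rewrite dE /pos lift0 -ltNge; move: (la`_i.+1) (mu`_i) => x y; lia.
  have : (d (widen_ord (leqnSn n) i) <= i)%N by rewrite e2.
  by rewrite dE /pos /=; lia.
case: ifP => _; last by rewrite mul0r mulr0.
rewrite big_ord_recr /= {2}/u ltnn mulr1.
rewrite (eq_bigr (fun i : 'I_n => a ^ (- pos mu i))); last by move=> i _; rewrite /u /= ltn_ord.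
rewrite !prod_expz// -!expfzDr//; congr (a ^ _).
rewrite (sig_sumE (proj1 la_GT)) (sig_sumE (proj1 mu_GT)) sumrN /pos !sumrB.
rewrite [X in _ + (_ - X)]big_ord_recr /=; ring.
Qed.

Lemma asummableM (f g : int -> R) : asummable f -> asummable g -> asummable (fun x => f x * g x).
Proof.
move=> cf cg.
have gfin : \esum_(x in [set: int]) `|g x|%:E \is a fin_num.
  by rewrite ge0_fin_numE// esum_ge0// => x _; rewrite lee_fin.
apply: (le_asummable (g := fun x => fine (\esum_(x in [set: int]) `|g x|%:E) * f x)).
  move=> x; rewrite !normrM mulrC ler_wpM2r//.
  rewrite -lee_fin; apply: (@le_trans _ _ (\esum_(x in [set: int]) `|g x|%:E)).
    by apply: (@esum_ge_term _ _ setT (fun x => `|g x|%:E)); rewrite ?lee_fin.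
  by rewrite -[leLHS]fineK// lee_fin ler_norm.
exact: asummableZ.
Qed.

Lemma asummable_shift (f : int -> R) c : asummable f -> asummable (fun x => f (x - c)).
Proof. exact: (asummable_reindex (set_bij_shift c)). Qed.

Lemma asummable_reflect (f : int -> R) c : asummable f -> asummable (fun x => f (c - x)).
Proof. exact: (asummable_reindex (set_bij_reflect c)). Qed.

Lemma toep_ge0 M x : tn setT (toep M) -> 0 <= M x.
Proof. by move=> /(@tn_entry _ setT _ x 0); rewrite /toep subr0; exact. Qed.

(** Cauchy-Binet turns both sides into determinants of n by n matrices of series. Their entries
    agree under the reflection of x into [pos la i + pos mu j - x], whose centre depends on the
    entry. *)
Lemma skew_cauchy_MM n M1 M2 la mu : tn setT (toep M1) -> tn setT (toep M2) ->
  asummable M1 -> asummable M2 -> GT n la -> GT n mu ->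
  (\esum_(nu in GT n) (skew_schur M1 nu la * skew_schur M2 nu mu)%:E < +oo)%E /\
  \esum_(nu in GT n) (skew_schur M1 nu la * skew_schur M2 nu mu)%:E =
  \esum_(ka in GT n) (skew_schur M1 mu ka * skew_schur M2 la ka)%:E.
Proof.
move=> t1 t2 s1 s2 la_GT mu_GT.
pose D := \det (\matrix_(i < n, j < n) bisum (fun x => M1 (x - pos la i) * M2 (x - pos mu j))).
have bic i j : bicvg (fun x => M1 (x - pos la i) * M2 (x - pos mu j)).
  by apply/asummable_bicvg/asummableM; exact: asummable_shift.
have Mge0 i j x : 0 <= M1 (x - pos la i) * M2 (x - pos mu j).
  by apply: mulr_ge0; exact: toep_ge0.
have E1 : \esum_(nu in GT n) (skew_schur M1 nu la * skew_schur M2 nu mu)%:E = D%:E.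
  have W nu : GT n nu -> skew_schur M1 nu la * skew_schur M2 nu mu =
      \det (\matrix_(i < n, j < n) M1 (pos nu j - pos la i)) *
      \det (\matrix_(i < n, j < n) M2 (pos nu i - pos mu j)).
    move=> nu_GT; rewrite !(skew_schurE _ _ (proj1 nu_GT)) -det_tr; congr (\det _ * _).
    by apply/matrixP => i j; rewrite !mxE.
  under eq_esum => nu nu_GT do rewrite W//.
  rewrite (cauchy_binet_esum (f := fun i x => M1 (x - pos la i))
    (g := fun j x => M2 (x - pos mu j)))// => nu nu_GT.
  by rewrite -W//; apply: mulr_ge0; exact: (@skew_schur_ge0 n).
split; first by rewrite E1 ltry.
rewrite E1; apply/esym.
have W ka : GT n ka -> skew_schur M1 mu ka * skew_schur M2 la ka =
    \det (\matrix_(i < n, j < n) M2 (pos la i - pos ka j)) *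
    \det (\matrix_(i < n, j < n) M1 (pos mu j - pos ka i)).
  move=> ka_GT; rewrite (skew_schurE _ _ (proj1 mu_GT)) (skew_schurE _ _ (proj1 la_GT)) mulrC.
  by rewrite -[\det (\matrix_(i, j) M1 _)]det_tr; congr (_ * \det _); apply/matrixP => i j; rewrite !mxE.
under eq_esum => ka ka_GT do rewrite W//.
have re (i j : 'I_n) : (fun x => M2 (pos la i - x) * M1 (pos mu j - x)) =
   (fun x => M1 (x - pos la i) * M2 (x - pos mu j)) \o (fun x => pos la i + pos mu j - x).
  by apply/funext => x /=; rewrite mulrC; congr (M1 _ * M2 _); lia.
rewrite (cauchy_binet_esum (f := fun i x => M2 (pos la i - x))
    (g := fun j x => M1 (pos mu j - x))).
- congr (\det _)%:E; apply/matrixP => i j; rewrite !mxE re.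
  exact: (ge0_bisum_reindex (Mge0 i j) (bic i j) (set_bij_reflect _)).2.
- by move=> i j; rewrite re; exact: (ge0_bisum_reindex (Mge0 i j) (bic i j) (set_bij_reflect _)).1.
- by move=> ka ka_GT; rewrite -W//; apply: mulr_ge0; exact: (@skew_schur_ge0 n).
Qed.

(** The virtual row is an eigenvector: summing a^x against [Q (x - pos mu j)] gives H(Q;a) times
    a^(pos mu j). So the row comes back with the factor H(Q;a), and the remaining rows agree by the
    same reflection as in [skew_cauchy_MM]. *)
Lemma skew_cauchy_aM n (a : R) Q la mu : 0 < a -> tn setT (toep Q) ->
  asummable (fun x => Q x * a ^ x) -> GT n la -> GT n.+1 mu ->
  (\esum_(nu in GT n.+1) (skew_schur1 a nu la * skew_schur Q nu mu)%:E < +oo)%E /\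
  \esum_(nu in GT n.+1) (skew_schur1 a nu la * skew_schur Q nu mu)%:E =
  ((bisum (fun x => Q x * a ^ x))%:E *
  \esum_(ka in GT n) (skew_schur1 a mu ka * skew_schur Q la ka)%:E)%E.
Proof.
move=> a0 tQ sQ la_GT mu_GT; have an0 : a != 0 by rewrite gt_eqF.
have Q0 x : 0 <= Q x by exact: toep_ge0.
have anle : 0 <= a ^ n by rewrite exprz_ge0// ltW.
set H := bisum (fun x => Q x * a ^ x).
have sQm j : asummable (fun x => a ^ x * Q (x - pos mu j)).
  apply: (le_asummable (g := fun x => a ^ pos mu j * (Q (x - pos mu j) * a ^ (x - pos mu j)))).
    by move=> x; rewrite mulrCA -expfzDr// subrKC mulrC.
  exact: asummableZ (asummable_shift (pos mu j) sQ).
have bisum_last j : bisum (fun x => a ^ x * Q (x - pos mu j)) = H * a ^ pos mu j.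
  have Qa0 x : 0 <= Q x * a ^ x by rewrite mulr_ge0// exprz_ge0// ltW.
  have [c2 e2] := ge0_bisum_reindex Qa0 (asummable_bicvg sQ) (set_bij_shift (pos mu j)).
  rewrite mulrC -[H]e2 -bisumZ//; congr bisum; apply/funext => x /=.
  by rewrite mulrCA -expfzDr// subrKC mulrC.
have slad (i : nat) (j : nat) : asummable (fun x => ladder a (pos la i) x * Q (x - pos mu j)).
  apply: (le_asummable (g := fun x => a ^ (- pos la i) * (a ^ x * Q (x - pos mu j)))).
    move=> x; rewrite mulrA -expfzDr// !normrM ler_wpM2r//.
    rewrite [- _ + x]addrC (ger0_norm (ladder_ge0 _ _ a0)) ger0_norm ?exprz_ge0 ?(ltW a0)//.
    exact: ladder_le.
  exact: asummableZ.
pose B : 'M[R]_n.+1 := \matrix_(i, j) (if (i < n)%N then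
   bisum (fun x => ladder a (pos la i) x * Q (x - pos mu j)) else a ^ pos mu j).
have E1 : \esum_(nu in GT n.+1) (skew_schur1 a nu la * skew_schur Q nu mu)%:E =
          (a ^ n * (H * \det B))%:E.
  pose f (i : 'I_n.+1) x := if (i < n)%N then ladder a (pos la i) x else a ^ x.
  have W nu : GT n.+1 nu -> skew_schur1 a nu la * skew_schur Q nu mu =
      a ^ n * (\det (\matrix_(i < n.+1, j < n.+1) f i (pos nu j)) *
      \det (\matrix_(i < n.+1, j < n.+1) Q (pos nu i - pos mu j))).
    move=> nu_GT; rewrite (skew_schurE _ _ (proj1 nu_GT)) (skew_schur1E a0 nu_GT la_GT) mulrA.
    by congr (_ * \det _ * _); apply/matrixP => i j; rewrite !mxE.
  have W0 nu : GT n.+1 nu -> 0 <= \det (\matrix_(i < n.+1, j < n.+1) f i (pos nu j)) *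
      \det (\matrix_(i < n.+1, j < n.+1) Q (pos nu i - pos mu j)).
    move=> nu_GT; have an : 0 < a ^ n by rewrite exprz_gt0.
    rewrite -(pmulr_rge0 _ an) -W//; apply: mulr_ge0; first exact: skew_schur1_ge0.
    exact: (@skew_schur_ge0 n.+1).
  under eq_esum => nu nu_GT do rewrite W// EFinM.
  rewrite (ge0_esumZl anle); last by move=> nu nu_GT; rewrite lee_fin W0.
  rewrite (cauchy_binet_esum (f := f) (g := fun j x => Q (x - pos mu j)))//; last first.
    move=> i j; apply: asummable_bicvg; by rewrite /f; case: (i < n)%N.
  rewrite -EFinM; congr ((_ * _)%:E).
  rewrite -det_tr (_ : _^T = \matrix_(i < n.+1, j < n.+1)
     (B j i * (if (j < n)%N then 1 else H))); last first.
    apply/matrixP => i j; rewrite !mxE /f; case: (j < n)%N; first by rewrite mulr1.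
    by rewrite bisum_last mulrC.
  rewrite (det_scale_cols (fun i j => B j i)) -det_tr mulrC big_ord_recr /= ltnn.
  rewrite big1 ?mul1r; last by move=> i _; rewrite ltn_ord.
  by congr (_ * \det _); apply/matrixP => i j; rewrite !mxE.
split; first by rewrite E1 ltry.
rewrite E1 mulrCA EFinM; congr (_ * _)%E; apply/esym.
have W ka : GT n ka -> skew_schur1 a mu ka * skew_schur Q la ka =
    a ^ n * (\det (\matrix_(i < n, j < n) Q (pos la i - pos ka j)) *
     \det (@bordered _ n (fun j x => ladder a x (pos mu j)) (fun j => a ^ pos mu j) (pos ka))).
  move=> ka_GT; rewrite (skew_schurE _ _ (proj1 la_GT)) (skew_schur1E a0 mu_GT ka_GT).
  by rewrite -mulrA [X in _ * X = _]mulrC.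
have W0 ka : GT n ka -> 0 <= \det (\matrix_(i < n, j < n) Q (pos la i - pos ka j)) *
     \det (@bordered _ n (fun j x => ladder a x (pos mu j)) (fun j => a ^ pos mu j) (pos ka)).
  move=> ka_GT; have an : 0 < a ^ n by rewrite exprz_gt0.
  rewrite -(pmulr_rge0 _ an) -W//; apply: mulr_ge0; first exact: skew_schur1_ge0.
  exact: (@skew_schur_ge0 n).
under eq_esum => ka ka_GT do rewrite W// EFinM.
rewrite (ge0_esumZl anle); last by move=> ka ka_GT; rewrite lee_fin W0.
have re (i : nat) (j : 'I_n.+1) : (fun x => Q (pos la i - x) * ladder a x (pos mu j)) =
   (fun x => ladder a (pos la i) x * Q (x - pos mu j)) \o (fun x => pos la i + pos mu j - x).
  apply/funext => x /=; rewrite mulrC; congr (_ * Q _); last by lia.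
  by rewrite /ladder (_ : (pos la i <= _) = (x <= pos mu j)); [congr (if _ then a ^ _ else _)|]; lia.
have Mge0 (i : nat) (j : 'I_n.+1) x : 0 <= ladder a (pos la i) x * Q (x - pos mu j).
  by rewrite mulr_ge0// ladder_ge0.
have rei (i : nat) (j : 'I_n.+1) :=
  ge0_bisum_reindex (Mge0 i j) (asummable_bicvg (slad i j)) (set_bij_reflect (pos la i + pos mu j)).
rewrite (cauchy_binet_bordered (f := fun i x => Q (pos la i - x))
    (g := fun j x => ladder a x (pos mu j)))//; last first.
  by move=> i j; rewrite re; exact: (rei i j).1.
rewrite -EFinM; congr ((_ * \det _)%:E); apply/matrixP => i j; rewrite !mxE.
case: insubP => [i' -> e|/negbTE ->//]; rewrite -e re; exact: (rei i' j).2.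
Qed.

End skew_schur_identities.

(** * Exchange of sums, absolute summability and convolution *)

Lemma esum_swap (R : realType) (T1 T2 : choiceType) (I : set T1) (J : set T2)
    (f : T1 -> T2 -> \bar R) :
  (forall i j, I i -> J j -> 0 <= f i j)%E ->
  (\esum_(i in I) \esum_(j in J) f i j = \esum_(j in J) \esum_(i in I) f i j)%E.
Proof.
move=> f0; rewrite esum_esum// esum_esum; last by move=> j i Jj Ii; exact: f0.
have sb : set_bij (J `*` I) (I `*` J) (fun p => (p.2, p.1)).
  split=> [[j i] /= [] //|[j i] [j' i'] /= _ _ [-> ->]//|[i j] /= [Ii Jj]].
  by exists (j, i).
by rewrite -[I `*`` _]/(I `*` J) (reindex_esum _ _ _ _ sb).
Qed.

Section convolution.
Context {R : realType}.
Implicit Types f g h : int -> R.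

Lemma asummableD f g : asummable f -> asummable g -> asummable (fun x => f x + g x).
Proof.
rewrite /asummable => cf cg; apply: le_lt_trans (lte_add_pinfty cf cg).
rewrite -esumD; [|by move=> *; rewrite lee_fin..].
by apply: le_esum => x _; rewrite -EFinD lee_fin ler_normD.
Qed.

Lemma asummableN f : asummable f -> asummable (fun x => - f x).
Proof. by apply: le_asummable => x; rewrite normrN. Qed.

Lemma bisumB f g : bicvg f -> bicvg g -> bisum (fun x => f x - g x) = bisum f - bisum g.
Proof.
move=> cf cg; rewrite (_ : (fun x => f x - g x) = f \+ (fun x => -1 * g x)).
  by rewrite bisumD ?bisumZ ?mulN1r//; exact: bicvgZ.
by apply/funext => x /=; rewrite mulN1r.
Qed.

(** Positive and negative parts; they reduce identities between signed series to the nonnegative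
    case, where sums can be exchanged freely. *)
Lemma asummable_split f : asummable f -> exists f1 f2 : int -> R,
  [/\ (forall x, 0 <= f1 x), (forall x, 0 <= f2 x), asummable f1, asummable f2 &
      f = fun x => f1 x - f2 x].
Proof.
move=> cf; exists (fun x => 2^-1 * (`|f x| + f x)), (fun x => 2^-1 * (`|f x| - f x)).
have cn : asummable (fun x => `|f x|) by apply: le_asummable cf => x; rewrite normr_id.
split.
- by move=> x; have := ler_norm (- f x); rewrite normrN; lra.
- by move=> x; have := ler_norm (f x); lra.
- exact/asummableZ/asummableD.
- exact/asummableZ/asummableD/asummableN.
- by apply/funext => x; lra.
Qed.

Lemma bisum_reindex (e : int -> int) f : asummable f -> set_bij setT setT e ->
  bisum (f \o e) = bisum f.
Proof.
move=> /asummable_split[f1 [f2 [p1 p2 c1 c2 ->]]] eb.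
have [b1 e1] := ge0_bisum_reindex p1 (asummable_bicvg c1) eb.
have [b2 e2] := ge0_bisum_reindex p2 (asummable_bicvg c2) eb.
rewrite [X in bisum X](_ : _ = fun x => (f1 \o e) x - (f2 \o e) x)//.
by rewrite !bisumB ?e1 ?e2//; exact: asummable_bicvg.
Qed.

Definition conv f g (n : int) : R := bisum (fun m => f (n - m) * g m).

Lemma asummable_conv_term f g n : asummable f -> asummable g ->
  asummable (fun m => f (n - m) * g m).
Proof. by move=> cf cg; apply: asummableM => //; exact: asummable_reflect. Qed.

Lemma bicvg_conv f g n : asummable f -> asummable g -> bicvg (fun m => f (n - m) * g m).
Proof. by move=> cf cg; exact/asummable_bicvg/asummable_conv_term. Qed.

Lemma conv_ge0 f g : (forall x, 0 <= f x) -> (forall x, 0 <= g x) ->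
  asummable f -> asummable g -> forall n, 0 <= conv f g n.
Proof.
by move=> f0 g0 cf cg n; apply: bisum_ge0; [move=> m; exact: mulr_ge0|exact: bicvg_conv].
Qed.

Lemma ge0_bisum_conv f g : (forall x, 0 <= f x) -> (forall x, 0 <= g x) ->
  asummable f -> asummable g ->
  asummable (conv f g) /\ bisum (conv f g) = bisum f * bisum g.
Proof.
move=> f0 g0 cf cg.
have E : \esum_(n in [set: int]) (conv f g n)%:E = (bisum f * bisum g)%:E.
  transitivity (\esum_(n in [set: int]) \esum_(m in [set: int]) (f (n - m) * g m)%:E).
    apply: eq_esum => n _; rewrite ge0_bisum_esum//; last exact: bicvg_conv.
    by move=> m; exact: mulr_ge0.
  rewrite esum_swap; last by move=> i j _ _; rewrite lee_fin mulr_ge0.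
  transitivity (\esum_(m in [set: int]) ((bisum f)%:E * (g m)%:E)%E).
    apply: eq_esum => m _.
    under eq_esum do rewrite mulrC EFinM.
    rewrite (ge0_esumZl (g0 m)); last by move=> x _; rewrite lee_fin.
    rewrite muleC; congr (_ * _)%E.
    rewrite -(ge0_bisum_esum f0); last exact: asummable_bicvg.
    by rewrite [RHS](reindex_esum _ _ _ _ (set_bij_shift m)).
  rewrite ge0_esumZl; last 2 first.
  - by apply: bisum_ge0 => //; exact: asummable_bicvg.
  - by move=> x _; rewrite lee_fin.
  by rewrite ge0_bisum_esum// ?EFinM//; exact: asummable_bicvg.
have s : asummable (conv f g).
  rewrite /asummable (eq_esum (b := fun x => (conv f g x)%:E)) ?E ?ltry// => x _.
  by rewrite ger0_norm// conv_ge0.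
split=> //; apply: EFin_inj; rewrite -E -ge0_bisum_esum//.
  exact: conv_ge0.
exact: asummable_bicvg.
Qed.

Lemma conv_subl f1 f2 g : asummable f1 -> asummable f2 -> asummable g ->
  conv (fun x => f1 x - f2 x) g = fun n => conv f1 g n - conv f2 g n.
Proof.
move=> c1 c2 cg; apply/funext => n; rewrite /conv -bisumB; [|exact: bicvg_conv..].
by congr bisum; apply/funext => m; rewrite mulrBl.
Qed.

Lemma conv_subr f g1 g2 : asummable f -> asummable g1 -> asummable g2 ->
  conv f (fun x => g1 x - g2 x) = fun n => conv f g1 n - conv f g2 n.
Proof.
move=> cf c1 c2; apply/funext => n; rewrite /conv -bisumB; [|exact: bicvg_conv..].
by congr bisum; apply/funext => m; rewrite mulrBr.
Qed.

Lemma bisum_conv f g : asummable f -> asummable g ->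
  asummable (conv f g) /\ bisum (conv f g) = bisum f * bisum g.
Proof.
move=> /asummable_split[f1 [f2 [p1 p2 c1 c2 ->]]].
have H h : (forall x, 0 <= h x) -> asummable h ->
    asummable (conv (fun x => f1 x - f2 x) h) /\
    bisum (conv (fun x => f1 x - f2 x) h) = bisum (fun x => f1 x - f2 x) * bisum h.
  move=> h0 ch; rewrite conv_subl//.
  have [s1 e1] := ge0_bisum_conv p1 h0 c1 ch.
  have [s2 e2] := ge0_bisum_conv p2 h0 c2 ch.
  split; first exact/asummableD/asummableN.
  by rewrite !bisumB ?e1 ?e2 ?mulrBl//; exact: asummable_bicvg.
have c12 : asummable (fun x => f1 x - f2 x) by exact/asummableD/asummableN.
move=> /asummable_split[g1 [g2 [q1 q2 d1 d2 ->]]].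
have [s1 e1] := H _ q1 d1; have [s2 e2] := H _ q2 d2.
rewrite conv_subr//; split; first exact/asummableD/asummableN.
rewrite [in LHS]bisumB; [|exact: asummable_bicvg..].
rewrite e1 e2 -mulrBr; congr (_ * _); rewrite bisumB//; exact: asummable_bicvg.
Qed.

Lemma asummable_halves f : cvgn (series (fun n => `|f (Posz n)|)) ->
  cvgn (series (fun n => `|f (Negz n)|)) -> asummable f.
Proof.
move=> c1 c2; apply: (le_asummable (g := fun x => `|f x|)).
  by move=> x; rewrite normr_id.
exact: ge0_asummable.
Qed.

Lemma asummable_between h (ra rb r : R) : 0 < ra -> ra <= r -> r <= rb ->
  asummable (fun n => h n * ra ^ n) -> asummable (fun n => h n * rb ^ n) ->
  asummable (fun n => h n * r ^ n).
Proof.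
move=> ra0 ar rrb ca cb.
have r0 : 0 < r by exact: lt_le_trans ar.
have rb0 : 0 < rb by exact: lt_le_trans rrb.
have cn k : asummable (fun n => h n * k ^ n) -> asummable (fun n => `|h n * k ^ n|).
  by apply: le_asummable => x; rewrite normr_id.
apply: (le_asummable (g := fun n => `|h n * ra ^ n| + `|h n * rb ^ n|)); last first.
  by apply: asummableD; exact: cn.
move=> n; rewrite [leRHS]ger0_norm ?addr_ge0// !normrM -mulrDr ler_wpM2l//.
have [ra0' r0' rb0'] := And3 (ltW ra0) (ltW r0) (ltW rb0).
rewrite !ger0_norm ?exprz_ge0//.
case: n => n; rewrite ?NegzE -?exprnP -?exprnN.
  by rewrite ler_wpDl ?exprn_ge0// lerXn2r ?nnegrE.
rewrite ler_wpDr ?invr_ge0 ?exprn_ge0//.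
by rewrite lef_pV2 ?posrE ?exprn_gt0// lerXn2r ?nnegrE.
Qed.

(** Abel's argument. The terms of the positive half at [rb] and of the negative half at [ra] are
    bounded, so at [r] the halves are dominated by geometric series of ratios r / rb and ra / r. *)
Lemma asummable_inside h (ra rb r : R) : 0 < ra -> ra < r -> r < rb ->
  bicvg (fun n => h n * ra ^ n) -> bicvg (fun n => h n * rb ^ n) ->
  asummable (fun n => h n * r ^ n).
Proof.
move=> ra0 ar rrb [_ ca] [cb _].
have r0 : 0 < r by exact: lt_trans ar.
have rb0 : 0 < rb by exact: lt_trans rrb.
have geo (u : nat -> R) (q : R) : cvgn (series u) -> 0 <= q < 1 ->
    cvgn (series (fun n => `|u n| * q ^+ n)).
  move=> cu /andP[q0 q1].
  have /cvg_seq_bounded[B [_ HB]] : cvgn u by apply/cvg_ex; exists 0; exact: cvg_series_cvg_0.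
  have {}HB n : `|u n| <= `|B| + 1.
    by apply: HB => //; rewrite (le_lt_trans (ler_norm B))// ltrDl.
  apply: (series_le_cvg (v_ := geometric (`|B| + 1) q)).
  - by move=> n; rewrite mulr_ge0// exprn_ge0.
  - by move=> n; rewrite mulr_ge0 ?addr_ge0// exprn_ge0.
  - by move=> n; rewrite /geometric /= ler_wpM2r ?exprn_ge0.
  - by apply: is_cvg_geometric_series; rewrite ger0_norm.
apply: asummable_halves.
  have := geo _ (r / rb) cb; rewrite divr_ge0 ?ltW// ltr_pdivrMr// mul1r rrb => /(_ erefl).
  rewrite (_ : (fun n => _ * _) = fun n => `|h (Posz n) * r ^ (Posz n)|)//.
  apply/funext => n; rewrite !normrM -mulrA; congr (_ * _).
  rewrite -!exprnP !ger0_norm ?exprn_ge0 ?ltW// expr_div_n mulrCA mulfV ?mulr1//.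
  by rewrite expf_neq0// gt_eqF.
have := geo _ (ra / r) ca; rewrite divr_ge0 ?ltW// ltr_pdivrMr// mul1r ar => /(_ erefl) cc.
apply: (series_le_cvg (v_ := fun n => `|h (Negz n) * ra ^ Negz n| * (ra / r) ^+ n)) => //.
- by move=> n; rewrite mulr_ge0// exprn_ge0// divr_ge0 ?ltW.
- move=> n; rewrite !normrM -mulrA ler_wpM2l//.
  rewrite NegzE -!exprnN !ger0_norm ?invr_ge0 ?exprn_ge0 ?(ltW r0) ?(ltW ra0)//.
  rewrite (_ : ra ^- n.+1 * _ = ra^-1 * r ^- n).
    rewrite exprS invfM ler_wpM2r ?invr_ge0 ?exprn_ge0 ?(ltW r0)//.
    by rewrite lef_pV2 ?posrE// ltW.
  rewrite expr_div_n exprS; field.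
  by rewrite !expf_neq0 ?gt_eqF.
Qed.

End convolution.

(** * Complex Laurent series through real and imaginary parts *)

Section complex_series.
Context {R : realType}.
Implicit Types (z u : Cx R) (h g : int -> R).

Definition cRe z : R := complex.Re z.
Definition cIm z : R := complex.Im z.
(** The norm of [Cx R] takes values in [Cx R] itself; this real version gives access to the order
    and the analysis of [R]. *)
Definition cnorm z : R := cRe `|z|.

Definition mkCx (x y : R) : Cx R := (x +i* y)%C.

Lemma cReD z1 z2 : cRe (z1 + z2) = cRe z1 + cRe z2. Proof. by case: z1; case: z2. Qed.
Lemma cImD z1 z2 : cIm (z1 + z2) = cIm z1 + cIm z2. Proof. by case: z1; case: z2. Qed.
Lemma cReM z1 z2 : cRe (z1 * z2) = cRe z1 * cRe z2 - cIm z1 * cIm z2.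
Proof. by case: z1; case: z2. Qed.
Lemma cImM z1 z2 : cIm (z1 * z2) = cRe z1 * cIm z2 + cIm z1 * cRe z2.
Proof. by case: z1; case: z2. Qed.
Lemma cReB z1 z2 : cRe (z1 - z2) = cRe z1 - cRe z2. Proof. by case: z1; case: z2. Qed.
Lemma cImB z1 z2 : cIm (z1 - z2) = cIm z1 - cIm z2. Proof. by case: z1; case: z2. Qed.

Lemma cRe_sum (I : Type) (r : seq I) (F : I -> Cx R) :
  cRe (\sum_(i <- r) F i) = \sum_(i <- r) cRe (F i).
Proof. exact: (big_morph cRe cReD). Qed.
Lemma cIm_sum (I : Type) (r : seq I) (F : I -> Cx R) :
  cIm (\sum_(i <- r) F i) = \sum_(i <- r) cIm (F i).
Proof. exact: (big_morph cIm cImD). Qed.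

Lemma toCxM (x y : R) : toCx (x * y) = toCx x * toCx y.
Proof. exact: (rmorphM (real_complex R)). Qed.
Lemma toCxD (x y : R) : toCx (x + y) = toCx x + toCx y.
Proof. exact: (rmorphD (real_complex R)). Qed.
Lemma toCxB (x y : R) : toCx (x - y) = toCx x - toCx y.
Proof. exact: (rmorphB (real_complex R)). Qed.
Lemma toCx1 : toCx 1 = 1 :> Cx R. Proof. by []. Qed.
Lemma toCx0 : toCx 0 = 0 :> Cx R. Proof. by []. Qed.
Lemma toCxV (x : R) : toCx x^-1 = (toCx x)^-1.
Proof. exact: (fmorphV (real_complex R)). Qed.
Lemma toCxXz (x : R) (n : int) : toCx (x ^ n) = toCx x ^ n.
Proof. exact: (fmorphXz (real_complex R)). Qed.
Lemma toCxX (x : R) n : toCx (x ^+ n) = toCx x ^+ n.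
Proof. exact: (rmorphXn (real_complex R)). Qed.
Lemma toCx_inj : injective (@toCx R). Proof. by move=> x y []. Qed.
Lemma toCx_lt (x y : R) : (toCx x < toCx y) = (x < y). Proof. exact: ltcR. Qed.
Lemma toCx_le (x y : R) : (toCx x <= toCx y) = (x <= y). Proof. exact: lecR. Qed.

Lemma cnormE z : `|z| = toCx (cnorm z).
Proof. by rewrite /cnorm /cRe normc_def. Qed.

Lemma cnormM z1 z2 : cnorm (z1 * z2) = cnorm z1 * cnorm z2.
Proof. by apply: toCx_inj; rewrite toCxM -!cnormE normrM. Qed.
Lemma cnorm_ge0 z : 0 <= cnorm z.
Proof. by rewrite -toCx_le -cnormE toCx0 normr_ge0. Qed.
Lemma cnormD z1 z2 : cnorm (z1 + z2) <= cnorm z1 + cnorm z2.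
Proof. by rewrite -toCx_le toCxD -!cnormE ler_normD. Qed.
Lemma cnormX z n : cnorm (z ^+ n) = cnorm z ^+ n.
Proof. by apply: toCx_inj; rewrite toCxX -!cnormE normrX. Qed.
Lemma cnorm_toCx (x : R) : cnorm (toCx x) = `|x|.
Proof. by rewrite /cnorm /cRe normc_def /= expr0n /= addr0 sqrtr_sqr. Qed.
Lemma cnorm1 : cnorm 1 = 1. Proof. by rewrite -toCx1 cnorm_toCx normr1. Qed.
Lemma cnormV z : cnorm z^-1 = (cnorm z)^-1.
Proof. by apply: toCx_inj; rewrite toCxV -!cnormE normfV. Qed.
Lemma cnormXz z (n : int) : cnorm (z ^ n) = cnorm z ^ n.
Proof. by case: n => n; rewrite ?NegzE -?exprnN ?cnormV -?exprnP cnormX. Qed.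
Lemma cnorm_eq0 z : (cnorm z == 0) = (z == 0).
Proof. by rewrite -[RHS]normr_eq0 [in RHS]cnormE -toCx0 (inj_eq toCx_inj). Qed.
Lemma cnorm_Re z : `|cRe z| <= cnorm z.
Proof. by rewrite -toCx_le -cnormE; exact: normc_ge_Re. Qed.
Lemma cnorm_Im z : `|cIm z| <= cnorm z.
Proof.
rewrite /cnorm /cRe normc_def /= -sqrtr_sqr ler_wsqrtr// lerDr sqr_ge0//.
Qed.
Lemma cnorm_le z : cnorm z <= `|cRe z| + `|cIm z|.
Proof.
rewrite /cnorm {1}/cRe normc_def /= -[leRHS]ger0_norm ?addr_ge0// -sqrtr_sqr ler_wsqrtr//.
rewrite sqrrD !real_normK ?num_real//.
by have := mulr_ge0 (normr_ge0 (cRe z)) (normr_ge0 (cIm z)); rewrite mulr2n /cRe /cIm; lra.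
Qed.

Lemma Cx_gt0 (e : Cx R) : 0 < e -> e = toCx (cRe e) /\ 0 < cRe e.
Proof.
by case: e => x y; rewrite ltcE /= => /andP[/eqP -> ?].
Qed.

Lemma cvg_CxP (v : nat -> Cx R) z :
  v @ \oo --> z <-> (fun n => cnorm (z - v n)) @ \oo --> (0 : R).
Proof.
split=> [/cvgrPdist_lt vz|/cvgr0Pnorm_lt vz].
  apply/cvgr0Pnorm_lt => e e0; have := vz (toCx e); rewrite -toCx0 toCx_lt => /(_ e0).
  by apply: filterS => n; rewrite cnormE toCx_lt ger0_norm ?cnorm_ge0.
apply/cvgrPdist_lt => e /Cx_gt0[-> e0].
by apply: filterS (vz _ e0) => n; rewrite cnormE toCx_lt ger0_norm ?cnorm_ge0.
Qed.

Lemma cvg_cRe (v : nat -> Cx R) z : v @ \oo --> z -> (fun n => cRe (v n)) @ \oo --> cRe z.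
Proof.
move=> /cvg_CxP vz; apply/cvgrPdist_lt => e e0; move/cvgr0Pnorm_lt : vz => /(_ _ e0).
apply: filterS => n; apply: le_lt_trans; rewrite -cReB.
by rewrite (ger0_norm (cnorm_ge0 _)); exact: cnorm_Re.
Qed.

Lemma cvg_Cx (v : nat -> Cx R) z : (fun n => cRe (v n)) @ \oo --> cRe z ->
  (fun n => cIm (v n)) @ \oo --> cIm z -> v @ \oo --> z.
Proof.
move=> /cvgrPdist_lt vr /cvgrPdist_lt vi; apply/cvg_CxP/cvgr0Pnorm_lt => e e0.
have e2 : 0 < e / 2 by rewrite divr_gt0.
have := vr _ e2; have := vi _ e2; apply: filterS2 => n H1 H2.
rewrite (ger0_norm (cnorm_ge0 _)); apply: le_lt_trans (cnorm_le _) _.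
by rewrite cReB cImB; lra.
Qed.

Lemma bicvg_Cx (f : int -> Cx R) : bicvg (cRe \o f) -> bicvg (cIm \o f) ->
  bicvg f /\ bisum f = mkCx (bisum (cRe \o f)) (bisum (cIm \o f)).
Proof.
move=> [r1 r2] [i1 i2].
have H (v : nat -> Cx R) : cvgn (series (cRe \o v)) -> cvgn (series (cIm \o v)) ->
    series v @ \oo --> mkCx (limn (series (cRe \o v))) (limn (series (cIm \o v))).
  move=> cr ci; apply: cvg_Cx.
    by under eq_fun do rewrite cRe_sum; exact: cr.
  by under eq_fun do rewrite cIm_sum; exact: ci.
have H1 := H _ r1 i1; have H2 := H _ r2 i2.
split; first by split; apply/cvg_ex; eexists; [exact: H1|exact: H2].
by rewrite /bisum (cvg_lim _ H1)// (cvg_lim _ H2).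
Qed.

Lemma cRe_bisum (f : int -> Cx R) : bicvg f -> bicvg (cRe \o f) /\ bisum (cRe \o f) = cRe (bisum f).
Proof.
move=> cf; have [c1 c2] := cf; have c3 : bicvg (cRe \o f).
  split; apply/cvg_ex; eexists.
    have := cvg_cRe c1; under eq_fun do rewrite cRe_sum; apply.
  have := cvg_cRe c2; under eq_fun do rewrite cRe_sum; apply.
split=> //; apply: (bicvg_bisum_lim c3) => //.
under eq_fun do rewrite -cRe_sum; exact/cvg_cRe/window_cvg.
Qed.

Lemma laurent_term_re h u n : cRe (laurent_term h u n) = h n * cRe (u ^ n).
Proof. by rewrite /laurent_term cReM mul0r subr0. Qed.
Lemma laurent_term_im h u n : cIm (laurent_term h u n) = h n * cIm (u ^ n).
Proof. by rewrite /laurent_term cImM mul0r addr0. Qed.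

Lemma asummable_re h u : asummable (fun n => h n * cnorm u ^ n) ->
  asummable (fun n => h n * cRe (u ^ n)).
Proof.
apply: le_asummable => n; rewrite !normrM ler_wpM2l// -cnormXz.
by rewrite (ger0_norm (cnorm_ge0 _)); exact: cnorm_Re.
Qed.
Lemma asummable_im h u : asummable (fun n => h n * cnorm u ^ n) ->
  asummable (fun n => h n * cIm (u ^ n)).
Proof.
apply: le_asummable => n; rewrite !normrM ler_wpM2l// -cnormXz.
by rewrite (ger0_norm (cnorm_ge0 _)); exact: cnorm_Im.
Qed.

Lemma laurentE h u : asummable (fun n => h n * cnorm u ^ n) ->
  bicvg (laurent_term h u) /\
  laurent h u = mkCx (bisum (fun n => h n * cRe (u ^ n))) (bisum (fun n => h n * cIm (u ^ n))).
Proof.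
move=> s; have := @bicvg_Cx (laurent_term h u).
have -> : cRe \o laurent_term h u = fun n => h n * cRe (u ^ n).
  by apply/funext => n /=; rewrite laurent_term_re.
have -> : cIm \o laurent_term h u = fun n => h n * cIm (u ^ n).
  by apply/funext => n /=; rewrite laurent_term_im.
by apply; apply: asummable_bicvg; [exact: asummable_re|exact: asummable_im].
Qed.

Lemma laurent_real h (r : R) : bicvg (laurent_term h (toCx r)) ->
  bicvg (fun n => h n * r ^ n) /\ cRe (laurent h (toCx r)) = bisum (fun n => h n * r ^ n).
Proof.
move=> /cRe_bisum[c e].
have E : cRe \o laurent_term h (toCx r) = fun n => h n * r ^ n.
  by apply/funext => n /=; rewrite laurent_term_re -toCxXz.
by rewrite E in c e; split.
Qed.

Lemma annulus_cnorm (r1 r2 : R) u : annulus r1 r2 u <-> r1 < cnorm u < r2.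
Proof. by rewrite /annulus /= cnormE !toCx_lt. Qed.

Lemma laurent_holomorphic_asummable h (r1 r2 r : R) : 0 <= r1 ->
  laurent_holomorphic (annulus r1 r2) h -> r1 < r < r2 -> asummable (fun n => h n * r ^ n).
Proof.
move=> r10 hol /andP[r1r rr2].
have r0 : 0 < r by exact: le_lt_trans r1r.
have b x : r1 < x < r2 -> bicvg (fun n => h n * x ^ n).
  move=> xr; have [] := hol (toCx x); last by move=> /laurent_real[].
  apply/annulus_cnorm; rewrite cnorm_toCx ger0_norm//.
  by case/andP: xr => /(le_lt_trans r10)/ltW.
apply: (@asummable_inside _ _ ((r1 + r) / 2) ((r + r2) / 2)); try lra.
- by apply: b; apply/andP; split; lra.
- by apply: b; apply/andP; split; lra.
Qed.

Lemma conv_expz h g (r : R) n : r != 0 -> asummable (fun n => h n * r ^ n) ->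
  asummable (fun n => g n * r ^ n) ->
  conv (fun n => h n * r ^ n) (fun n => g n * r ^ n) n = conv h g n * r ^ n.
Proof.
move=> r0 ch cg; have rn : r ^ n != 0 by rewrite expfz_neq0.
have E : (fun m => h (n - m) * r ^ (n - m) * (g m * r ^ m)) =
         (fun m => r ^ n * (h (n - m) * g m)).
  apply/funext => m; have -> : r ^ n = r ^ (n - m) * r ^ m by rewrite -expfzDr// subrK.
  ring.
have := bicvg_conv n ch cg; rewrite E => cE.
have c2 : bicvg (fun m => h (n - m) * g m).
  have := bicvgZ (r ^ n)^-1 cE.
  by congr bicvg; apply/funext => m; rewrite mulKf.
by rewrite /conv E bisumZ// mulrC.
Qed.

Lemma asummable_conv_expz h g (r : R) : r != 0 -> asummable (fun n => h n * r ^ n) ->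
  asummable (fun n => g n * r ^ n) -> asummable (fun n => conv h g n * r ^ n).
Proof.
move=> r0 ch cg; have [+ _] := bisum_conv ch cg.
by congr asummable; apply/funext => n; rewrite conv_expz.
Qed.

(** The relation u^n = u^(n - m) u^m, split into real and imaginary parts, reduces the product of
    two complex series to four real convolutions. *)
Lemma laurent_conv h g u : u != 0 -> asummable h -> asummable g ->
  asummable (fun n => h n * cnorm u ^ n) ->
  asummable (fun n => g n * cnorm u ^ n) ->
  laurent (conv h g) u = laurent h u * laurent g u.
Proof.
move=> u0 sh sg ch cg; have nu0 : cnorm u != 0 by rewrite cnorm_eq0.
have [_ ->] := laurentE ch; have [_ ->] := laurentE cg.
have [_ ->] := laurentE (asummable_conv_expz nu0 ch cg).
have hr := asummable_re ch; have hi := asummable_im ch.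
have gr := asummable_re cg; have gi := asummable_im cg.
set hc := fun n => h n * cRe (u ^ n); set hs := fun n => h n * cIm (u ^ n).
set gc := fun n => g n * cRe (u ^ n); set gs := fun n => g n * cIm (u ^ n).
have uE (n m : int) : u ^ n = u ^ (n - m) * u ^ m by rewrite -expfzDr// subrK.
have Er : (fun n => conv h g n * cRe (u ^ n)) = fun n => conv hc gc n - conv hs gs n.
  apply/funext => n; rewrite /conv -bisumB; [|exact: bicvg_conv..].
  rewrite mulrC -bisumZ; last exact: bicvg_conv.
  congr bisum; apply/funext => m; rewrite (uE n m) cReM /hc /gc /hs /gs; ring.
have Ei : (fun n => conv h g n * cIm (u ^ n)) = (conv hc gs) \+ (conv hs gc).
  apply/funext => n /=; rewrite /conv -bisumD; [|exact: bicvg_conv..].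
  rewrite mulrC -bisumZ; last exact: bicvg_conv.
  congr bisum; apply/funext => m /=; rewrite (uE n m) cImM /hc /gc /hs /gs; ring.
have [a1 e1] := bisum_conv hr gr; have [a2 e2] := bisum_conv hi gi.
have [a3 e3] := bisum_conv hr gi; have [a4 e4] := bisum_conv hi gr.
rewrite Er Ei bisumB; [|exact: asummable_bicvg..].
rewrite (bisumD (asummable_bicvg a3) (asummable_bicvg a4)).
by rewrite e1 e2 e3 e4.
Qed.

Lemma laurent_flip h u : asummable (fun n => h n * cnorm u^-1 ^ n) ->
  asummable (fun n => h (- n) * cnorm u ^ n) /\
  laurent (fun n => h (- n)) u = laurent h u^-1.
Proof.
move=> s.
have b : set_bij [set: int] [set: int] (fun n => - n).
  by rewrite (_ : (fun n => - n) = fun n => 0 - n); [exact: set_bij_reflect|apply/funext => n; rewrite sub0r].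
have s' : asummable (fun n => h (- n) * cnorm u ^ n).
  have := asummable_reindex b s; congr asummable.
  by apply/funext => n /=; rewrite cnormV exprz_inv opprK.
split; first exact: s'.
rewrite (laurentE s).2 (laurentE s').2.
rewrite -(bisum_reindex (asummable_re s) b) -(bisum_reindex (asummable_im s) b).
by congr (mkCx (bisum _) (bisum _)); apply/funext => n /=; rewrite exprz_inv opprK.
Qed.

End complex_series.

(** * Generating functions of elementary totally nonnegative factors *)

Lemma bisum_supp2 (K : numFieldType) (f : int -> K) :
  (forall x, x != 0 -> x != 1 -> f x = 0) -> bicvg f /\ bisum f = f 0 + f 1.
Proof.
move=> f0.
have H1 : series (fun n => f (Posz n)) @ \oo --> f 0 + f 1.
  apply: cvg_near_cst; exists 2%N => // -[//|[//|n]] _.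
  rewrite /series/= !big_nat_recl//= big1_seq ?addr0//.
  by move=> k _; apply: f0.
have H2 : series (fun n => f (Negz n)) @ \oo --> (0 : K).
  apply: cvg_near_cst; exists 0%N => // n _.
  by rewrite /series/= big1// => k _; exact: f0.
split; first by split; apply/cvg_ex; eexists; [exact: H1|exact: H2].
by rewrite /bisum (cvg_lim _ H1)// (cvg_lim _ H2)// addr0.
Qed.

Section tn_expansions.
Context {R : realType}.
Variable rho : R.
Hypothesis rho1 : 1 < rho.
Implicit Types (h g : int -> R) (F G : Cx R -> Cx R).

(* [F] is, on a closed annulus around the unit circle, the generating function of
   a totally nonnegative Toeplitz matrix; this class is closed under products. *)
Definition tn_expansion h F := [/\ tn setT (toep h), asummable (fun n => h n * rho ^ n),
  asummable (fun n => h n * rho^-1 ^ n) &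
  forall u, rho^-1 <= cnorm u <= rho -> laurent h u = F u].

Let rho0 : 0 < rho. Proof. exact: lt_trans rho1. Qed.
Let rhoV0 : 0 < rho^-1. Proof. by rewrite invr_gt0. Qed.
Let rhoV1 : rho^-1 <= 1. Proof. by rewrite invf_le1// ltW. Qed.
Let rhoVn0 : rho^-1 != 0. Proof. by rewrite gt_eqF. Qed.
Let rhon0 : rho != 0. Proof. by rewrite gt_eqF. Qed.
Lemma tn_expansion_asummable h F (r : R) : tn_expansion h F -> rho^-1 <= r <= rho ->
  asummable (fun n => h n * r ^ n).
Proof. by case=> _ s1 s2 _ /andP[r1 r2]; exact: asummable_between s2 s1. Qed.

Lemma tn_expansion_asummable1 h F : tn_expansion h F -> asummable h.
Proof.
move=> gh; have := @tn_expansion_asummable h F 1 gh; rewrite rhoV1 (ltW rho1) => /(_ erefl).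
by congr asummable; apply/funext => n; rewrite exp1rz mulr1.
Qed.

Lemma cnorm_neq0 u : rho^-1 <= cnorm u <= rho -> u != 0 :> Cx R.
Proof. by move=> /andP[ur _]; rewrite -cnorm_eq0 gt_eqF//; exact: lt_le_trans ur. Qed.

Lemma tn_expansion_mul h g F G : tn_expansion h F -> tn_expansion g G ->
  tn_expansion (conv h g) (fun u => F u * G u).
Proof.
move=> gh gg; have [th h1 h2 hF] := gh; have [tg g1 g2 gG] := gg.
have sh := tn_expansion_asummable1 gh; have sg := tn_expansion_asummable1 gg.
split.
- have E x y : toep (conv h g) x y = bisum (fun m => toep h x m * toep g m y).
    rewrite /toep /conv -(bisum_reindex (asummable_conv_term _ sh sg) (set_bij_shift y)).
    by congr bisum; apply/funext => m /=; congr (h _ * g _); rewrite opprB addrA subrK.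
  rewrite (_ : toep (conv h g) = fun x y => bisum (fun m => toep h x m * toep g m y)).
    apply: tn_mul => // x y _; apply: asummable_bicvg; rewrite /toep.
    by apply: asummableM; [exact: asummable_reflect|exact: asummable_shift].
  by apply/funext => x; apply/funext => y.
- exact: asummable_conv_expz.
- exact: asummable_conv_expz.
- move=> u ur; rewrite -hF// -gG//; apply: laurent_conv => //; first exact: cnorm_neq0.
    exact: tn_expansion_asummable ur.
  exact: tn_expansion_asummable ur.
Qed.

Lemma tn_expansion_flip h F : tn_expansion h F -> tn_expansion (fun n => h (- n)) (fun u => F u^-1).
Proof.
move=> gh; have [th h1 h2 hF] := gh.
have H u : rho^-1 <= cnorm u <= rho -> rho^-1 <= cnorm u^-1 <= rho.
  move=> ur; have := ur; rewrite cnormV => /andP[u1 u2].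
  have u0 : 0 < cnorm u by exact: lt_le_trans u1.
  by rewrite lef_pV2 ?posrE// u2 -[X in _ <= X]invrK lef_pV2 ?posrE// u1.
have S u : rho^-1 <= cnorm u <= rho -> asummable (fun n => h n * cnorm u^-1 ^ n).
  by move=> /H; exact: tn_expansion_asummable.
split; first exact: tn_flip.
- have [] := @laurent_flip _ h (toCx rho); rewrite ?cnorm_toCx ?ger0_norm ?ltW//.
  by apply: S; rewrite cnorm_toCx gtr0_norm// lexx andbT (le_trans rhoV1)// ltW.
- have [] := @laurent_flip _ h (toCx rho^-1); rewrite ?cnorm_toCx ?gtr0_norm//.
  by apply: S; rewrite cnorm_toCx gtr0_norm// lexx (le_trans rhoV1)// ltW.
- by move=> u ur; rewrite (laurent_flip (S _ ur)).2 hF//; exact: H.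
Qed.

Lemma tn_expansion_eq h F G : tn_expansion h F ->
  (forall u, rho^-1 <= cnorm u <= rho -> F u = G u) -> tn_expansion h G.
Proof. by case=> ? ? ? hF FG; split=> // u ur; rewrite -FG// hF. Qed.

(** The two diagonals carry the entries 1 - b and b; the bound [b <= 1] makes both nonnegative. *)
Lemma tn_expansion_beta (b : R) : 0 <= b <= 1 ->
  tn_expansion (fun x => (1 - b) * delta x + b * delta (x - 1)) (fun u => 1 + toCx b * (u - 1)).
Proof.
move=> /andP[b0 b1].
have supp (n : int) : n != 0 -> n != 1 -> (1 - b) * delta n + b * delta (n - 1) = 0 :> R.
  by move=> n0 n1; rewrite /delta subr_eq0 (negbTE n0) (negbTE n1) !mulr0 addr0.
have f0 : (1 - b) * delta 0 + b * delta (0 - 1) = 1 - b :> R by rewrite /delta /= mulr1 mulr0 addr0.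
have f1 : (1 - b) * delta 1 + b * delta (1 - 1) = b :> R by rewrite /delta subrr /= mulr1 mulr0 add0r.
have S (r : R) : asummable (fun n => ((1 - b) * delta n + b * delta (n - 1)) * r ^ n).
  apply: (le_asummable (g := fun n => `|((1 - b) * delta n + b * delta (n - 1)) * r ^ n|)).
    by move=> n; rewrite normr_id.
  apply: ge0_asummable => //.
  by apply: (bisum_supp2 _).1 => n n0 n1; rewrite supp// mul0r normr0.
split; [by apply: tn_two; lra|exact: S|exact: S|].
move=> u _; rewrite /laurent (bisum_supp2 _).2; last first.
  by move=> n n0 n1; rewrite /laurent_term supp// toCx0 mul0r.
by rewrite /laurent_term f0 f1 expr0z expr1z toCxB toCx1; ring.
Qed.

Lemma tn_expansion_geom (p q : R) : 0 <= p -> 0 < q -> q * rho < 1 ->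
  tn_expansion (fun x => if 0 <= x then p * q ^ x else 0)
       (fun u => toCx p / (1 - toCx q * u)).
Proof.
move=> p0 q0 qr.
have S (r : R) : 0 < r <= rho ->
    asummable (fun n => (if 0 <= n then p * q ^ n else 0) * r ^ n).
  move=> /andP[r0 rr]; have qr1 : q * r < 1.
    by apply: le_lt_trans qr; rewrite ler_wpM2l// ltW.
  apply: asummable_halves.
    rewrite (_ : (fun n => _) = geometric p (q * r)).
      by apply: is_cvg_geometric_series; rewrite ger0_norm// mulr_ge0 ?ltW.
    apply/funext => n; rewrite /= -!exprnP -mulrA -exprMn ger0_norm//.
    by rewrite mulr_ge0// exprn_ge0// mulr_ge0 ?ltW.
  rewrite (_ : (fun n => _) = fun=> 0); last by apply/funext => n /=; rewrite mul0r normr0.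
  rewrite (_ : series _ = fun=> 0); first exact: is_cvg_cst.
  by apply/funext => n; rewrite /series/= big1.
split; [exact: tn_geom|by apply: S; rewrite rho0 lexx|by apply: S; rewrite rhoV0 (le_trans rhoV1)// ltW|].
move=> u ur; set z := toCx q * u.
have zn : cnorm z < 1.
  rewrite cnormM cnorm_toCx gtr0_norm//; apply: le_lt_trans qr.
  by rewrite ler_wpM2l ?(ltW q0)//; case/andP: ur.
have z1 : 1 - z != 0.
  apply: contraTneq zn => /eqP; rewrite subr_eq0 => /eqP <-.
  by rewrite cnorm1 ltxx.
have H1 : series (fun n => laurent_term (fun x => if 0 <= x then p * q ^ x else 0) u (Posz n))
    @ \oo --> toCx p / (1 - z).
  have -> : series (fun n => laurent_term (fun x => if 0 <= x then p * q ^ x else 0) u (Posz n)) =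
      fun n => toCx p / (1 - z) * (1 - z ^+ n).
    apply/funext => n.
    have -> : 1 - z ^+ n = (1 - z) * \sum_(k < n) z ^+ k by rewrite -opprB subrX1 -mulNr opprB.
    rewrite -mulrA mulKf// /series/= big_mkord.
    rewrite mulr_sumr; apply: eq_bigr => k _.
    by rewrite /laurent_term /= toCxM -!exprnP toCxX /z exprMn mulrA.
  have zn0 : (fun n => z ^+ n) @ \oo --> (0 : Cx R).
    apply/cvg_CxP; under eq_fun do rewrite sub0r /cnorm normrN -/(cnorm _) cnormX.
    by apply: cvg_expr; rewrite ger0_norm ?cnorm_ge0.
  have : (fun n => toCx p / (1 - z) * (1 - z ^+ n)) @ \oo --> toCx p / (1 - z) * (1 - 0).
    have c1 : (fun n => 1 - z ^+ n) @ \oo --> (1 - 0 : Cx R) by exact: (cvgB (cvg_cst _) zn0).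
    exact: (cvgM (cvg_cst _) c1).
  by rewrite subr0 mulr1.
have H2 : series (fun n => laurent_term (fun x => if 0 <= x then p * q ^ x else 0) u (Negz n))
    @ \oo --> (0 : Cx R).
  apply: cvg_near_cst; exists 0%N => // n _; rewrite /series/= big1// => k _.
  by rewrite /laurent_term /= toCx0 mul0r.
by rewrite /laurent /bisum (cvg_lim _ H1)// (cvg_lim _ H2)// addr0.
Qed.

(** Writing 1 - al (u - 1) = (1 + al) (1 - q u) with q = al / (1 + al) gives a geometric series, and
    the condition on [al] is q rho < 1. The case al = 0 is separate because [tn_expansion_geom] asks
    for q > 0. *)
Lemma tn_expansion_alpha (al : R) : 0 <= al -> al * (rho - 1) < 1 ->
  exists h, tn_expansion h (fun u => (1 - toCx al * (u - 1))^-1).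
Proof.
rewrite le_eqVlt => /orP[/eqP <- _|al0 alr].
  exists (fun x => (1 - 0) * delta x + 0 * delta (x - 1)).
  have b01 : is_true (0 <= (0 : R) <= 1) by apply/andP; split; [exact: lexx|exact: ler01].
  by apply: (tn_expansion_eq (tn_expansion_beta b01)) => u _; rewrite toCx0 !mul0r addr0 subr0 invr1.
have al1 : 0 < 1 + al by rewrite addr_gt0.
exists (fun x => if 0 <= x then (1 + al)^-1 * (al / (1 + al)) ^ x else 0).
have /tn_expansion_eq : tn_expansion (fun x => if 0 <= x then (1 + al)^-1 * (al / (1 + al)) ^ x else 0)
       (fun u => toCx (1 + al)^-1 / (1 - toCx (al / (1 + al)) * u)).
  apply: tn_expansion_geom; rewrite ?invr_ge0 ?(ltW al1)// ?divr_gt0//.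
  by rewrite mulrAC ltr_pdivrMr// mul1r; move: alr; rewrite mulrBr mulr1; lra.
apply=> u _; rewrite toCxM toCxV -invfM; congr (_^-1).
have c0 : toCx (1 + al) != 0 by rewrite -toCx0 (inj_eq (@toCx_inj R)) gt_eqF.
rewrite mulrBr mulr1 mulrA mulrCA mulfV// mulr1 toCxD toCx1; ring.
Qed.

Definition has_tn_expansion F := exists h, tn_expansion h F.

Lemma has_tn_expansion_one : has_tn_expansion (fun=> 1).
Proof.
exists (fun x => (1 - 0) * delta x + 0 * delta (x - 1)).
have b01 : is_true (0 <= (0 : R) <= 1) by apply/andP; split; [exact: lexx|exact: ler01].
by apply: (tn_expansion_eq (tn_expansion_beta b01)) => u _; rewrite toCx0 !mul0r addr0.
Qed.

Lemma has_tn_expansion_mul F G : has_tn_expansion F -> has_tn_expansion G ->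
  has_tn_expansion (fun u => F u * G u).
Proof. by move=> [h hF] [g gG]; exists (conv h g); exact: tn_expansion_mul. Qed.

Lemma has_tn_expansion_flip F : has_tn_expansion F -> has_tn_expansion (fun u => F u^-1).
Proof. by move=> [h hF]; exists (fun n => h (- n)); exact: tn_expansion_flip. Qed.

Lemma has_tn_expansion_prod (I : Type) (r : seq I) (F : I -> Cx R -> Cx R) :
  (forall i, has_tn_expansion (F i)) -> has_tn_expansion (fun u => \prod_(i <- r) F i u).
Proof.
move=> gF; elim: r => [|i r IH].
  by under eq_fun do rewrite big_nil; exact: has_tn_expansion_one.
by under eq_fun do rewrite big_cons; exact: has_tn_expansion_mul.
Qed.

Lemma has_tn_expansion_exp F n : has_tn_expansion F -> has_tn_expansion (fun u => F u ^+ n).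
Proof.
move=> gF; elim: n => [|n IH]; first by under eq_fun do rewrite expr0; exact: has_tn_expansion_one.
by under eq_fun do rewrite exprS; exact: has_tn_expansion_mul.
Qed.

Lemma has_tn_expansion_beta (b : R) : 0 <= b <= 1 -> has_tn_expansion (fun u => 1 + toCx b * (u - 1)).
Proof. by move=> /tn_expansion_beta gb; eexists; exact: gb. Qed.

Lemma has_tn_expansion_admissible_factor (ap am bp bm : R) : 0 <= ap -> 0 <= am ->
  0 <= bp <= 1 -> 0 <= bm <= 1 -> ap * (rho - 1) < 1 -> am * (rho - 1) < 1 ->
  has_tn_expansion (admissible_factor ap am bp bm).
Proof.
move=> a0 m0 b1 b2 a1 m1.
have ga := tn_expansion_alpha a0 a1; have gm := tn_expansion_alpha m0 m1.
have gb := has_tn_expansion_beta b1; have gn := has_tn_expansion_beta b2.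
exact: has_tn_expansion_mul (has_tn_expansion_mul gb ga)
  (has_tn_expansion_mul (has_tn_expansion_flip gn) (has_tn_expansion_flip gm)).
Qed.

End tn_expansions.

(** * The exponential as a limit of powers *)

Section complex_exponential.
Context {R : realType}.

Lemma scaled_increment_cvg (f : R -> R) (d : R) : is_derive (0 : R) 1 f d ->
  (fun n => n.+1%:R * (f n.+1%:R^-1 - f 0)) @ \oo --> d.
Proof.
move=> [df dE].
have : (fun h : R => h^-1 *: (f (h *: 1 + 0) - f 0)) @ 0^' --> d by rewrite -dE; exact: df.
have hn : (fun n : nat => n.+1%:R^-1 : R) @ \oo --> (0 : R)^'.
  move=> A [e /= e0 eA]; have := @cvg_harmonic R => /cvgr0Pnorm_lt/(_ e e0).
  apply: filterS => n; rewrite /harmonic /= => ne; apply: eA => /=.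
    by rewrite /ball /= sub0r normrN.
  by rewrite invr_eq0 pnatr_eq0.
move=> /(cvg_comp _ _ hn); apply: cvg_trans; apply: near_eq_cvg.
by near=> n; rewrite /= invrK addr0 [_ *: 1]mulr1.
Unshelve. all: by end_near. Qed.

Lemma cexpD (z1 z2 : Cx R) : cexp (z1 + z2) = cexp z1 * cexp z2.
Proof.
case: z1 => x1 y1; case: z2 => x2 y2.
have E (a b c d : R) : ((a +i* b) * (c +i* d) : R[i])%C = ((a * c - b * d) +i* (a * d + b * c))%C by [].
rewrite [RHS]E /= expRD cosD sinD; congr Complex; ring.
Qed.

Lemma cexp0 : cexp (0 : Cx R) = 1.
Proof. by rewrite /= expR0 cos0 sin0 mulr1 mulr0. Qed.

Lemma cexpMn (z : Cx R) n : cexp (z *+ n) = cexp z ^+ n.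
Proof.
elim: n => [|n IH]; first by rewrite mulr0n cexp0 expr0.
by rewrite mulrS cexpD IH exprS.
Qed.

Lemma cnorm_cexp (z : Cx R) : cnorm (cexp z) = expR (cRe z).
Proof.
case: z => x y; rewrite /cnorm {1}/cRe normc_def /= !exprMn -mulrDr cos2Dsin2 mulr1.
by rewrite sqrtr_sqr ger0_norm// expR_ge0.
Qed.

Lemma cnormN (z : Cx R) : cnorm (- z) = cnorm z.
Proof. by rewrite /cnorm normrN. Qed.

Lemma cnorm_sum (I : Type) (r : seq I) (F : I -> Cx R) :
  cnorm (\sum_(i <- r) F i) <= \sum_(i <- r) cnorm (F i).
Proof.
elim: r => [|i r IH]; first by rewrite !big_nil /cnorm normr0.
by rewrite !big_cons; apply: le_trans (cnormD _ _) _; rewrite lerD2l.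
Qed.

(** Put m = n + 1, a = 1 + z/m and b = exp(z/m). Both have modulus at most exp(|z|/m), so factoring
    a^m - b^m bounds it by exp|z| times m |a - b|, which tends to 0. *)
Lemma cexp_cvg (z : Cx R) :
  (fun n => (1 + z / n.+1%:R) ^+ n.+1) @ \oo --> cexp z.
Proof.
pose a n := 1 + z / n.+1%:R; pose b n := cexp (z / n.+1%:R).
have nE n : n.+1%:R = toCx n.+1%:R :> Cx R by exact: (esym (rmorph_nat (real_complex R) _)).
have n0 n : (n.+1%:R : R) != 0 by rewrite pnatr_eq0.
have zn n : z / n.+1%:R = mkCx (n.+1%:R^-1 * cRe z) (n.+1%:R^-1 * cIm z).
  rewrite nE -toCxV mulrC {nE n0 b a}; case: z => x y.
  by rewrite /mkCx /toCx; apply/eqP; rewrite eq_complex /= !mul0r subr0 addr0 !eqxx.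
have bE n : b n ^+ n.+1 = cexp z.
  by rewrite -cexpMn -mulrnAl -mulr_natr mulfK// pnatr_eq0.
(* The real and imaginary parts of exp(t z) have derivatives Re z and Im z at t = 0; this is read
   along t = 1/(n + 1). *)
have ab : (fun n => n.+1%:R * cnorm (a n - b n)) @ \oo --> (0 : R).
  have d1 : is_derive (0 : R) 1 (fun t => expR (t * cRe z) * cos (t * cIm z)) (cRe z).
    apply: is_derive_eq; rewrite !mul0r expR0 cos0 sin0.
    by rewrite ?scaler0 ?scale1r /GRing.scale /=; ring.
  have d2 : is_derive (0 : R) 1 (fun t => expR (t * cRe z) * sin (t * cIm z)) (cIm z).
    apply: is_derive_eq; rewrite !mul0r expR0 cos0 sin0.
    by rewrite ?scaler0 ?scale1r /GRing.scale /=; ring.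
  have := scaled_increment_cvg d1; have := scaled_increment_cvg d2.
  rewrite !mul0r expR0 cos0 sin0 mulr1 mulr0 => /cvgrPdist_lt c2 /cvgrPdist_lt c1.
  apply/cvgr0Pnorm_lt => e e0; have e2 : 0 < e / 2 by rewrite divr_gt0.
  have := c1 _ e2; have := c2 _ e2; apply: filterS2 => n H2 H1.
  rewrite ger0_norm ?mulr_ge0 ?cnorm_ge0//.
  apply: le_lt_trans (_ : n.+1%:R * (`|cRe (a n - b n)| + `|cIm (a n - b n)|) < e).
    by rewrite ler_wpM2l// cnorm_le.
  have npos : 0 <= (n.+1%:R : R) by [].
  rewrite mulrDr -(ger0_norm npos) -!normrM.
  rewrite /a /b zn /mkCx !cReB !cImB !cReD !cImD /=.
  rewrite (_ : n.+1%:R * _ = cRe z - n.+1%:R *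
     (expR (n.+1%:R^-1 * cRe z) * cos (n.+1%:R^-1 * cIm z) - 1)); last first.
    by rewrite /cRe /=; field.
  rewrite (_ : n.+1%:R * (0 + _ - _) = cIm z - n.+1%:R *
     (expR (n.+1%:R^-1 * cRe z) * sin (n.+1%:R^-1 * cIm z) - 0)); last first.
    by rewrite /cIm /=; field.
  by lra.
pose E := expR (cnorm z).
apply/cvg_CxP; apply: (@squeeze_cvgr _ _ _ _ (fun=> 0) (fun n => n.+1%:R * cnorm (a n - b n) * E)).
- near=> n; rewrite cnorm_ge0 /= -(bE n) -/(a n) -cnormN opprB subrXX cnormM.
  rewrite -mulrA mulrCA ler_wpM2l ?cnorm_ge0//.
  apply: le_trans (cnorm_sum _ _) _.
  have En : 0 <= expR (cnorm z / n.+1%:R) by exact: expR_ge0.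
  have za : cnorm (z / n.+1%:R) = cnorm z / n.+1%:R.
    by rewrite nE cnormM cnormV cnorm_toCx ger0_norm.
  have an : cnorm (a n) <= expR (cnorm z / n.+1%:R).
    apply: le_trans (cnormD _ _) _; rewrite cnorm1 za; exact: expR_ge1Dx.
  have bn : cnorm (b n) <= expR (cnorm z / n.+1%:R).
    by rewrite cnorm_cexp ler_expR -za (le_trans (ler_norm _))// cnorm_Re.
  apply: (@le_trans _ _ (\sum_(i < n.+1) E)); last by rewrite sumr_const card_ord mulr_natl.
  apply: ler_sum => i _; rewrite cnormM !cnormX.
  apply: (@le_trans _ _ (expR (cnorm z / n.+1%:R) ^+ (n.+1.-1 - i) * expR (cnorm z / n.+1%:R) ^+ i)).
    by apply: ler_pM; rewrite ?exprn_ge0 ?cnorm_ge0// lerXn2r ?nnegrE ?cnorm_ge0.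
  rewrite -exprD -expRM_natl ler_expR mulrA ler_pdivrMr ?ltr0Sn// mulrC ler_wpM2l ?cnorm_ge0//.
  by rewrite ler_nat; have := ltn_ord i; lia.
- exact: cvg_cst.
- by rewrite -[X in _ --> X](mul0r E); apply: cvgMl.
Unshelve. all: by end_near. Qed.

End complex_exponential.

(** * Laurent coefficients as averages over roots of unity *)

Lemma Cx_prim_root (R : realType) n : (0 < n)%N -> exists z : Cx R, n.-primitive_root z.
Proof.
move=> n_gt0; pose p : {poly R[i]} := 'X^n - 1.
have [r Dp] := closed_field_poly_normal p.
rewrite (monicP _) ?monicXnsubC // scale1r in Dp.
have rn1 : all n.-unity_root r by apply/allP => z; rewrite -root_prod_XsubC -Dp.
have sz_r : (n < (size r).+1)%N by rewrite -(size_prod_XsubC r id) -Dp size_XnsubC.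
have [|z _ zp] := hasP (has_prim_root n_gt0 rn1 _ sz_r); last by exists z.
by rewrite -separable_prod_XsubC -Dp separable_Xn_sub_1 // pnatr_eq0 -lt0n.
Qed.

Section averaging.
Context {R : realType}.

Lemma norm_bisum_le (f g : int -> R) : (forall x, `|f x| <= g x) -> bicvg g ->
  `|bisum f| <= bisum g.
Proof.
move=> fg cg.
have g0 x : 0 <= g x by apply: le_trans (fg x).
have cf : bicvg f.
  apply: asummable_bicvg; apply: le_asummable (ge0_asummable g0 cg) => x.
  by rewrite (ger0_norm (g0 x)).
have nf : (fun n => `|\sum_(x <- window n) f x|) @ \oo --> `|bisum f|.
  by apply: cvg_norm; exact: window_cvg.
apply: (ler_cvg_to nf (window_cvg cg)).
by near=> n; apply: le_trans (ler_norm_sum _ _ _) _; apply: ler_sum.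
Unshelve. all: by end_near. Qed.

Section roots_of_unity.
Variables (K : nat) (w : Cx R).
Hypothesis wK : K.-primitive_root w.

Let K0 : (0 < K)%N. Proof. exact: prim_order_gt0 wK. Qed.

Lemma cnorm_prim : cnorm w = 1.
Proof.
have /(congr1 cnorm) := prim_expr_order wK; rewrite cnormX cnorm1 => /eqP.
by rewrite pexpr_eq1 ?cnorm_ge0// => /eqP.
Qed.

Lemma prim_neq0 : w != 0.
Proof. by rewrite -cnorm_eq0 cnorm_prim oner_eq0. Qed.

Lemma prim_sum (d : int) : \sum_(j < K) (w ^+ j) ^ d = toCx (K%:R * (w ^ d == 1)%:R).
Proof.
have E (j : nat) : (w ^+ j) ^ d = (w ^ d) ^+ j by rewrite (exprnP w j) (exprnP (w ^ d) j) !exprz_exp mulrC.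
under eq_bigr do rewrite E.
case: eqP => [->|/eqP w1].
  under eq_bigr do rewrite expr1n.
  by rewrite sumr_const card_ord mulr1; exact: (esym (rmorph_nat (real_complex R) K)).
rewrite mulr0 toCx0; apply: (mulfI (_ : w ^ d - 1 != 0)); first by rewrite subr_eq0.
by rewrite mulr0 -subrX1 -E (prim_expr_order wK) exp1rz subrr.
Qed.

Lemma prim_expz_neq1 (d : int) : d != 0 -> w ^ d = 1 -> (K <= `|d|)%N.
Proof.
move=> d0 wd; apply: dvdn_leq; first by rewrite lt0n absz_eq0.
rewrite (prim_order_dvd wK); case: d {d0} wd => [k /eqP//|k].
by rewrite NegzE -exprnN => /eqP; rewrite invr_eq1 abszN.
Qed.

(** Averaging over the K-th roots of unity kills every exponent not congruent to n modulo K, and the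
    condition w^(m - n) = 1 expresses that congruence. *)
Lemma laurent_average (h : int -> R) n : asummable h ->
  cRe (\sum_(j < K) (w ^+ j) ^ (- n) * laurent h (w ^+ j)) =
  K%:R * bisum (fun m => h m * (w ^ (m - n) == 1)%:R).
Proof.
move=> sh.
have bl j : bicvg (laurent_term h (w ^+ j)).
  apply: (laurentE _).1; rewrite cnormX cnorm_prim expr1n.
  by move: sh; congr asummable; apply/funext => m; rewrite exp1rz mulr1.
have E : \sum_(j < K) (w ^+ j) ^ (- n) * laurent h (w ^+ j) =
    bisum (fun m => \sum_(j < K) (w ^+ j) ^ (- n) * laurent_term h (w ^+ j) m).
  rewrite bisum_sum; last by move=> j; exact/bicvgZ/bl.
  by apply: eq_bigr => j _; rewrite bisumZ.
rewrite E -(cRe_bisum _).2; last by apply: bicvg_sum => j; exact/bicvgZ/bl.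
rewrite -bisumZ; last first.
  apply: asummable_bicvg; apply: le_asummable sh => m.
  by rewrite normrM ler_piMr//; case: eqP; rewrite ?normr1 ?normr0.
congr bisum; apply/funext => m /=.
rewrite (eq_bigr (fun j : 'I_K => toCx (h m) * (w ^+ j) ^ (m - n))); last first.
  move=> j _; rewrite /laurent_term mulrCA -expfzDr 1?addrC//.
  by rewrite expf_neq0// prim_neq0.
by rewrite -mulr_sumr prim_sum -toCxM /= mulrCA.
Qed.

(** The error comes from the m other than n with m = n modulo K. They satisfy K <= |m| + |n|, so 1
    <= rho^(|n| - K) rho^|m|, and rho^|m| is at most rho^m + rho^(-m). *)
Lemma average_error (h : int -> R) (rho : R) n : 1 < rho -> asummable h ->
  asummable (fun m => h m * rho ^ m) -> asummable (fun m => h m * rho^-1 ^ m) ->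
  `|bisum (fun m => h m * (w ^ (m - n) == 1)%:R) - h n| <=
  bisum (fun m => `|h m| * (rho ^ m + rho^-1 ^ m)) * (rho ^+ `|n|%N / rho ^+ K).
Proof.
move=> rho1 sh s1 s2; have rho0 : 0 < rho by exact: lt_trans rho1.
have hn : h n = bisum (fun m => h m * (m == n)%:R).
  have s : asummable (fun m => h m * (m == n)%:R).
    apply: le_asummable sh => m; rewrite normrM ler_piMr//.
    by case: eqP; rewrite ?normr1 ?normr0.
  rewrite -(bisum_reindex s (set_bij_shift (- n))) (bisum_supp2 _).2 /=.
    by rewrite opprK add0r eqxx mulr1 [_ == n](_ : _ = false) ?mulr0 ?addr0//; apply/negbTE; lia.
  by move=> x x0 x1; rewrite [_ == n](_ : _ = false) ?mulr0//; apply/negbTE; move: x0; lia.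
have bi (P : int -> bool) : bicvg (fun m => h m * (P m)%:R).
  apply: asummable_bicvg; apply: le_asummable sh => m.
  by rewrite normrM ler_piMr//; case: (P m); rewrite ?normr1 ?normr0.
rewrite hn -bisumB; [|exact: (bi (fun m => w ^ (m - n) == 1))|exact: (bi (fun m => m == n))].
have cW : bicvg (fun m => `|h m| * (rho ^ m + rho^-1 ^ m)).
  apply: asummable_bicvg.
  rewrite (_ : (fun m => _) = fun m => `|h m * rho ^ m| + `|h m * rho^-1 ^ m|).
    by apply: asummableD; [apply: le_asummable s1|apply: le_asummable s2] => m; rewrite normr_id.
  apply/funext => m; rewrite !normrM mulrDr.
  by rewrite (ger0_norm (exprz_ge0 m (ltW rho0))) [X in _ = _ + _ * X]ger0_norm// exprz_ge0// invr_ge0 ltW.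
rewrite mulrC -bisumZ//; apply: norm_bisum_le; last exact: bicvgZ.
have c0 : 0 <= rho ^+ `|n|%N / rho ^+ K by rewrite divr_ge0// exprn_ge0// ltW.
move=> m; have m0 : 0 <= rho ^ m + rho^-1 ^ m.
  by rewrite addr_ge0// exprz_ge0// ?invr_ge0 ltW.
rewrite -mulrBr normrM mulrCA ler_wpM2l//.
have [mn|mn] := eqVneq m n; first by rewrite -mn subrr expr0z eqxx subrr normr0 mulr_ge0// mn.
rewrite subr0; case: eqP => [w1|_]; last by rewrite normr0 mulr_ge0.
have := prim_expz_neq1 _ w1; rewrite subr_eq0 => /(_ mn) Kmn.
rewrite normr1 mulrAC ler_pdivlMr ?exprn_gt0// mul1r.
apply: (@le_trans _ _ (rho ^+ `|n|%N * rho ^+ `|m|%N)).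
  by rewrite -exprD ler_weXn2l ?(ltW rho1)//; lia.
rewrite ler_wpM2l ?exprn_ge0 ?(ltW rho0)//.
case: m {m0 mn w1 Kmn} => k; first by rewrite -exprnP lerDl exprz_ge0// invr_ge0 ltW.
by rewrite NegzE exprz_inv opprK abszN -exprnP lerDr exprz_ge0// ltW.
Qed.

End roots_of_unity.

(* The values at [rho] bound the tails of the [h p] uniformly, so averaging over
   the K-th roots of unity recovers the coefficients with an error small in K. *)
Lemma coef_cvg (h : nat -> int -> R) (M : int -> R) (rho : R) : 1 < rho ->
  (forall p x, 0 <= h p x) ->
  (forall p (r : R), rho^-1 <= r <= rho -> asummable (fun m => h p m * r ^ m)) ->
  (forall (r : R), rho^-1 <= r <= rho -> asummable (fun m => M m * r ^ m)) ->
  (forall u, rho^-1 <= cnorm u <= rho -> (fun p => laurent (h p) u) @ \oo --> laurent M u) ->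
  forall n, h ^~ n @ \oo --> M n.
Proof.
move=> rho1 h0 sh sM cv n.
have rho0 : 0 < rho by exact: lt_trans rho1.
have rhoV1 : rho^-1 <= 1 by rewrite invf_le1// ltW.
have i1 : is_true (rho^-1 <= rho <= rho) by rewrite lexx andbT (le_trans rhoV1)// ltW.
have i2 : is_true (rho^-1 <= rho^-1 <= rho) by rewrite lexx (le_trans rhoV1)// ltW.
have i3 : is_true (rho^-1 <= 1 <= rho) by rewrite rhoV1 ltW.
have one (f : int -> R) : asummable (fun m => f m * 1 ^ m) -> asummable f.
  by congr asummable; apply/funext => m; rewrite exp1rz mulr1.
have sh1 p : asummable (h p) by apply: one; exact: sh.
have sM1 : asummable M by apply: one; exact: sM.
pose W p := bisum (fun m => `|h p m| * (rho ^ m + rho^-1 ^ m)).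
pose WM := bisum (fun m => `|M m| * (rho ^ m + rho^-1 ^ m)).
(* As the coefficients of [h p] are nonnegative, the majorant is itself a sum of two values of the
   Laurent function. Convergence at these two points bounds it independently of p. *)
have WE p : W p = cRe (laurent (h p) (toCx rho)) + cRe (laurent (h p) (toCx rho^-1)).
  have L (r : R) : 0 < r -> rho^-1 <= r <= rho ->
      cRe (laurent (h p) (toCx r)) = bisum (fun m => h p m * r ^ m).
    move=> r0 ir; apply: (laurent_real _).2; apply: (laurentE _).1.
    by rewrite cnorm_toCx gtr0_norm//; exact: sh.
  have rhoV0 : 0 < rho^-1 by rewrite invr_gt0.
  transitivity (bisum (fun m => h p m * rho ^ m) + bisum (fun m => h p m * rho^-1 ^ m)); last first.
    by congr (_ + _); apply/esym; [exact: (L _ rho0 i1)|exact: (L _ rhoV0 i2)].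
  rewrite -(bisumD (asummable_bicvg (sh p _ i1)) (asummable_bicvg (sh p _ i2))).
  by congr bisum; apply/funext => m /=; rewrite ger0_norm// mulrDr.
have [C HC] : exists C, forall p, W p <= C.
  have cW : cvgn W.
    apply/cvg_ex; exists (cRe (laurent M (toCx rho)) + cRe (laurent M (toCx rho^-1))).
    rewrite (_ : W = fun p => cRe (laurent (h p) (toCx rho)) +
      cRe (laurent (h p) (toCx rho^-1))); last by apply/funext.
    by apply: cvgD; apply: cvg_cRe; apply: cv; rewrite cnorm_toCx gtr0_norm// invr_gt0.
  have [B [_ HB]] := cvg_seq_bounded cW; exists (`|B| + 1) => p.
  apply: le_trans (ler_norm _) _; apply: HB => //.
  by rewrite (le_lt_trans (ler_norm B))// ltrDl.
apply/cvgrPdist_lt => e e0.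
have e3 : 0 < e / 3 by rewrite divr_gt0.
have X0 : 0 <= `|C| + `|WM| + 1 by rewrite !addr_ge0.
(* The order of K is fixed before p: the aliasing error is then below e / 3 for all p and for the
   limit, and only finitely many points on the unit circle remain. *)
have [K0 HK0] : exists K : nat,
    (`|C| + `|WM| + 1) * (rho ^+ `|n|%N / rho ^+ K.+1) <= e / 3.
  have : (fun k => (`|C| + `|WM| + 1) * rho ^+ `|n|%N * rho^-1 ^+ k) @ \oo -->
         (`|C| + `|WM| + 1) * rho ^+ `|n|%N * 0.
    by apply: cvgMr; apply: cvg_expr; rewrite gtr0_norm ?invr_gt0// invf_lt1.
  rewrite mulr0 => /cvgr0Pnorm_lt/(_ _ e3)[K _ /(_ K.+1 (leqnSn K))] /= HK.
  by exists K; rewrite mulrA -exprVn; apply: le_trans (ler_norm _) (ltW HK).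
have [w wK] := Cx_prim_root R (ltn0Sn K0).
have avg f := laurent_average wK (h := f) n.
have cB : (fun p => bisum (fun m => h p m * (w ^ (m - n) == 1)%:R)) @ \oo -->
          bisum (fun m => M m * (w ^ (m - n) == 1)%:R).
  have E f : asummable f -> bisum (fun m => f m * (w ^ (m - n) == 1)%:R) =
     K0.+1%:R^-1 * cRe (\sum_(j < K0.+1) (w ^+ j) ^ (- n) * laurent f (w ^+ j)).
    by move=> sf; rewrite avg// mulKf// pnatr_eq0.
  under eq_fun do rewrite E//; rewrite E//; apply: cvgMr; apply: cvg_cRe.
  apply: (cvg_big (op := +%R)); first exact: add_continuous.
  move=> j _; apply: cvgMr; apply: cv.
  by rewrite cnormX (cnorm_prim wK) expr1n.
move/cvgrPdist_lt : cB => /(_ _ e3); apply: filterS => p.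
have := average_error wK n rho1 (sh1 p) (sh p _ i1) (sh p _ i2).
have := average_error wK n rho1 sM1 (sM _ i1) (sM _ i2).
rewrite -/(W p) -/WM.
set bM := bisum _; set bp := bisum _ => eM ep ebb.
have bound (V : R) : V <= `|C| + `|WM| + 1 -> V * (rho ^+ `|n| / rho ^+ K0.+1) <= e / 3.
  move=> VC; apply: le_trans HK0; rewrite ler_wpM2r// divr_ge0// exprn_ge0// ltW//.
have {}eM := le_trans eM (bound _ _); have {}ep := le_trans ep (bound _ _).
have {}eM : `|bM - M n| <= e / 3.
  by apply: eM; have := ler_norm WM; have := normr_ge0 C; lra.
have {}ep : `|bp - h p n| <= e / 3.
  by apply: ep; have := HC p; have := ler_norm C; have := normr_ge0 WM; lra.
move: eM ep ebb; rewrite !ler_norml !ltr_norml => /andP[? ?] /andP[? ?] /andP[? ?].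
by apply/andP; split; lra.
Qed.

End averaging.

(** * Admissible matrices are totally nonnegative *)

Section admissible.
Context {R : realType}.

Lemma cvg_series_bounded (u : nat -> R) : cvgn (series u) -> exists B : R, forall n, `|u n| <= B.
Proof.
move=> cu.
have /cvg_seq_bounded[B [_ HB]] : cvgn u by apply/cvg_ex; exists 0; exact: cvg_series_cvg_0.
exists (`|B| + 1) => n; apply: HB => //.
by rewrite (le_lt_trans (ler_norm B))// ltrDl.
Qed.

Lemma admissible_factor1 (ap am bp bm : R) : admissible_factor ap am bp bm 1 = 1.
Proof. by rewrite /admissible_factor invr1 subrr !mulr0 addr0 subr0 invr1 !mulr1. Qed.

Theorem admissible_tn (M : int -> R) : admissible M ->
  [/\ tn setT (toep M), asummable M & bisum M = 1].
Proof.
move=> [gp [gm [ap [am [bp [bm [gp0 gm0 par sc [r1 [r2 [r10 /andP[r11 r21] hol cv]]]]]]]]]].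
have sM (r : R) : r1 < r < r2 -> asummable (fun m => M m * r ^ m).
  exact: laurent_holomorphic_asummable hol.
have sM1 : asummable M.
  have := sM 1; rewrite r11 r21 => /(_ erefl).
  by congr asummable; apply/funext => m; rewrite exp1rz mulr1.
have [B HB] := cvg_series_bounded sc.
have B0 : 0 <= B by apply: le_trans (HB 0%N).
have apB i : ap i <= B.
  have [? ? /andP[? _] /andP[? _]] := par i.
  by apply: le_trans (HB i); apply: le_trans (ler_norm _); lra.
have amB i : am i <= B.
  have [? ? /andP[? _] /andP[? _]] := par i.
  by apply: le_trans (HB i); apply: le_trans (ler_norm _); lra.
(* For rho = 1 + dl: the second bound gives rho < r2; the third gives rho r1 < 1 - dl^2, hence r1 <
   1 / rho; the last keeps the poles of all alpha factors off the closed annulus. *)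
have [dl [d0 d1 d2 d3]] : exists dl : R, [/\ 0 < dl, dl < r2 - 1, dl < 1 - r1 & B * dl < 1].
  exists (Num.min ((r2 - 1) / 2) (Num.min ((1 - r1) / 2) (2 * (B + 1))^-1)).
  have b1 : 0 < (2 * (B + 1))^-1 by rewrite invr_gt0; lra.
  split.
  - by rewrite !lt_min b1 !divr_gt0//; lra.
  - by rewrite gt_min; apply/orP; left; lra.
  - by rewrite !gt_min; apply/orP; right; apply/orP; left; lra.
  - apply: (@le_lt_trans _ _ (B * (2 * (B + 1))^-1)).
      by rewrite ler_wpM2l// !ge_min lexx !orbT.
    by rewrite ltr_pdivrMr; lra.
pose rho := 1 + dl.
have rho1 : 1 < rho by rewrite /rho; lra.
have rho0 : 0 < rho by exact: lt_trans rho1.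
have rhoV : r1 < rho^-1.
  rewrite -(ltr_pM2r rho0) mulVf ?gt_eqF// /rho.
  by have := mulr_gt0 d0 d0; have := mulr_ge0 r10 (ltW d0); nra.
have inann u : rho^-1 <= cnorm u <= rho -> annulus r1 r2 u.
  move=> /andP[u1 u2]; apply/annulus_cnorm.
  by rewrite (lt_le_trans rhoV u1) (le_lt_trans u2)// /rho; lra.
(* From index [p0] on, gp / (p + 1) and gm / (p + 1) are at most 1, so the factors that replace the
   exponentials are beta factors. *)
pose p0 := (Num.bound gp + Num.bound gm)%N.
have gp1 n : gp <= (n + p0).+1%:R.
  apply: le_trans (ltW (archi_boundP gp0)) _; rewrite ler_nat /p0.
  by move: (Num.bound gp) (Num.bound gm) => x y; clear; lia.
have gm1 n : gm <= (n + p0).+1%:R.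
  apply: le_trans (ltW (archi_boundP gm0)) _; rewrite ler_nat /p0.
  by move: (Num.bound gp) (Num.bound gm) => x y; clear; lia.
pose F p (u : Cx R) := (1 + toCx (gp / p.+1%:R) * (u - 1)) ^+ p.+1 *
   (1 + toCx (gm / p.+1%:R) * (u^-1 - 1)) ^+ p.+1 *
   \prod_(0 <= i < p) admissible_factor (ap i) (am i) (bp i) (bm i) u.
have gF n : has_tn_expansion rho (F (n + p0)%N).
  have fr (g : R) : 0 <= g -> g <= (n + p0).+1%:R -> is_true (0 <= g / (n + p0).+1%:R <= 1).
    by move=> g0 g1; rewrite divr_ge0// ler_pdivrMr// mul1r.
  apply: (has_tn_expansion_mul rho1); first apply: (has_tn_expansion_mul rho1).
  - exact/(has_tn_expansion_exp rho1)/has_tn_expansion_beta/fr.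
  - apply: (has_tn_expansion_exp rho1).
    exact: (has_tn_expansion_flip rho1 (has_tn_expansion_beta _ (fr _ gm0 (gm1 n)))).
  - apply: (has_tn_expansion_prod rho1) => i; have [? ? ? ?] := par i.
    have rd : rho - 1 = dl by rewrite /rho addrC addKr.
    apply: has_tn_expansion_admissible_factor => //; rewrite rd; apply: le_lt_trans d3;
      by rewrite ler_wpM2r// ltW.
have [h hF] := choice gF.
have cvF u : rho^-1 <= cnorm u <= rho -> (fun p => F p u) @ \oo --> laurent M u.
  move=> ur; have := cv u (inann u ur).
  set z1 := toCx gp * (u - 1); set z2 := toCx gm * (u^-1 - 1).
  rewrite cexpD => cvu.
  have en (z : Cx R) : cexp z != 0 by rewrite -cnorm_eq0 cnorm_cexp gt_eqF// expR_gt0.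
  have zE (g : R) (z : Cx R) p : toCx (g / p.+1%:R) * z = toCx g * z / p.+1%:R.
    rewrite toCxM toCxV mulrAC; congr (_ / _); exact: (rmorph_nat (real_complex R)).
  have c1 : (fun p => (1 + toCx (gp / p.+1%:R) * (u - 1)) ^+ p.+1) @ \oo --> cexp z1.
    by under eq_fun do rewrite zE; exact: cexp_cvg.
  have c2 : (fun p => (1 + toCx (gm / p.+1%:R) * (u^-1 - 1)) ^+ p.+1) @ \oo --> cexp z2.
    by under eq_fun do rewrite zE; exact: cexp_cvg.
  (* Admissibility gives convergence of the product together with its exponential prefactor; the
     exponential never vanishes and is divided out. *)
  have c3 : (fun p => \prod_(0 <= i < p) admissible_factor (ap i) (am i) (bp i) (bm i) u)
      @ \oo --> (cexp z1 * cexp z2)^-1 * laurent M u.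
    have c4 : (fun p => (cexp z1 * cexp z2)^-1 * (cexp z1 * cexp z2 *
        \prod_(0 <= i < p) admissible_factor (ap i) (am i) (bp i) (bm i) u)) @ \oo -->
        (cexp z1 * cexp z2)^-1 * laurent M u by exact: (cvgM (cvg_cst _) cvu).
    move: c4; rewrite (_ : (fun p => _ * _) = fun p =>
      \prod_(0 <= i < p) admissible_factor (ap i) (am i) (bp i) (bm i) u)//.
    by apply/funext => p; rewrite mulKf// mulf_neq0.
  have : (fun p => F p u) @ \oo --> cexp z1 * cexp z2 * ((cexp z1 * cexp z2)^-1 * laurent M u).
    exact: (cvgM (cvgM c1 c2) c3).
  by rewrite mulVKf// mulf_neq0.
have hM n : h ^~ n @ \oo --> M n.
  apply: (coef_cvg rho1) => //.
  - by move=> p x; have [t _ _ _] := hF p; exact: toep_ge0.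
  - by move=> p r rr; exact: (tn_expansion_asummable rho1 (hF p)).
  - move=> r /andP[rr1 rr2]; apply: sM.
    by rewrite (lt_le_trans rhoV rr1) (le_lt_trans rr2)// /rho; lra.
  - move=> u ur.
    rewrite (_ : (fun p => laurent (h p) u) = (F ^~ u) \o (fun p => (p + p0)%N)).
      exact: cvg_comp (cvg_addnr p0) (cvF u ur).
    by apply/funext => p /=; have [_ _ _ ->] := hF p.
split=> //.
  apply: (tn_lim (A_ := fun k => toep (h k))) => [k|x y]; first by have [] := hF k.
  exact: hM.
have L1 : laurent M 1 = 1.
  have : annulus r1 r2 (1 : Cx R) by apply/annulus_cnorm; rewrite cnorm1 r11 r21.
  move=> /cv; rewrite invr1 subrr !mulr0 addr0 cexp0.
  under eq_fun do (under eq_bigr do rewrite admissible_factor1; rewrite big1// mulr1).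
  by move=> c1; apply: cvg_unique c1 _ => //; exact: cvg_cst.
have := @laurent_real _ M 1; rewrite -/(1 : Cx R) toCx1 L1.
have bc : bicvg (laurent_term M 1).
  apply: (laurentE _).1; rewrite cnorm1; apply: sM; rewrite r11 r21//.
move=> /(_ bc)[_ e]; transitivity (bisum (fun m => M m * 1 ^ m)); last by rewrite -e.
by congr bisum; apply/funext => m; rewrite exp1rz mulr1.
Unshelve. all: by end_near. Qed.

End admissible.

(** * The matrix product Q Psi *)

Section laurent_product.
Context {R : realType}.
Implicit Types (Q : int -> R) (Psi : int -> int -> R).

Lemma annulus_open (r1 r2 : R) : open (annulus r1 r2).
Proof.
rewrite openE => u /annulus_cnorm/andP[u1 u2]; rewrite /interior.
have e0 : 0 < toCx (Num.min (cnorm u - r1) (r2 - cnorm u)).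
  by rewrite -toCx0 toCx_lt lt_min !subr_gt0 u1.
apply/nbhs_normP; exists (toCx (Num.min (cnorm u - r1) (r2 - cnorm u))) => //= v /=.
rewrite cnormE toCx_lt lt_min => /andP[v1 v2]; apply/annulus_cnorm.
have H1 : cnorm u <= cnorm (u - v) + cnorm v by rewrite -{1}(subrK v u) cnormD.
have H2 : cnorm v <= cnorm (u - v) + cnorm u.
  by rewrite -{1}(subrK u v) -[cnorm (u - v)]cnormN opprB cnormD.
by apply/andP; split; lra.
Qed.

(** The annulus is open, so near each of its points the Laurent function of the convolution agrees
    with the product of the two given ones and inherits derivability. *)
Lemma laurent_holomorphic_conv (r1 r2 : R) (h g : int -> R) : 0 <= r1 -> r1 < 1 < r2 ->
  laurent_holomorphic (annulus r1 r2) h -> laurent_holomorphic (annulus r1 r2) g ->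
  laurent_holomorphic (annulus r1 r2) (conv h g).
Proof.
move=> r10 r12 hh hg.
have S f : laurent_holomorphic (annulus r1 r2) f -> forall r : R, r1 < r < r2 ->
    asummable (fun m => f m * r ^ m).
  by move=> hf r; exact: laurent_holomorphic_asummable hf.
have S1 f : laurent_holomorphic (annulus r1 r2) f -> asummable f.
  move=> /S/(_ 1 r12); congr asummable; apply/funext => m; rewrite exp1rz mulr1//.
have n0 u : annulus r1 r2 u -> u != 0.
  by move=> /annulus_cnorm/andP[u1 _]; rewrite -cnorm_eq0 gt_eqF//; exact: le_lt_trans u1.
move=> u uA; have un0 := n0 u uA.
have nu0 : cnorm u != 0 by rewrite cnorm_eq0.
have uc := uA; move/annulus_cnorm : uc => uc.
split; first exact: (laurentE (asummable_conv_expz nu0 (S _ hh _ uc) (S _ hg _ uc))).1.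
have [_ dh] := hh u uA; have [_ dg] := hg u uA.
apply: near_eq_derivable (derivableM dh dg).
have : nbhs u (annulus r1 r2) by apply: open_nbhs_nbhs; split=> //; exact: annulus_open.
apply: filterS => v vA; apply/esym; have vc := vA; move/annulus_cnorm : vc => vc.
by rewrite laurent_conv//; [exact: n0|exact: S1|exact: S1|exact: S|exact: S].
Qed.

Lemma in_annulus_sub (h : int -> R) (r1 r2 s1 s2 : R) : r1 <= s1 -> s2 <= r2 ->
  laurent_holomorphic (annulus r1 r2) h -> laurent_holomorphic (annulus s1 s2) h.
Proof.
move=> rs1 rs2 hol u /annulus_cnorm/andP[u1 u2]; apply: hol; apply/annulus_cnorm.
by rewrite (le_lt_trans rs1 u1) (lt_le_trans u2 rs2).
Qed.

Lemma in_analyticity_annulus_conv (h g : int -> R) a :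
  in_analyticity_annulus h a -> in_analyticity_annulus g a ->
  in_analyticity_annulus (conv h g) a.
Proof.
move=> [r1 [r2 [r10 /andP[r11 r12] /andP[ra1 ra2] hh]]].
move=> [s1 [s2 [s10 /andP[s11 s12] /andP[sa1 sa2] hg]]].
have m1 : is_true (Num.max r1 s1 < 1 < Num.min r2 s2).
  by rewrite gt_max lt_min r11 s11 r12 s12.
exists (Num.max r1 s1), (Num.min r2 s2); split => //.
- by rewrite le_max r10.
- by rewrite gt_max lt_min ra1 ra2 sa1 sa2.
- apply: laurent_holomorphic_conv => //; first by rewrite le_max r10.
  + by apply: in_annulus_sub hh; rewrite ?le_max ?ge_min lexx.
  + by apply: in_annulus_sub hg; rewrite ?le_max ?ge_min lexx ?orbT.
Qed.

Lemma in_analyticity_annulus_asummable (h : int -> R) a :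
  in_analyticity_annulus h a -> asummable h /\ asummable (fun m => h m * a ^ m).
Proof.
move=> [r1 [r2 [r10 r12 ra hh]]]; split; last exact: laurent_holomorphic_asummable hh ra.
have := laurent_holomorphic_asummable r10 hh r12; congr asummable.
by apply/funext => m; rewrite exp1rz mulr1.
Qed.

Lemma Psi_col_asummable N a Psi j : (1 <= j <= N)%N -> Psi_valid N a Psi ->
  asummable (fun x => Psi x (- j%:Z)).
Proof.
move=> jN [_ _ hP].
have N1 : (1 <= 1 <= N)%N by case/andP: jN => /leq_trans H /H ->.
have [s _] := in_analyticity_annulus_asummable (hP j 1%N jN N1).
have := asummable_shift (- j%:Z) s; congr asummable.
by apply/funext => x; rewrite /Psi_gen opprK addrK.
Qed.

Lemma mulQPsi_valid N (a : nat -> R) Q Psi : tn setT (toep Q) -> asummable Q ->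
  (forall j, (1 <= j <= N)%N -> in_analyticity_annulus Q (a j)) ->
  Psi_valid N a Psi ->
  (forall i j : int, - N%:Z <= j <= -1 -> bicvg (fun m => Q (i - m) * Psi m j)) /\
  Psi_valid N a (mulQPsi Q Psi).
Proof.
move=> tQ sQ haQ hP.
have col (j : int) : - N%:Z <= j <= -1 -> asummable (fun x => Psi x j).
  move=> jN; have := @Psi_col_asummable N a Psi `|j|%N _ hP.
  by rewrite (_ : - `|j|%:Z = j); [apply; lia|lia].
have bc i j : - N%:Z <= j <= -1 -> bicvg (fun m => Q (i - m) * Psi m j).
  by move=> /col cj; apply: asummable_bicvg; apply: asummableM => //; exact: asummable_reflect.
have [tP _ hA] := hP.
have A i j : (1 <= i <= N)%N -> (1 <= j <= N)%N ->
    in_analyticity_annulus (Psi_gen (mulQPsi Q Psi) i) (a j).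
  move=> iN jN; have := in_analyticity_annulus_conv (haQ j jN) (hA i j iN jN).
  (* Shifting the summation index by i turns a column of Q Psi into the convolution of Q with the
     coefficients of Psi_i. *)
  suff -> : Psi_gen (mulQPsi Q Psi) i = conv Q (Psi_gen Psi i) by [].
  apply/funext => m; rewrite /conv /Psi_gen /mulQPsi.
  have sc : asummable (fun x => Q (m - i%:Z - x) * Psi x (- i%:Z)).
    apply: asummableM; first exact: asummable_reflect.
    exact: Psi_col_asummable hP.
  rewrite -(bisum_reindex sc (set_bij_shift i%:Z)).
  by congr bisum; apply/funext => x /=; congr (Q _ * _); rewrite opprB addrA subrK.
split; first exact: bc.
split; last exact: A.
  apply: (@tn_mul _ [set j : int | is_true (- N%:Z <= j <= -1)] (toep Q) Psi) => //.
move=> j jN; have [r1 [r2 [r10 /andP[r11 r12] _ hol]]] := A j j jN jN.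
exists (annulus r1 r2); split=> //; first exact: annulus_open.
by move=> u u1; apply/annulus_cnorm; rewrite /cnorm u1 /cRe /= r11.
Qed.

End laurent_product.

(** * Growth estimates for the skew Schur weights *)

Section cons_sums.
Context {R : realType} {T : choiceType}.

Definition cons_set (A : set T) (B : set (seq T)) : set (seq T) :=
  [set s | exists x t, [/\ A x, B t & s = x :: t]].

Lemma esum_cons_set (A : set T) (B : set (seq T)) (F : seq T -> \bar R) :
  (forall x t, A x -> B t -> 0 <= F (x :: t))%E ->
  (\esum_(s in cons_set A B) F s = \esum_(x in A) \esum_(t in B) F (x :: t))%E.
Proof.
move=> F0; rewrite esum_esum//.
have sb : set_bij (A `*` B) (cons_set A B) (fun p => p.1 :: p.2).
  split=> [[x t] /= [Ax Bt]|[x t] [x' t'] /= _ _ [-> ->]//|s [x [t [Ax Bt ->]]]].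
    by exists x, t.
  by exists (x, t).
by rewrite (reindex_esum _ _ _ _ sb).
Qed.

End cons_sums.

Section growth.
Context {R : realType}.

(** Forgetting that the parts are ordered only enlarges the sum, which then factors over the
    parts. *)
Lemma esum_prod_le n (u : nat -> int -> R) (b : nat -> R) :
  (forall i x, 0 <= u i x) ->
  (forall i, (i < n)%N -> \esum_(x in [set: int]) (u i x)%:E <= (b i)%:E)%E ->
  (\esum_(ka in GT n) (\prod_(i < n) u i ka`_i)%:E <= (\prod_(i < n) b i)%:E)%E.
Proof.
move=> u0 ub.
apply: (@le_trans _ _ (\esum_(ka in [set ka : seq int | size ka = n])
    (\prod_(i < n) u i ka`_i)%:E)%E); first by apply: subset_esum => ka [].
elim: n u b u0 ub => [|n IH] u b u0 ub.
  rewrite (_ : [set ka : seq int | size ka = 0%N] = [set [::]]).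
    by rewrite esum_set1 !big_ord0// lee_fin.
  by apply/seteqP; split=> [[]|_ ->].
rewrite (_ : [set ka : seq int | size ka = n.+1] =
             cons_set [set: int] [set ka : seq int | size ka = n]); last first.
  apply/seteqP; split=> [[//|x t] /= [st]|_ [x [t [_ st ->]]]]; first by exists x, t.
  by rewrite /= st.
rewrite esum_cons_set; last first.
  by move=> x t _ _; rewrite lee_fin prodr_ge0.
have b0 i : (i < n.+1)%N -> 0 <= b i.
  move=> /ub; rewrite -lee_fin; apply: le_trans; apply: esum_ge0 => x _; rewrite lee_fin//.
apply: (@le_trans _ _ (\esum_(x in [set: int]) ((\prod_(i < n) b i.+1)%:E * (u 0%N x)%:E))%E).
  apply: le_esum => x _.
  under eq_esum do rewrite big_ord_recl/= EFinM.
  rewrite (ge0_esumZl (u0 0%N x)); last by move=> t _; rewrite lee_fin prodr_ge0.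
  rewrite muleC lee_wpmul2r ?lee_fin//.
  by apply: (IH (fun i => u i.+1) (fun i => b i.+1)) => // i ni; exact: ub.
rewrite ge0_esumZl; [|by apply: prodr_ge0 => i _; apply: b0; rewrite ltnS|by move=> x _; rewrite lee_fin].
rewrite big_ord_recl EFinM muleC lee_wpmul2r//; last exact: ub.
by rewrite lee_fin prodr_ge0// => i _; apply: b0; rewrite ltnS.
Qed.

(* Equal to [max (P ^ x) (q ^ x)], hence submultiplicative, when [0 < q <= P]. *)
Definition gro (P q : R) (x : int) : R := if 0 <= x then P ^ x else q ^ x.

Definition Gro (P q : R) (la : seq int) : R := \prod_(x <- la) gro P q x.

Lemma gro_gt0 P q x : 0 < q -> q <= P -> 0 < gro P q x.
Proof. by move=> q0 qP; rewrite /gro; case: ifP => _; rewrite exprz_gt0// (lt_le_trans q0). Qed.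

Lemma Gro_gt0 P q la : 0 < q -> q <= P -> 0 < Gro P q la.
Proof. by move=> q0 qP; apply: prodr_gt0 => x _; exact: gro_gt0. Qed.

Definition posp (x : int) : nat := if x is Posz n then n else 0%N.

Lemma posp_ge x : x <= Posz (posp x).
Proof. by case: x. Qed.

Lemma posp_le x k : (posp x <= k)%N = (x <= Posz k).
Proof. by case: x => n /=; rewrite ?lez_nat. Qed.

(** Separates a character of Z from a power of P / q >= 1 whose exponent, the positive part, is
    subadditive. Submultiplicativity of [gro] and the interlacing bound both rest on this form. *)
Lemma groE P q x : 0 < q -> q <= P -> gro P q x = q ^ x * (P / q) ^+ posp x.
Proof.
move=> q0 qP; case: x => n; rewrite /gro /=; last by rewrite expr0 mulr1.
by rewrite -!exprnP -exprMn mulrC divfK// gt_eqF.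
Qed.

Lemma groD P q x y : 0 < q -> q <= P -> gro P q (x + y) <= gro P q x * gro P q y.
Proof.
move=> q0 qP; rewrite !groE// mulrACA -expfzDr ?gt_eqF// ler_wpM2l ?exprz_ge0 ?(ltW q0)//.
rewrite -exprD ler_weXn2l//; first by rewrite ler_pdivlMr// mul1r.
by rewrite posp_le PoszD lerD// posp_ge.
Qed.

Lemma gro_le_sum P q x : 0 < q -> q <= P -> gro P q x <= P ^ x + q ^ x.
Proof.
move=> q0 qP; have P0 : 0 < P by exact: lt_le_trans qP.
by rewrite /gro; case: ifP => _; rewrite ?lerDl ?lerDr exprz_ge0// ltW.
Qed.

Lemma gro_mono P q P' q' x : 0 < q' -> q' <= q -> q <= P -> P <= P' ->
  gro P q x <= gro P' q' x.
Proof.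
move=> q'0 qq qP PP; have q0 : 0 < q by exact: lt_le_trans qq.
have P0 : 0 < P by exact: lt_le_trans qP.
case: x => n; rewrite /gro /=.
  by rewrite -!exprnP lerXn2r// nnegrE ltW// (lt_le_trans P0).
rewrite NegzE -!exprnN lef_pV2 ?posrE ?exprn_gt0// lerXn2r// nnegrE ltW//.
Qed.

Lemma Gro_mono P q P' q' la : 0 < q' -> q' <= q -> q <= P -> P <= P' ->
  Gro P q la <= Gro P' q' la.
Proof.
move=> q'0 qq qP PP; apply: ler_prod => x _; rewrite gro_mono// andbT ltW// gro_gt0//.
exact: lt_le_trans qq.
Qed.

Lemma gro_scale P q t x : 0 < t -> gro P q x * t ^+ absz x = gro (P * t) (q / t) x.
Proof.
move=> t0; case: x => n; rewrite /gro /=; first by rewrite -!exprnP exprMn.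
by rewrite NegzE -!exprnN expr_div_n invfM invrK.
Qed.

(** Where the outer positive part is 0, ka_i <= la_i compares the positive parts. Elsewhere the
    claim compares the negative parts, and la_(i+1) <= ka_i bounds those of [ka] by those of
    [la]. *)
Lemma posp_interlace n la ka : GT n.+1 la -> GT n ka -> interlaces la ka ->
  (posp (sig_sum la - sig_sum ka) + \sum_(x <- ka) posp x <= \sum_(x <- la) posp x)%N.
Proof.
move=> [sl _] [sk _] /forallP il.
have {}il i : (i < n)%N -> la`_i.+1 <= ka`_i <= la`_i.
  by rewrite -{1}sk => ik; exact: (il (Ordinal ik)).
have el : (\sum_(x <- la) posp x = \sum_(i < n.+1) posp la`_i)%N by rewrite (big_nth 0) sl big_mkord.
have ek : (\sum_(x <- ka) posp x = \sum_(i < n) posp ka`_i)%N by rewrite (big_nth 0) sk big_mkord.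
rewrite (sig_sumE sl) (sig_sumE sk) el ek {el ek}.
have s1 : (\sum_(i < n) posp ka`_i <= \sum_(i < n.+1) posp la`_i)%N.
  rewrite big_ord_recr /= (leq_trans _ (leq_addr _ _))//; apply: leq_sum => i _.
  have /andP[_] := il i (ltn_ord i); move: (ka`_i) (la`_i) => x y xy.
  by rewrite posp_le (le_trans xy)// posp_ge.
rewrite addnC -leq_subRL//.
have PS m (F : nat -> nat) : Posz (\sum_(i < m) F i)%N = \sum_(i < m) Posz (F i).
  exact: (big_morph Posz PoszD).
rewrite posp_le -subzn// (PS n (fun i => posp ka`_i)) (PS n.+1 (fun i => posp la`_i)).
have : \sum_(i < n) (Posz (posp ka`_i) - ka`_i) <= \sum_(i < n.+1) (Posz (posp la`_i) - la`_i).
  rewrite [leRHS]big_ord_recl ler_wpDl//; first by rewrite subr_ge0 posp_ge.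
  apply: ler_sum => i _; rewrite lift0; have /andP[+ _] := il i (ltn_ord i).
  move: (ka`_i) (la`_i.+1) => x y; case: x => x; case: y => y /=; rewrite ?NegzE; lia.
rewrite !sumrB; lra.
Qed.

Lemma GroE P q la : 0 < q -> q <= P ->
  Gro P q la = q ^ sig_sum la * (P / q) ^+ (\sum_(x <- la) posp x).
Proof.
move=> q0 qP; rewrite /Gro /sig_sum; elim: la => [|x la IH].
  by rewrite !big_nil expr0z mulr1.
by rewrite !big_cons IH groE// mulrACA -expfzDr ?gt_eqF// -exprD.
Qed.

Lemma expz_le_gro P q a x : 0 < q -> q <= a -> a <= P -> a ^ x <= gro P q x.
Proof.
move=> q0 qa aP; have a0 : 0 < a by exact: lt_le_trans qa.
case: x => n; rewrite /gro /=.
  by rewrite -!exprnP lerXn2r// nnegrE ltW// (lt_le_trans a0).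
by rewrite NegzE -!exprnN lef_pV2 ?posrE ?exprn_gt0// lerXn2r// nnegrE ltW.
Qed.

Lemma Gro_interlace n P q a la ka : 0 < q -> q <= a -> a <= P ->
  GT n.+1 la -> GT n ka -> skew_schur1 a la ka * Gro P q ka <= Gro P q la.
Proof.
move=> q0 qa aP laGT kaGT; have qP := le_trans qa aP.
rewrite /skew_schur1; case: ifPn => il; last by rewrite mul0r ltW// Gro_gt0.
apply: (@le_trans _ _ (gro P q (sig_sum la - sig_sum ka) * Gro P q ka)).
  by rewrite ler_wpM2r ?(ltW (Gro_gt0 _ q0 qP))// expz_le_gro.
rewrite groE// !GroE// mulrACA -expfzDr ?gt_eqF// subrK -exprD.
rewrite ler_wpM2l ?exprz_ge0 ?(ltW q0)// ler_weXn2l//.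
  by rewrite ler_pdivlMr// mul1r.
exact: (posp_interlace laGT kaGT).
Qed.

Lemma asummable_geom2 (t : R) : 1 < t -> asummable (fun x : int => t^-1 ^+ absz x).
Proof.
move=> t1; have t0 : 0 < t by exact: lt_trans t1.
have tV0 : 0 <= t^-1 by rewrite invr_ge0 ltW.
have tV1 : `|t^-1| < 1 by rewrite ger0_norm// invf_lt1.
have c1 : cvgn (series (geometric 1 t^-1)) by exact: is_cvg_geometric_series.
apply: asummable_halves; apply: (series_le_cvg _ _ _ c1) => n //=;
  rewrite ?mul1r ?exprn_ge0// ger0_norm ?exprn_ge0//.
by rewrite ler_wiXn2l// ltW// -[ltLHS]ger0_norm.
Qed.

(** [Gro_interlace] bounds each term but says nothing about how many signatures interlace with [la].
    Applied at the wider radii P t and q / t, it leaves a factor t^(-|ka_i|) for every part, which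
    is summable. *)
Lemma skew_schur1_bound n (P q a t : R) : 0 < q -> q <= a -> a <= P -> 1 < t ->
  exists2 C : R, 0 <= C & forall la, GT n.+1 la ->
  (\esum_(ka in GT n) (skew_schur1 a la ka * Gro P q ka)%:E <=
   (C * Gro (P * t) (q / t) la)%:E)%E.
Proof.
move=> q0 qa aP t1; have t0 : 0 < t by exact: lt_trans t1.
have a0 : 0 < a by exact: lt_le_trans qa.
have P0 : 0 < P by exact: lt_le_trans aP.
have tV0 : 0 <= t^-1 by rewrite invr_ge0 ltW.
have st := asummable_geom2 t1.
have g0 x : 0 <= t^-1 ^+ absz x by rewrite exprn_ge0.
pose b := bisum (fun x : int => t^-1 ^+ absz x).
have b0 : 0 <= b by apply: bisum_ge0 => //; exact: asummable_bicvg.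
have q'0 : 0 < q / t by rewrite divr_gt0.
have q'q : q / t <= q by rewrite ler_pdivrMr// ler_peMr ?ltW.
have PP' : P <= P * t by rewrite ler_peMr ?ltW.
have q'P' : q / t <= P * t by rewrite (le_trans q'q)// (le_trans qa)// (le_trans aP).
exists (b ^+ n) => [|la laGT]; first exact: exprn_ge0.
have G0 := ltW (Gro_gt0 la q'0 q'P').
apply: (@le_trans _ _ (\esum_(ka in GT n) ((Gro (P * t) (q / t) la)%:E *
    (\prod_(i < n) t^-1 ^+ absz ka`_i)%:E)%E)).
  apply: le_esum => ka kaGT; rewrite -EFinM lee_fin.
  have GE : Gro P q ka = Gro (P * t) (q / t) ka * \prod_(i < n) t^-1 ^+ absz ka`_i.
    have -> : \prod_(i < n) t^-1 ^+ absz ka`_i = \prod_(x <- ka) t^-1 ^+ absz x.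
      by rewrite (big_nth 0) (proj1 kaGT) big_mkord.
    rewrite /Gro -big_split/=; apply: eq_bigr => x _.
    by rewrite -gro_scale// -mulrA -exprMn mulfV ?expr1n ?mulr1// gt_eqF.
  rewrite GE mulrA ler_wpM2r ?prodr_ge0//.
  apply: (@Gro_interlace n) => //; first exact: le_trans q'q qa.
  exact: le_trans aP PP'.
rewrite (ge0_esumZl G0); last by move=> ka _; rewrite lee_fin prodr_ge0.
rewrite [b ^+ n * _]mulrC EFinM lee_wpmul2l ?lee_fin//.
have -> : b ^+ n = \prod_(i < n) b by rewrite prodr_const card_ord.
apply: (@esum_prod_le n (fun _ x => t^-1 ^+ absz x) (fun=> b)) => // i _.
by rewrite ge0_bisum_esum//; exact: asummable_bicvg.
Qed.

Lemma det_le_perm n (A : 'I_n -> 'I_n -> R) : (forall i j, 0 <= A i j) ->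
  \det (\matrix_(i, j) A i j) <= \sum_(s : 'S_n) \prod_i A i (s i).
Proof.
move=> A0; apply: ler_sum => s _.
rewrite (eq_bigr (fun i => A i (s i))); last by move=> i _; rewrite mxE.
have p0 : 0 <= \prod_i A i (s i) by apply: prodr_ge0.
by case: (odd_perm s); rewrite ?expr1 ?expr0 ?mulN1r ?mul1r//; lra.
Qed.

(** A determinant with nonnegative entries is at most the permanent, whose terms are products over
    the parts, as [esum_prod_le] requires. *)
Lemma esum_det_bound n (P q : R) (F : 'I_n -> 'I_n -> int -> R) (b : 'I_n -> 'I_n -> R) :
  0 < q -> q <= P -> (forall i j x, 0 <= F i j x) ->
  (forall i j, \esum_(x in [set: int]) (F i j x * gro P q x)%:E <= (b i j)%:E)%E ->
  (\esum_(la in GT n) (\det (\matrix_(i, j) F i j (la`_i)) * Gro P q la)%:E <=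
   (\sum_(s : 'S_n) \prod_i b i (s i))%:E)%E.
Proof.
move=> q0 qP F0 Fb; have g0 x := ltW (gro_gt0 x q0 qP).
apply: (@le_trans _ _ (\esum_(la in GT n) \sum_(s : 'S_n)
    (\prod_i (F i (s i) la`_i * gro P q la`_i))%:E)%E).
  apply: le_esum => la laGT; rewrite sumEFin lee_fin.
  rewrite (eq_bigr (fun s : 'S_n => (\prod_i F i (s i) la`_i) * Gro P q la)).
    rewrite -mulr_suml ler_wpM2r ?(ltW (Gro_gt0 _ q0 qP))//.
    exact: (@det_le_perm n (fun i j => F i j la`_i)).
  by move=> s _; rewrite big_split/= /Gro (big_nth 0) (proj1 laGT) big_mkord.
rewrite esum_sum; last first.
  by move=> la s _ _; rewrite lee_fin prodr_ge0// => i _; rewrite mulr_ge0.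
rewrite -sumEFin; apply: lee_sum => s _.
(* [esum_prod_le] takes families indexed by [nat]; the default 0 only occurs at indices from [n]
   on. *)
pose u (i : nat) x : R := if insub i is Some i' then F i' (s i') x * gro P q x else 0.
pose c (i : nat) : R := if insub i is Some i' then b i' (s i') else 0.
have := @esum_prod_le n u c.
rewrite (eq_bigr (fun i : 'I_n => b i (s i))); last by move=> i _; rewrite /c valK.
rewrite (eq_esum (b := fun la : seq int =>
    (\prod_(i < n) (F i (s i) la`_i * gro P q la`_i))%:E)); last first.
  by move=> la _; congr EFin; apply: eq_bigr => i _; rewrite /u valK.
apply=> [i x|i ni]; rewrite /u /c; last by rewrite (insubT (fun i => (i < n)%N) ni).
by case: insubP => // i' _ _; rewrite mulr_ge0.
Qed.

(** No radius is lost here, in contrast with [skew_schur1_bound]: the sum over each part runs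
    against [M] and converges by itself, while submultiplicativity of [gro] moves the weight from
    ka_i to the part of [la] chosen by the permutation, up to a constant. Summing over the lower
    signature reflects [M], hence the argument -y. *)
Lemma skew_schur_bound n (P q : R) (M : int -> R) : 0 < q -> q <= P ->
  tn setT (toep M) -> asummable (fun y => M (- y) * P ^ y) ->
  asummable (fun y => M (- y) * q ^ y) ->
  exists2 C : R, 0 <= C & forall la, GT n la ->
  (\esum_(ka in GT n) (skew_schur M la ka * Gro P q ka)%:E <= (C * Gro P q la)%:E)%E.
Proof.
move=> q0 qP tM sP sq; have g0 x := ltW (gro_gt0 x q0 qP).
have P0 : 0 < P by exact: lt_le_trans qP.
have M0 x : 0 <= M x by exact: toep_ge0.
have sg : asummable (fun y => M (- y) * gro P q y).
  apply: (le_asummable (g := fun y => M (- y) * P ^ y + M (- y) * q ^ y)); last exact: asummableD.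
  move=> y; rewrite -mulrDr !normrM ler_wpM2l//.
  rewrite !ger0_norm ?gro_le_sum// addr_ge0// exprz_ge0// ltW//.
have Mg0 y : 0 <= M (- y) * gro P q y by rewrite mulr_ge0.
pose b := bisum (fun y => M (- y) * gro P q y).
have b0 : 0 <= b by apply: bisum_ge0 => //; exact: asummable_bicvg.
exists (\sum_(s : 'S_n) \prod_(i < n) (b * gro P q (i%:Z - (s i : nat)%:Z))).
  by apply: sumr_ge0 => s _; apply: prodr_ge0 => i _; rewrite mulr_ge0.
move=> la laGT.
have E ka : GT n ka -> skew_schur M la ka = \det (\matrix_(i < n, j < n)
    (fun (i j : 'I_n) (x : int) => M (pos la j - (x - (i : nat)%:Z))) i j (ka`_i)).
  move=> kaGT; rewrite (skew_schurE _ _ (proj1 laGT)) -det_tr; congr (\det _).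
  by apply/matrixP => i j; rewrite !mxE.
under eq_esum => ka kaGT do rewrite E//.
have -> : (\sum_(s : 'S_n) \prod_(i < n) (b * gro P q (i%:Z - (s i : nat)%:Z))) * Gro P q la =
    \sum_(s : 'S_n) \prod_(i < n) (b * gro P q (i%:Z - (s i : nat)%:Z) * gro P q (la`_(s i))).
  rewrite mulr_suml; apply: eq_bigr => s _; rewrite [RHS]big_split/=; congr (_ * _).
  by rewrite /Gro (big_nth 0) (proj1 laGT) big_mkord (reindex_inj (@perm_inj _ s)).
apply: (esum_det_bound (F := fun (i j : 'I_n) x => M (pos la j - (x - (i : nat)%:Z)))
  (b := fun i j : 'I_n => b * gro P q (i%:Z - (j : nat)%:Z) * gro P q la`_j)) => // i j.
set c : int := la`_j + (i%:Z - j%:Z).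
apply: (@le_trans _ _ (\esum_(x in [set: int]) ((gro P q (i%:Z - j%:Z) * gro P q la`_j)%:E *
   (M (- (x - c)) * gro P q (x - c))%:E))%E).
  apply: le_esum => x _; rewrite -EFinM lee_fin.
  have -> : pos la j - (x - (i : nat)%:Z) = - (x - c) by rewrite /pos /c; move: (la`_j) => y; lia.
  rewrite mulrCA ler_wpM2l// mulrC [X in _ <= _ * X]mulrC -{1}(subrK c x).
  apply: le_trans (groD _ _ q0 qP) _; rewrite ler_wpM2l//; exact: groD.
rewrite ge0_esumZl ?mulr_ge0//; last by move=> x _; rewrite lee_fin.
rewrite -(reindex_esum _ _ _ (fun y => (M (- y) * gro P q y)%:E) (set_bij_shift c)).
rewrite ge0_bisum_esum//; last exact: asummable_bicvg.
by rewrite -EFinM lee_fin mulrC mulrA.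
Qed.

Lemma Psi_det_bound N (P q : R) (Psi : int -> int -> R) : 0 < q -> q <= P ->
  totally_nonneg N Psi ->
  (forall j, (1 <= j <= N)%N -> asummable (fun m => Psi_gen Psi j m * P ^ m)) ->
  (forall j, (1 <= j <= N)%N -> asummable (fun m => Psi_gen Psi j m * q ^ m)) ->
  (\esum_(la in GT N) (Psi_det N Psi la * Gro P q la)%:E < +oo)%E.
Proof.
move=> q0 qP tP sP sq; have g0 x := ltW (gro_gt0 x q0 qP).
have P0 : 0 < P by exact: lt_le_trans qP.
have Psi0 x (j : 'I_N) : 0 <= Psi x (- j.+1%:Z).
  apply: (@tn_entry _ [set j : int | is_true (- N%:Z <= j <= -1)] Psi) => //=.
  by have := ltn_ord j; lia.
pose f (j : 'I_N) y := Psi_gen Psi j.+1 y * gro P q y.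
have f0 j y : 0 <= f j y by rewrite mulr_ge0// Psi0.
have sg j : asummable (f j).
  have jN : (1 <= j.+1 <= N)%N by rewrite ltn_ord.
  apply: (le_asummable (g := fun y => Psi_gen Psi j.+1 y * P ^ y + Psi_gen Psi j.+1 y * q ^ y)).
    move=> y; rewrite -mulrDr !normrM ler_wpM2l//.
    rewrite !ger0_norm ?gro_le_sum// addr_ge0// exprz_ge0// ltW//.
  by apply: asummableD; [exact: sP|exact: sq].
pose b (i j : 'I_N) := gro P q (i%:Z - (j : nat)%:Z) * bisum (f j).
apply: (@le_lt_trans _ _ (\sum_(s : 'S_N) \prod_i b i (s i))%:E); last exact: ltry.
apply: (esum_det_bound (F := fun i j x => Psi (x - i.+1%:Z) (- j.+1%:Z))) => // i j.
set c : int := i%:Z - j%:Z.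
apply: (@le_trans _ _ (\esum_(x in [set: int]) ((gro P q c)%:E * (f j (x - c))%:E))%E).
  apply: le_esum => x _; rewrite -EFinM lee_fin /f /Psi_gen.
  have -> : x - i.+1%:Z = x - c - j.+1%:Z by rewrite /c; lia.
  rewrite [leRHS]mulrCA ler_wpM2l ?Psi0// -{1}(subrK c x) addrC; exact: groD.
rewrite ge0_esumZl//; last by move=> x _; rewrite lee_fin.
rewrite -(reindex_esum _ _ _ (fun y => (f j y)%:E) (set_bij_shift c)).
by rewrite ge0_bisum_esum//; exact: asummable_bicvg.
Qed.

End growth.

(** * Normalized weights *)

Section normalization.
Context {R : realType} {T : choiceType}.
Implicit Types (A B : set T) (f : T -> R).

Lemma esum_eq_support A B f : A `<=` B -> (forall x, B x -> 0 <= f x) ->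
  (forall x, B x -> ~ A x -> f x = 0) ->
  \esum_(x in A) (f x)%:E = \esum_(x in B) (f x)%:E.
Proof.
move=> AB f0 fA; rewrite [RHS](esumID A); last by move=> x Bx; rewrite lee_fin f0.
by rewrite (setIidr AB) [X in (_ + X)%E]esum1 ?adde0// => x [Bx /fA ->].
Qed.

Lemma fin_esum A f : (forall x, A x -> 0 <= f x) -> (\esum_(x in A) (f x)%:E < +oo)%E ->
  \esum_(x in A) (f x)%:E = (fine (\esum_(x in A) (f x)%:E))%:E.
Proof.
by move=> f0 lt; rewrite fineK// ge0_fin_numE// esum_ge0// => x /f0; rewrite lee_fin.
Qed.

Lemma normalized_ge0 A f x : (forall x, A x -> 0 <= f x) -> A x -> 0 <= normalized A f x.
Proof.
move=> f0 Ax; rewrite /normalized divr_ge0 ?f0// fine_ge0// esum_ge0// => y /f0.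
Qed.

Lemma normalized_mulK A f x : (forall x, A x -> 0 <= f x) ->
  (\esum_(x in A) (f x)%:E < +oo)%E -> A x ->
  normalized A f x * fine (\esum_(x in A) (f x)%:E) = f x.
Proof.
move=> f0 lt Ax; rewrite /normalized.
have [z0|z0] := eqVneq (fine (\esum_(x in A) (f x)%:E)) 0; last by rewrite divfK.
rewrite z0 mulr0; apply/eqP; rewrite eq_le f0// -lee_fin.
have : ((f x)%:E <= \esum_(x in A) (f x)%:E)%E.
  by apply: (@esum_ge_term R T A (fun x => (f x)%:E)) => //; rewrite lee_fin f0.
by rewrite fin_esum// z0.
Qed.

Lemma esum_normalized A f : normalizable A f ->
  \esum_(x in A) (normalized A f x)%:E = 1%E.
Proof.
move=> [f0 /andP[gt lt]]; have zE := fin_esum f0 lt.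
have z0 : 0 < fine (\esum_(x in A) (f x)%:E) by rewrite -lte_fin -zE.
rewrite (eq_esum (b := fun x => ((fine (\esum_(x in A) (f x)%:E))^-1%:E * (f x)%:E)%E)); last first.
  by move=> x _; rewrite -EFinM mulrC.
rewrite ge0_esumZl ?invr_ge0 ?(ltW z0)//.
by rewrite {2}zE -EFinM mulVf// gt_eqF.
Qed.

End normalization.

(** * Sequential updates along an abstract chain of levels *)

Section chain.
Context {R : realType} {I : eqType} {T : choiceType}.
(** [w s x x'] weighs [x] on level [s] over [x'] on the preceding level, [V y x] models s_(y/x)(Q)
    between the new and the old state of one level, and [h s] is the constant of the skew Cauchy
    identity. The relation [e s' s] says that [s'] immediately precedes [s]. *)
Variables (S : I -> set T) (w : I -> T -> T -> R) (V : T -> T -> R) (e : rel I) (h : I -> R).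
Hypothesis w0 : forall s' s x x', e s' s -> S s x -> S s' x' -> 0 <= w s x x'.
Hypothesis V0 : forall s x y, S s x -> S s y -> 0 <= V y x.
Hypothesis h0 : forall s' s, e s' s -> 0 < h s.
Hypothesis link_fin : forall s' s x y', e s' s -> S s x -> S s' y' ->
  (\esum_(y in S s) (w s y y' * V y x)%:E < +oo)%E.
(* The skew Cauchy identity, linking the levels [s'] and [s]. *)
Hypothesis link : forall s' s x y', e s' s -> S s x -> S s' y' ->
  (\esum_(y in S s) (w s y y' * V y x)%:E =
   (h s)%:E * \esum_(x' in S s') (w s x x' * V y' x')%:E)%E.

Fixpoint chains (ss : seq I) : set (seq T) :=
  if ss is s :: ss' then cons_set (S s) (chains ss') else [set [::]].

Fixpoint wprod (x' : T) (ss : seq I) (xs : seq T) : R :=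
  match ss, xs with
  | s :: ss', x :: xs' => w s x x' * wprod x ss' xs'
  | _, _ => 1
  end.

Definition update s (y' x : T) : T -> R := normalized (S s) (fun y => w s y y' * V y x).

Fixpoint pprod (y' : T) (ss : seq I) (xs ys : seq T) : R :=
  match ss, xs, ys with
  | s :: ss', x :: xs', y :: ys' => update s y' x y * pprod y ss' xs' ys'
  | _, _, _ => 1
  end.

Let wV0 s' s x y' : e s' s -> S s x -> S s' y' -> forall y, S s y -> 0 <= w s y y' * V y x.
Proof.
by move=> es Sx Sy' y Sy; apply: mulr_ge0; [exact: w0 es Sy Sy'|exact: V0 Sx Sy].
Qed.

Lemma update_ge0 s' s x y' y : e s' s -> S s x -> S s' y' -> S s y -> 0 <= update s y' x y.
Proof. by move=> es Sx Sy' Sy; apply: normalized_ge0 => //; exact: wV0 Sx Sy'. Qed.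

Lemma update_gt0 s' s x y' y : e s' s -> S s x -> S s' y' -> S s y ->
  0 < update s y' x y -> 0 < w s y y' /\ 0 < V y x.
Proof.
move=> es Sx Sy' Sy up; have wy := w0 es Sy Sy'; have Vy := V0 Sx Sy.
have : w s y y' * V y x != 0.
  by apply: contraTneq up; rewrite /update /normalized => ->; rewrite mul0r ltxx.
by rewrite mulf_eq0 negb_or !lt0r wy Vy !andbT => /andP.
Qed.

Lemma wprod_ge0 s' ss x' xs : path e s' ss -> S s' x' -> chains ss xs -> 0 <= wprod x' ss xs.
Proof.
elim: ss s' x' xs => [|s ss IH] s' x' xs /=; first by [].
move=> /andP[es pt] Sx' [x [t [Sx Ct ->]]] /=; apply: mulr_ge0; first exact: w0 es Sx Sx'.
exact: IH pt Sx Ct.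
Qed.

Lemma pprod_ge0 s' ss y' xs ys : path e s' ss -> S s' y' -> chains ss xs -> chains ss ys ->
  0 <= pprod y' ss xs ys.
Proof.
elim: ss s' y' xs ys => [|s ss IH] s' y' xs ys /=; first by [].
move=> /andP[es pt] Sy' [x [t [Sx Ct ->]]] [y [r [Sy Cr ->]]] /=.
apply: mulr_ge0; [exact: update_ge0 es Sx Sy' Sy|exact: IH pt Sy Ct Cr].
Qed.

Lemma pprod_gt0 s' ss y' xs ys : path e s' ss -> S s' y' -> chains ss xs -> chains ss ys ->
  0 < pprod y' ss xs ys -> 0 < wprod y' ss ys.
Proof.
elim: ss s' y' xs ys => [|s ss IH] s' y' xs ys /=; first by [].
move=> /andP[es pt] Sy' [x [t [Sx Ct ->]]] [y [r [Sy Cr ->]]] /=.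
have u0 := update_ge0 es Sx Sy' Sy; have p0 := pprod_ge0 pt Sy Ct Cr.
rewrite lt0r mulf_eq0 negb_or => /andP[/andP[un pn] _].
have up : 0 < update s y' x y by rewrite lt0r un.
have pp : 0 < pprod y ss t r by rewrite lt0r pn.
by rewrite mulr_gt0//; [case: (update_gt0 es Sx Sy' Sy up)|exact: IH pt Sy Ct Cr pp].
Qed.

Lemma chains_last s' ss x' xs : S s' x' -> chains ss xs -> S (last s' ss) (last x' xs).
Proof.
elim: ss s' x' xs => [|s ss IH] s' x' xs /=; first by move=> Sx ->.
by move=> _ [x [t [Sx Ct ->]]] /=; exact: IH.
Qed.

(** By the link, the normalizing sum is [h s] times a sum over the preceding level, in which the old
    state [x'] contributes a positive term. *)
Lemma link_normalizable s' s x y' x' : e s' s -> S s x -> S s' y' -> S s' x' ->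
  0 < w s x x' -> 0 < V y' x' -> normalizable (S s) (fun y => w s y y' * V y x).
Proof.
move=> es Sx Sy' Sx' wp Vp; split; first exact: wV0 es Sx Sy'.
rewrite (link_fin es Sx Sy') andbT (link es Sx Sy') mule_gt0 ?lte_fin ?(h0 es)//.
apply: lt_le_trans (@esum_ge_term R T (S s') (fun x' => (w s x x' * V y' x')%:E) x' Sx' _).
  by rewrite lte_fin mulr_gt0.
by rewrite lee_fin ltW// mulr_gt0.
Qed.

(** The invariant is [0 < V y' x']: it makes the next update normalizable, and every [y] drawn with
    positive probability satisfies it again. The other [y] contribute 0. *)
Lemma chain_stochastic s' ss x' y' xs : path e s' ss -> S s' x' -> S s' y' ->
  0 < V y' x' -> chains ss xs -> 0 < wprod x' ss xs ->
  \esum_(ys in chains ss) (pprod y' ss xs ys)%:E = 1%E.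
Proof.
elim: ss s' x' y' xs => [|s ss IH] s' x' y' xs /=.
  by move=> *; rewrite esum_set1.
move=> /andP[es pt] Sx' Sy' Vp [x [t [Sx Ct ->]]] /= wp.
have wx := w0 es Sx Sx'; have wt := wprod_ge0 pt Sx Ct.
have [wx0 wt0] : 0 < w s x x' /\ 0 < wprod x ss t.
  by move: wp; rewrite lt0r mulf_eq0 negb_or !lt0r wx wt !andbT => /andP[/andP].
rewrite esum_cons_set; last first.
  move=> y r Sy Cr; rewrite lee_fin mulr_ge0//; first exact: update_ge0 es Sx Sy' Sy.
  exact: pprod_ge0 pt Sy Ct Cr.
rewrite -[RHS](esum_normalized (link_normalizable es Sx Sy' Sx' wx0 Vp)).
apply: eq_esum => y Sy.
have u0 := update_ge0 es Sx Sy' Sy.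
under eq_esum do rewrite EFinM.
rewrite (ge0_esumZl u0); last by move=> r Cr; rewrite lee_fin; exact: pprod_ge0 pt Sy Ct Cr.
have [uz|un] := eqVneq (update s y' x y) 0; first by rewrite uz mul0e -/(update s y' x y) uz.
have up : 0 < update s y' x y by rewrite lt0r un.
have [_ Vy] := update_gt0 es Sx Sy' Sy up.
by rewrite (IH s x y t pt Sx Sy Vy Ct wt0) mule1.
Qed.

(** Summing out the old state [x'] first yields, by the link, the normalizing sum of the next update
    divided by [h s]. It cancels the denominator of [update] and leaves [w s y y' * V y x], which is
    the same expression one level higher. The factor [V y' x'] in the summand is there for this
    induction; at the empty root it equals 1. *)
Lemma chain_intertwine s' ss y' ys (F : T -> R) : path e s' ss -> S s' y' -> chains ss ys ->
  (forall x, S (last s' ss) x -> 0 <= F x) ->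
  \esum_(x' in S s') \esum_(xs in chains ss)
     (V y' x' * wprod x' ss xs * F (last x' xs) * pprod y' ss xs ys)%:E =
  (((\prod_(s <- ss) h s)^-1 * wprod y' ss ys)%:E *
   \esum_(x in S (last s' ss)) (V (last y' ys) x * F x)%:E)%E.
Proof.
elim: ss s' y' ys => [|s ss IH] s' y' ys /=.
  move=> _ Sy' -> F0; rewrite big_nil invr1 mulr1 mul1e; apply: eq_esum => x' Sx'.
  by rewrite esum_set1/= ?mulr1// lee_fin mulr_ge0 ?F0//; exact: V0 Sx' Sy'.
move=> /andP[es pt] Sy' [y [r [Sy Cr ->]]] F0 /=.
have hs := h0 es.
rewrite esum_swap; last first.
  move=> x' xs Sx' [x [t [Sx Ct ->]]] /=; rewrite lee_fin.
  have v1 := V0 Sx' Sy'; have w1 := w0 es Sx Sx'; have p1 := wprod_ge0 pt Sx Ct.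
  have F1 := F0 _ (chains_last Sx Ct); have u1 := update_ge0 es Sx Sy' Sy.
  have q1 := pprod_ge0 pt Sy Ct Cr.
  by repeat (apply: mulr_ge0 => //).
have inner x t : S s x -> chains ss t ->
    \esum_(x' in S s') (V y' x' * (w s x x' * wprod x ss t) * F (last x t) *
        (update s y' x y * pprod y ss t r))%:E =
    (((h s)^-1 * w s y y')%:E * (V y x * wprod x ss t * F (last x t) * pprod y ss t r)%:E)%E.
  move=> Sx Ct.
  set c := wprod x ss t * F (last x t) * (update s y' x y * pprod y ss t r).
  have c0 : 0 <= c.
    have p1 := wprod_ge0 pt Sx Ct; have F1 := F0 _ (chains_last Sx Ct).
    have u1 := update_ge0 es Sx Sy' Sy; have q1 := pprod_ge0 pt Sy Ct Cr.
    by repeat (apply: mulr_ge0 => //).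
  under eq_esum => x' _.
    have -> : V y' x' * (w s x x' * wprod x ss t) * F (last x t) *
        (update s y' x y * pprod y ss t r) = c * (w s x x' * V y' x') by rewrite /c; ring.
    rewrite EFinM; over.
  rewrite (ge0_esumZl c0); last first.
    by move=> x' Sx'; rewrite lee_fin mulr_ge0//; [exact: w0 es Sx Sx'|exact: V0 Sx' Sy'].
  have lf := link_fin es Sx Sy'.
  have Z := fin_esum (wV0 es Sx Sy') lf.
  have nk := normalized_mulK (wV0 es Sx Sy') lf Sy.
  have hE : \esum_(x' in S s') (w s x x' * V y' x')%:E =
      ((h s)^-1 * fine (\esum_(y in S s) (w s y y' * V y x)%:E))%:E.
    rewrite EFinM -Z (link es Sx Sy') muleA -EFinM mulVf ?mul1e// gt_eqF//.
  rewrite hE -!EFinM; congr EFin.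
  rewrite (_ : (h s)^-1 * w s y y' * (V y x * wprod x ss t * F (last x t) * pprod y ss t r) =
    (h s)^-1 * (w s y y' * V y x) * (wprod x ss t * F (last x t) * pprod y ss t r)); last by ring.
  by rewrite -nk /c /update; ring.
rewrite esum_cons_set; last first.
  move=> x t Sx Ct; apply: esum_ge0 => x' Sx' /=; rewrite lee_fin.
  have v1 := V0 Sx' Sy'; have w1 := w0 es Sx Sx'; have p1 := wprod_ge0 pt Sx Ct.
  have F1 := F0 _ (chains_last Sx Ct); have u1 := update_ge0 es Sx Sy' Sy.
  have q1 := pprod_ge0 pt Sy Ct Cr.
  by repeat (apply: mulr_ge0 => //).
have w1 : 0 <= (h s)^-1 * w s y y'.
  by rewrite mulr_ge0 ?invr_ge0 ?(ltW hs)//; exact: w0 es Sy Sy'.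
have B0 x t : S s x -> chains ss t ->
    0 <= V y x * wprod x ss t * F (last x t) * pprod y ss t r.
  move=> Sx Ct; have p1 := wprod_ge0 pt Sx Ct; have F1 := F0 _ (chains_last Sx Ct).
  have v1 := V0 Sx Sy; have q1 := pprod_ge0 pt Sy Ct Cr.
  by repeat (apply: mulr_ge0 => //).
transitivity (\esum_(x in S s) (((h s)^-1 * w s y y')%:E * \esum_(t in chains ss)
    (V y x * wprod x ss t * F (last x t) * pprod y ss t r)%:E))%E.
  apply: eq_esum => x Sx; rewrite -(ge0_esumZl w1); last first.
    by move=> t Ct; rewrite lee_fin B0.
  by apply: eq_esum => t Ct /=; rewrite inner.
rewrite (ge0_esumZl w1); last first.
  by move=> x Sx; apply: esum_ge0 => t Ct; rewrite lee_fin B0.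
rewrite (IH s y r pt Sy Cr F0) muleA -EFinM; congr (_%:E * _)%E.
by rewrite big_cons invfM; ring.
Qed.

(** Sums out the lowest level first, each time trading [G s'] for [C s * G s]; [F] is met only at
    the last level. *)
Lemma chain_bound (G : I -> T -> R) (C : I -> R) s' ss (F : T -> R) : path e s' ss ->
  (forall s x, S s x -> 0 <= G s x) ->
  (forall s' s, e s' s -> 0 <= C s) ->
  (forall s' s x, e s' s -> S s x ->
     \esum_(x' in S s') (w s x x' * G s' x')%:E <= (C s * G s x)%:E)%E ->
  (forall x, S (last s' ss) x -> 0 <= F x) ->
  (\esum_(x' in S s') \esum_(xs in chains ss) (G s' x' * wprod x' ss xs * F (last x' xs))%:E <=
   (\prod_(s <- ss) C s)%:E * \esum_(x in S (last s' ss)) (G (last s' ss) x * F x)%:E)%E.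
Proof.
move=> + G0 C0 GC; elim: ss s' => [|s ss IH] s' /=.
  move=> _ F0; rewrite big_nil mul1e; apply: le_esum => x' Sx'.
  rewrite esum_set1/=; last by rewrite lee_fin mulr1 mulr_ge0 ?F0 ?G0.
  by rewrite mulr1.
move=> /andP[es pt] F0 /=; have Cs := C0 _ _ es.
rewrite esum_swap; last first.
  move=> x' xs Sx' [x [t [Sx Ct ->]]] /=; rewrite lee_fin.
  have g1 := G0 _ _ Sx'; have w1 := w0 es Sx Sx'; have p1 := wprod_ge0 pt Sx Ct.
  have F1 := F0 _ (chains_last Sx Ct).
  by repeat (apply: mulr_ge0 => //).
rewrite esum_cons_set; last first.
  move=> x t Sx Ct; apply: esum_ge0 => x' Sx' /=; rewrite lee_fin.
  have g1 := G0 _ _ Sx'; have w1 := w0 es Sx Sx'; have p1 := wprod_ge0 pt Sx Ct.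
  have F1 := F0 _ (chains_last Sx Ct).
  by repeat (apply: mulr_ge0 => //).
have B0 x t : S s x -> chains ss t -> 0 <= wprod x ss t * F (last x t).
  move=> Sx Ct; rewrite mulr_ge0//; first exact: wprod_ge0 pt Sx Ct.
  by apply: F0; exact: chains_last Ct.
apply: (@le_trans _ _ (\esum_(x in S s) ((C s)%:E * \esum_(t in chains ss)
    (G s x * wprod x ss t * F (last x t))%:E))%E).
  apply: le_esum => x Sx; rewrite -(ge0_esumZl Cs); last first.
    by move=> t Ct; rewrite lee_fin -mulrA mulr_ge0 ?G0 ?B0.
  apply: le_esum => t Ct /=; have b0 := B0 x t Sx Ct.
  under eq_esum => x' _.
    have -> : G s' x' * (w s x x' * wprod x ss t) * F (last x t) =
       (wprod x ss t * F (last x t)) * (w s x x' * G s' x') by ring.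
    rewrite EFinM; over.
  rewrite (ge0_esumZl b0); last first.
    by move=> x' Sx'; rewrite lee_fin mulr_ge0 ?G0//; exact: w0 es Sx Sx'.
  apply: (@le_trans _ _ ((wprod x ss t * F (last x t))%:E * (C s * G s x)%:E)%E).
    by rewrite lee_wpmul2l ?lee_fin//; exact: GC es Sx.
  by rewrite -!EFinM lee_fin le_eqVlt; apply/orP; left; apply/eqP; ring.
rewrite (ge0_esumZl Cs); last first.
  by move=> x Sx; apply: esum_ge0 => t Ct; rewrite lee_fin -mulrA mulr_ge0 ?G0 ?B0.
rewrite big_cons EFinM -muleA lee_wpmul2l ?lee_fin//; exact: IH.
Qed.

End chain.

(** * Choice of the radii *)

Section radii.
Context {R : realType}.
Variable a : nat -> R.

(** The starting value 1 is an allowed radius, since every annulus contains the unit circle, and it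
    also provides a radius for the empty level. *)
Fixpoint amax k : R := if k is k'.+1 then Num.max (amax k') (a k) else 1.
Fixpoint amin k : R := if k is k'.+1 then Num.min (amin k') (a k) else 1.

Lemma amax_gt0 k : 0 < amax k.
Proof. by elim: k => //= k IH; rewrite lt_max IH. Qed.

Lemma amin_gt0 k : (forall j, (1 <= j <= k)%N -> 0 < a j) -> 0 < amin k.
Proof.
elim: k => //= k IH ha; rewrite lt_min ha ?ltnSn// andbT; apply: IH => j /andP[j1 jk].
by apply: ha; rewrite j1 ltnW.
Qed.

Lemma amin_le_amax k : amin k <= amax k.
Proof.
elim: k => //= k IH; rewrite ge_min !le_max IH//.
Qed.

(* The factors [t ^+ k] leave room for the loss of a factor [t] in the radii at
   each step from length k - 1 to length k. *)
Definition rad_hi (t : R) k : R := amax k * t ^+ k.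
Definition rad_lo (t : R) k : R := amin k / t ^+ k.

Lemma rad_lo_gt0 t k : 1 < t -> (forall j, (1 <= j <= k)%N -> 0 < a j) -> 0 < rad_lo t k.
Proof. by move=> t1 ak; rewrite divr_gt0 ?amin_gt0// exprn_gt0// (lt_trans _ t1). Qed.

Lemma rad_lo_le_hi t k : 1 < t -> rad_lo t k <= rad_hi t k.
Proof.
move=> t1; have tk : 1 <= t ^+ k by exact: exprn_ege1 (ltW t1).
rewrite ler_pdivrMr ?(lt_le_trans ltr01 tk)// -mulrA.
apply: le_trans (amin_le_amax k) _.
by rewrite ler_peMr ?(ltW (amax_gt0 _))// mulr_ege1.
Qed.

Lemma amax_annulus (h : int -> R) k : (1 <= k)%N ->
  (forall j, (1 <= j <= k)%N -> in_analyticity_annulus h (a j)) ->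
  in_analyticity_annulus h (amax k) /\ in_analyticity_annulus h (amin k).
Proof.
move=> k1 ha.
have one : in_analyticity_annulus h 1.
  have [r1 [r2 [r10 r12 _ hol]]] := ha 1%N k1.
  by exists r1, r2; split.
elim: k {k1} ha => [//|k IH] ha /=.
have [//|i1 i2] := IH _; first by move=> j /andP[j1 jk]; apply: ha; rewrite j1 ltnW.
have ak : in_analyticity_annulus h (a k.+1) by apply: ha; rewrite /= ltnSn.
by rewrite /Num.max /Num.min; split; case: ifP.
Qed.

(** Openness of the annulus leaves room on both sides of [c]. Stated through a filter, so that a
    single t > 1 can serve finitely many such conditions at once. *)
Lemma near_annulus (h : int -> R) c k : in_analyticity_annulus h c ->
  \forall t \near (1 : R)^'+, asummable (fun n => h n * (c * t ^+ k) ^ n) /\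
                              asummable (fun n => h n * (c / t ^+ k) ^ n).
Proof.
move=> [r1 [r2 [r10 _ /andP[c1 c2] hol]]].
have S (r : R) : r1 < r < r2 -> asummable (fun n => h n * r ^ n).
  exact: laurent_holomorphic_asummable hol.
have tk : (fun t : R => t ^+ k) @ (1 : R)^'+ --> (1 : R).
  rewrite -[X in _ --> X](expr1n R k); apply: cvg_at_right_filter.
  exact: exprn_continuous.
have m1 : (fun t : R => c * t ^+ k) @ (1 : R)^'+ --> c * 1 by apply: cvgMr.
have m2 : (fun t : R => c / t ^+ k) @ (1 : R)^'+ --> c * 1^-1.
  by apply: cvgMr; apply: cvgV => //; exact: oner_neq0.
rewrite mulr1 in m1; rewrite invr1 mulr1 in m2.
near=> t; split; apply: S; apply/andP; split; near: t.
- exact: cvgr_gt m1 _ c1.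
- exact: cvgr_lt m1 _ c2.
- exact: cvgr_gt m2 _ c1.
- exact: cvgr_lt m2 _ c2.
Unshelve. all: by end_near. Qed.

Lemma near_forall_ltn (F : set_system R) (FF : Filter F) n (P : nat -> R -> Prop) :
  (forall k, (k < n)%N -> \forall t \near F, P k t) ->
  \forall t \near F, forall k, (k < n)%N -> P k t.
Proof.
elim: n => [|n IH] nP; first by near=> t.
have H1 := nP n (ltnSn n).
have H2 := IH (fun k kn => nP k (ltnW kn)).
apply: filterS2 H1 H2 => t p1 p2 k; rewrite ltnS leq_eqVlt => /orP[/eqP->//|]; exact: p2.
Unshelve. all: by end_near. Qed.

End radii.

(** * Arrays of signatures as chains *)

Section chain_products.
Context {R : realType} {I : eqType} {T : choiceType}.
Variables (S : I -> set T) (w : I -> T -> T -> R) (V : T -> T -> R) (e : rel I).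

Lemma chainsP (s0 : I) (x0 : T) ss xs : chains S ss xs <->
  size xs = size ss /\ forall i, (i < size ss)%N -> S (nth s0 ss i) (nth x0 xs i).
Proof.
elim: ss xs => [|s ss IH] [|x xs] /=.
- by split.
- by split=> [|[]].
- by split=> [[x [t []]]|[]].
split=> [[x1 [t1 [Sx /IH[sz Sxs] [-> ->]]]]|[[sz] H]].
  by split=> [|[|i]]; rewrite ?sz//; exact: Sxs.
by exists x, xs; split=> //; [exact: (H 0%N)|apply/IH; split=> // i; exact: (H i.+1)].
Qed.

Lemma wprod_map (prv : I -> I) (p : I -> T) s' ss :
  (forall s' s, e s' s -> prv s = s') -> path e s' ss ->
  wprod w (p s') ss [seq p s | s <- ss] = \prod_(s <- ss) w s (p s) (p (prv s)).
Proof.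
move=> eP; elim: ss s' => [|s ss IH] s' /=; first by rewrite big_nil.
by move=> /andP[es pt]; rewrite big_cons (eP _ _ es) IH.
Qed.

Lemma pprod_map (prv : I -> I) (p q : I -> T) s' ss :
  (forall s' s, e s' s -> prv s = s') -> path e s' ss ->
  pprod S w V (q s') ss [seq p s | s <- ss] [seq q s | s <- ss] =
  \prod_(s <- ss) update S w V s (q (prv s)) (p s) (q s).
Proof.
move=> eP; elim: ss s' => [|s ss IH] s' /=; first by rewrite big_nil.
by move=> /andP[es pt]; rewrite big_cons (eP _ _ es) IH.
Qed.

End chain_products.

Section arrays.
Variable c : nat -> nat.
Hypothesis c0 : c 0%N = 0%N.

Definition steps n : seq (nat * nat) := [seq (k, l) | k <- iota 1 n, l <- iota 0 (c k).+1].

(** The root (0, 0) carries the empty signature; [c 0 = 0] makes it the predecessor of (1, 0). *)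
Definition prev (s : nat * nat) : nat * nat :=
  if s.2 == 0%N then (s.1.-1, c s.1.-1) else (s.1, s.2.-1).

Definition follows n : rel (nat * nat) :=
  fun s' s => [&& prev s == s', (1 <= s.1 <= n)%N & (s.2 <= c s.1)%N].

Definition entry (lam : config) (s : nat * nat) : seq int := part lam s.1 s.2.

Definition flat n (lam : config) : seq (seq int) := [seq entry lam s | s <- steps n].

Lemma mem_steps n s : (s \in steps n) = (1 <= s.1 <= n)%N && (s.2 <= c s.1)%N.
Proof.
apply/allpairsPdep/idP => [[k [l [+ + ->]]]|/andP[s1 s2]].
  by rewrite !mem_iota add1n add0n !ltnS /= => -> ->.
by exists s.1, s.2; rewrite !mem_iota -surjective_pairing; split=> //; lia.
Qed.

Lemma stepsS n : steps n.+1 = steps n ++ [seq (n.+1, l) | l <- iota 0 (c n.+1).+1].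
Proof. have E : iota 1 n.+1 = iota 1 n ++ [:: n.+1] by rewrite -[n.+1]addn1 iotaD add1n addn1.
by rewrite /steps E map_cat flatten_cat /= cats0. Qed.

Lemma prod_steps (R : realType) (F : nat * nat -> R) n :
  \prod_(s <- steps n) F s =
  \prod_(1 <= k < n.+1) (F (k, 0%N) * \prod_(1 <= l < (c k).+1) F (k, l)).
Proof.
rewrite big_allpairs_dep /index_iota subSS subn0; apply: eq_bigr => k _.
by rewrite /= big_cons subSS subn0.
Qed.

Lemma follows_prev n s' s : follows n s' s -> prev s = s'.
Proof. by case/andP => /eqP. Qed.

Lemma block_path n k m : (k < n)%N -> (m <= c k.+1)%N ->
  path (follows n) (k, c k) [seq (k.+1, l) | l <- iota 0 m.+1] /\
  last (k, c k) [seq (k.+1, l) | l <- iota 0 m.+1] = (k.+1, m).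
Proof.
move=> kn; elim: m => [|m IH] mc; first by rewrite /follows /prev /= kn eqxx.
have [p1 p2] := IH (ltnW mc).
rewrite -[m.+2]addn1 iotaD map_cat cat_path last_cat p1 p2 /= add0n; split=> //.
by rewrite /follows /prev /= eqxx kn mc.
Qed.

Lemma steps_path n k : (k <= n)%N ->
  path (follows n) (0, 0)%N (steps k) /\ last (0, 0)%N (steps k) = (k, c k).
Proof.
elim: k => [|k IH] kn; first by rewrite c0.
have [p1 p2] := IH (ltnW kn); have [q1 q2] := block_path kn (leqnn _).
by rewrite stepsS cat_path last_cat p1 p2.
Qed.

Lemma flat_last n lam : last [::] (flat n lam) = part lam n (c n).
Proof.
have [_ l] := steps_path (leqnn n).
by rewrite -[LHS]/(last (entry lam (0, 0)%N) [seq entry lam s | s <- steps n]) last_map l.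
Qed.

Lemma flat_bij n : set_bij (configs n c) (chains (fun s => GT s.1) (steps n)) (flat n).
Proof.
split.
- move=> lam [sz H]; apply: (chainsP _ (0, 0)%N [::] _ _).2; rewrite size_map; split=> // i il.
  rewrite (nth_map (0, 0)%N)//; have := mem_nth (0, 0)%N il.
  by rewrite mem_steps => /andP[h1 h2]; exact: (H _ h1).2.
- move=> lam mu /set_mem[szl Hl] /set_mem[szm Hm] /eq_in_map E.
  apply: (@eq_from_nth _ [::]); first by rewrite szl szm.
  move=> k; rewrite szl => kn.
  have [s1 _] := Hl k.+1 kn; have [s2 _] := Hm k.+1 kn; rewrite /= in s1 s2.
  apply: (@eq_from_nth _ [::]); first by rewrite s1 s2.
  move=> l; rewrite s1 ltnS => lc; have := E (k.+1, l).
  by rewrite mem_steps /= kn lc => /(_ erefl).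
- move=> xs Cxs; have [sz H] := (chainsP _ (0, 0)%N [::] _ _).1 Cxs.
  (* The inverse reads the signature at (k, l) off the position of that pair in [steps n]. *)
  pose x s := nth [::] xs (index s (steps n)).
  pose lam := [seq [seq x (k, l) | l <- iota 0 (c k).+1] | k <- iota 1 n].
  have rowE k : (1 <= k <= n)%N ->
      nth [::] ([::] :: lam) k = [seq x (k, l) | l <- iota 0 (c k).+1].
    case: k => // k kn; rewrite [LHS](nth_map 0%N) ?size_iota// nth_iota//.
  have partE k l : (1 <= k <= n)%N -> (l <= c k)%N -> part lam k l = x (k, l).
    move=> kn lc; rewrite /part rowE// (nth_map 0%N) ?size_iota ?ltnS//.
    by rewrite nth_iota// ltnS.
  exists lam.
    split; first by rewrite size_map size_iota.
    move=> k kn; rewrite rowE// size_map size_iota; split=> // l lc; rewrite partE//.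
    have kl : (k, l) \in steps n by rewrite mem_steps /= kn lc.
    by have := H (index (k, l) (steps n)); rewrite index_mem nth_index// => /(_ kl).
  rewrite /flat -[RHS](@mkseq_nth _ [::]) sz.
  apply: (@eq_from_nth _ [::]); first by rewrite size_map size_mkseq.
  move=> i; rewrite size_map => il; rewrite (nth_map (0, 0)%N)// nth_mkseq//.
  have := mem_nth (0, 0)%N il; rewrite mem_steps => /andP[h1 h2].
  rewrite /entry partE// /x -surjective_pairing index_uniq//.
  apply: allpairs_uniq_dep; rewrite ?iota_uniq//; first by move=> k _; exact: iota_uniq.
  by move=> [k l] [k' l'] _ _ /= [-> ->].
Qed.

End arrays.

(** * The Schur process and its update *)

Section process.
Context {R : realType}.
Variables (N : nat) (a : nat -> R) (c : nat -> nat) (M : nat -> nat -> int -> R)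
  (Q : int -> R).
Hypothesis a0 : forall k, (1 <= k <= N)%N -> 0 < a k.
Hypothesis c0 : c 0%N = 0%N.
Hypothesis tnM : forall k l, (1 <= k <= N)%N -> (1 <= l <= c k)%N -> tn setT (toep (M k l)).
Hypothesis sumM : forall k l, (1 <= k <= N)%N -> (1 <= l <= c k)%N -> asummable (M k l).
Hypothesis annM : forall j k l, (1 <= j <= k)%N -> (k <= N)%N -> (1 <= l <= c k)%N ->
  in_analyticity_annulus (fun n => M k l (- n)) (a j).
Hypothesis tnQ : tn setT (toep Q).
Hypothesis sumQ : asummable Q.
Hypothesis Q1 : bisum Q = 1.
Hypothesis annQ : forall j, (1 <= j <= N)%N -> in_analyticity_annulus Q (a j).

Definition level (s : nat * nat) : set (seq int) := GT s.1.

Definition trans (s : nat * nat) (x x' : seq int) : R :=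
  if s.2 == 0%N then skew_schur1 (a s.1) x x' else skew_schur (M s.1 s.2) x x'.

Definition link_const (s : nat * nat) : R :=
  if s.2 == 0%N then bisum (fun x => Q x * a s.1 ^ x) else 1.

Let e := follows c N.
Let V := skew_schur Q.

Lemma trans_ge0 s' s x x' : e s' s -> level s x -> level s' x' -> 0 <= trans s x x'.
Proof.
case: s => k [|l] /and3P[/eqP<- /= k1 l1] lx lx'.
  by rewrite /trans /= skew_schur1_ge0// a0.
by rewrite /trans /=; apply: skew_schur_ge0 lx lx'; apply: tnM.
Qed.

Lemma vert_ge0 s x y : level s x -> level s y -> 0 <= V y x.
Proof. by move=> lx ly; exact: skew_schur_ge0 ly lx. Qed.

Lemma Q_ge0 x : 0 <= Q x.
Proof. exact: toep_ge0. Qed.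

(** Nonnegative coefficients with sum 1 cannot all vanish, so H(Q; a_k) > 0. At the other steps the
    constant is 1. *)
Lemma link_const_gt0 s' s : e s' s -> 0 < link_const s.
Proof.
case: s => k l /and3P[_ /= k1 l1]; rewrite /link_const /=; case: eqP => // _.
have ak := a0 k1; have [_ sQa] := in_analyticity_annulus_asummable (annQ k1).
have Qa0 x : 0 <= Q x * a k ^ x by rewrite mulr_ge0 ?Q_ge0 ?exprz_ge0 ?(ltW ak).
have [x Qx] : exists x, 0 < Q x.
  apply: contrapT => /forallNP Qn.
  have Q0 : Q = fun=> 0.
    by apply/funext => x; apply/eqP; rewrite eq_le Q_ge0 leNgt andbT; apply/negP/Qn.
  by have := Q1; rewrite Q0 bisum0 => /esym/eqP; rewrite oner_eq0.
rewrite -lte_fin -ge0_bisum_esum//; last exact: asummable_bicvg.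
apply: (@lt_le_trans _ _ (Q x * a k ^ x)%:E).
  by rewrite lte_fin mulr_gt0 ?exprz_gt0.
by apply: (@esum_ge_term R int setT (fun x => (Q x * a k ^ x)%:E)) => //; rewrite lee_fin.
Qed.

Lemma trans_link s' s x y' : e s' s -> level s x -> level s' y' ->
  (\esum_(y in level s) (trans s y y' * V y x)%:E < +oo)%E /\
  \esum_(y in level s) (trans s y y' * V y x)%:E =
  ((link_const s)%:E * \esum_(x' in level s') (trans s x x' * V y' x')%:E)%E.
Proof.
case: s => k [|l] /and3P[/eqP<- /= k1 l1] lx ly'.
  rewrite /trans /link_const /level /prev /= in lx ly' *.
  case: k => // k in k1 l1 lx ly' *.
  apply: skew_cauchy_aM ly' lx => //; first exact: a0.
  by have [] := in_analyticity_annulus_asummable (annQ k1).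
rewrite /trans /link_const /level /prev /= in lx ly' *; rewrite mul1e.
by apply: skew_cauchy_MM ly' lx => //; [exact: tnM|exact: sumM].
Qed.

Let link_fin s' s x y' es lx ly' := (@trans_link s' s x y' es lx ly').1.
Let link s' s x y' es lx ly' := (@trans_link s' s x y' es lx ly').2.

Let ss := steps c N.
Let Cfg := chains level ss.
Let pth : path e (0, 0)%N ss := (steps_path c0 (leqnn N)).1.
Let lst : last (0, 0)%N ss = (N, c N) := (steps_path c0 (leqnn N)).2.
Let flt := flat c N.
Let fbij : set_bij (configs N c) Cfg flt := flat_bij c N.

Let fltC lam : configs N c lam -> Cfg (flt lam).
Proof. by case: fbij => H _ _; exact: H. Qed.

Lemma chain_weightE lam : chain_weight N a c M lam = wprod trans [::] ss (flt lam).
Proof.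
rewrite -[[::]]/(entry lam (0, 0)%N) (wprod_map trans (entry lam) (@follows_prev c N) pth).
rewrite prod_steps; apply: eq_big_nat => k _; congr (_ * _).
by apply: eq_big_nat => -[|l].
Qed.

Lemma step_weightE lam mu k l : step_weight a c M Q lam mu k l =
  fun nu => trans (k, l) nu (entry mu (prev c (k, l))) * V nu (entry lam (k, l)).
Proof. by case: l. Qed.

Lemma frakPE lam mu : frakP N a c M Q lam mu = pprod level trans V [::] ss (flt lam) (flt mu).
Proof.
rewrite -[[::]]/(entry mu (0, 0)%N).
rewrite (pprod_map level trans V (entry lam) (entry mu) (@follows_prev c N) pth).
rewrite prod_steps; apply: eq_big_nat => k _; congr (_ * _).
by apply: eq_big_nat => -[|l].
Qed.

Let GT00 : level (0, 0)%N [::]. Proof. by []. Qed.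

Let V00 : V [::] [::] = 1. Proof. by rewrite /V /skew_schur det_mx00. Qed.

Lemma chain_weight_ge0 lam : configs N c lam -> 0 <= chain_weight N a c M lam.
Proof. by move=> /fltC fl; rewrite chain_weightE; exact: (wprod_ge0 trans_ge0 pth GT00 fl). Qed.

Lemma frakP_ge0 lam mu : configs N c lam -> configs N c mu -> 0 <= frakP N a c M Q lam mu.
Proof.
move=> /fltC fl /fltC fm; rewrite frakPE.
exact: (pprod_ge0 trans_ge0 vert_ge0 pth GT00 fl fm).
Qed.

Lemma frakP_calX lam mu : configs N c lam -> configs N c mu -> ~ calX N a c M mu ->
  frakP N a c M Q lam mu = 0.
Proof.
move=> cl cm nX; apply/eqP; apply: contra_notT nX => P0; split=> //.
have {}P0 : 0 < frakP N a c M Q lam mu by rewrite lt0r P0 frakP_ge0.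
move: P0; rewrite frakPE chain_weightE.
exact: (pprod_gt0 trans_ge0 vert_ge0 pth GT00 (fltC cl) (fltC cm)).
Qed.

Lemma esum_configs (F : seq (seq int) -> R) : (forall xs, Cfg xs -> 0 <= F xs) ->
  \esum_(lam in configs N c) (F (flt lam))%:E = \esum_(xs in Cfg) (F xs)%:E.
Proof.
by move=> F0; rewrite (reindex_esum (configs N c) Cfg flt (fun xs => (F xs)%:E)).
Qed.

Lemma frakP_sum lam : calX N a c M lam ->
  \esum_(mu in configs N c) (frakP N a c M Q lam mu)%:E = 1%E.
Proof.
move=> [cl wl]; have fl := fltC cl; rewrite chain_weightE in wl.
under eq_esum do rewrite frakPE.
rewrite (esum_configs (F := pprod level trans V [::] ss (flt lam))); last first.
  by move=> xs Cxs; exact: (pprod_ge0 trans_ge0 vert_ge0 pth GT00 fl Cxs).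
apply: (chain_stochastic trans_ge0 vert_ge0 link_const_gt0 link_fin link pth GT00 GT00 _ fl wl).
by rewrite V00.
Qed.

Lemma frakP_stochastic : stochastic (calX N a c M) (frakP N a c M Q).
Proof.
move=> lam lX; have [cl _] := lX; split; first by move=> mu [cm _]; exact: frakP_ge0.
rewrite (@esum_eq_support R _ _ (configs N c)); first exact: frakP_sum.
- by move=> mu [].
- by move=> mu; exact: frakP_ge0.
- by move=> mu; exact: frakP_calX.
Qed.

Lemma configs_level lam s : configs N c lam -> (s.1 <= N)%N -> (s.2 <= c s.1)%N ->
  level s (entry lam s).
Proof.
case: s => [[|k] l] [sz H] /= kN lc; last exact: (H k.+1 kN).2.
by rewrite /entry /part /= nth_nil.
Qed.

(** [link_normalizable] asks for two positive quantities. The old weight is a factor of the positive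
    chain weight of [lam]. The vertical weight at the preceding step is 1 at the root, and elsewhere
    it is positive because that step was taken with positive probability. *)
Lemma frakP_is_well_defined : frakP_well_defined N a c M Q.
Proof.
move=> lam mu [cl wl] cm k l kN lc before; rewrite step_weightE.
have es : e (prev c (k, l)) (k, l) by rewrite /e /follows eqxx kN lc.
have prevP s : (s.1 <= N)%N -> (s.2 <= c s.1)%N ->
    ((prev c s).1 <= N)%N /\ ((prev c s).2 <= c (prev c s).1)%N.
  by rewrite /prev; case: eqP => /= _ h1 h2; split=> //; lia.
have k2 : (k <= N)%N by case/andP: kN.
have [p1 p2] := prevP (k, l) k2 lc.
have Sx : level (k, l) (entry lam (k, l)) by exact: configs_level.
have Sy' := configs_level cm p1 p2; have Sx' := configs_level cl p1 p2.
apply: (link_normalizable trans_ge0 vert_ge0 link_const_gt0 link_fin link es Sx Sy' Sx').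
  rewrite lt0r (trans_ge0 es Sx Sx') andbT; apply: contraTneq wl => t0.
  rewrite chain_weightE -[[::]]/(entry lam (0, 0)%N).
  rewrite (wprod_map trans (entry lam) (@follows_prev c N) pth).
  have kls : (k, l) \in ss by rewrite mem_steps /= kN lc.
  by rewrite (big_rem (k, l))//= t0 mul0r ltxx.
set s := prev c (k, l) in es p1 p2 Sy' Sx' *.
have [s0|s1] := posnP s.1.
  by rewrite /entry /part s0 /= !nth_nil V00.
have es' : e (prev c s) s by rewrite /e /follows eqxx s1 p1 p2.
have [q1 q2] := prevP s p1 p2.
have lt : (s.1 < k)%N || (s.1 == k) && (s.2 < l)%N.
  by rewrite /s /prev; case: eqP => /= [_|/eqP l0]; [lia|rewrite eqxx prednK ?lt0n// leqnn orbT].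
have := before s.1 s.2 s1 p2 lt; rewrite step_weightE -surjective_pairing => up.
exact: (update_gt0 trans_ge0 vert_ge0 es' Sx' (configs_level cm q1 q2) Sy' up).2.
Qed.

Lemma GT0 : GT 0 = [set [::]].
Proof. by apply/seteqP; split=> [x [/size0nil]|x ->]. Qed.

Definition link_total : R := \prod_(s <- ss) link_const s.

Lemma link_total_gt0 : 0 < link_total.
Proof.
rewrite /link_total big_seq; apply: prodr_gt0 => s; rewrite mem_steps => /andP[s1 s2].
by apply: (@link_const_gt0 (prev c s)); rewrite /e /follows eqxx s1 s2.
Qed.

Section boundary.
Variable Psi : int -> int -> R.
Hypothesis hPsi : Psi_valid N a Psi.
Let F := Psi_det N Psi.

Let tnPsi : tn [set j : int | - N%:Z <= j <= -1] Psi.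
Proof. by case: hPsi. Qed.

Lemma Psi_det_ge0 la : GT N la -> 0 <= F la.
Proof.
move=> la_GT; apply: (tn_decr tnPsi (r := fun i : 'I_N => la`_i - i.+1%:Z)
  (s := fun j : 'I_N => - j.+1%:Z)) => [i j ij|i j ij|j] /=.
- rewrite !intS !opprD !addrA ![_ - 1 - _]addrAC ltrD2r.
  by apply: (GT_pos la_GT); rewrite ij ltn_ord.
- by lia.
- by have := ltn_ord j; lia.
Qed.

Lemma Psi_det_mulQ mu : GT N mu ->
  \esum_(la in GT N) (V mu la * F la)%:E = (Psi_det N (mulQPsi Q Psi) mu)%:E.
Proof.
move=> mu_GT; have [cQ _] := mulQPsi_valid tnQ sumQ annQ hPsi.
(* [pos] counts the parts from 0 while [Psi_det] subtracts [i.+1], hence the shift by 1 in the row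
   argument of [Psi]. *)
have cv (i j : 'I_N) : bicvg (fun x => Q (pos mu i - x) * Psi (x - 1) (- j.+1%:Z)) /\
    bisum (fun x => Q (pos mu i - x) * Psi (x - 1) (- j.+1%:Z)) =
    mulQPsi Q Psi (mu`_i - i.+1%:Z) (- j.+1%:Z).
  have jN : - N%:Z <= - j.+1%:Z <= -1 by have := ltn_ord j; lia.
  pose u m := Q (mu`_i - i.+1%:Z - m) * Psi m (- j.+1%:Z).
  have u0 m : 0 <= u m.
    by rewrite mulr_ge0 ?Q_ge0//; apply: (@tn_entry _ _ Psi m _ tnPsi).
  have -> : (fun x => Q (pos mu i - x) * Psi (x - 1) (- j.+1%:Z)) = u \o (fun x => x - 1).
    by apply/funext => x; rewrite /u /= /pos intS; congr (Q _ * _); ring.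
  exact: ge0_bisum_reindex u0 (cQ _ _ jN) (set_bij_shift 1).
have E la : GT N la -> V mu la * F la =
    \det (\matrix_(i < N, j < N) Q (pos mu i - pos la j)) *
    \det (\matrix_(i < N, j < N) Psi (pos la i - 1) (- j.+1%:Z)).
  move=> _; rewrite /V (skew_schurE _ _ (proj1 mu_GT)); congr (_ * \det _).
  by apply/matrixP => i j; rewrite !mxE /pos; congr (Psi _ _); lia.
under eq_esum => la la_GT do rewrite E//.
rewrite (@cauchy_binet_esum R N (fun i x => Q (pos mu i - x))
  (fun j x => Psi (x - 1) (- j.+1%:Z))); last 2 first.
- by move=> i j; exact: (cv i j).1.
- move=> la la_GT; rewrite -E//.
  by rewrite mulr_ge0 ?Psi_det_ge0//; exact: (@vert_ge0 (N, 0%N)).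
congr (\det _)%:E; apply/matrixP => i j; rewrite !mxE; exact: (cv i j).2.
Qed.

Lemma schur_weightE lam :
  schur_weight N a c M Psi lam = F (last [::] (flt lam)) * wprod trans [::] ss (flt lam).
Proof. by rewrite /schur_weight chain_weightE flat_last. Qed.

Let F0 x : level (last (0, 0)%N ss) x -> 0 <= F x.
Proof. by rewrite lst; exact: Psi_det_ge0. Qed.

Lemma schur_weight_ge0 lam : configs N c lam -> 0 <= schur_weight N a c M Psi lam.
Proof.
move=> /fltC fl; rewrite schur_weightE mulr_ge0//.
  by apply: F0; exact: chains_last fl.
exact: (wprod_ge0 trans_ge0 pth GT00 fl).
Qed.

Lemma schur_weight_calX lam : configs N c lam -> ~ calX N a c M lam ->
  schur_weight N a c M Psi lam = 0.
Proof.
move=> cl nX; apply/eqP; apply: contra_notT nX; rewrite mulf_eq0 negb_or => /andP[_ w1].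
by split=> //; rewrite lt0r w1 chain_weight_ge0.
Qed.

Lemma schur_weight_frakP mu : configs N c mu ->
  \esum_(lam in configs N c) (schur_weight N a c M Psi lam * frakP N a c M Q lam mu)%:E =
  (link_total^-1 * schur_weight N a c M (mulQPsi Q Psi) mu)%:E.
Proof.
move=> cm; have fm := fltC cm; have pt := pth.
have := chain_intertwine trans_ge0 vert_ge0 link_const_gt0 link_fin link pt GT00 fm F0.
rewrite {1}/level /= GT0 esum_set1; last first.
  apply: esum_ge0 => xs Cxs; rewrite lee_fin V00.
  have w1 := wprod_ge0 trans_ge0 pt GT00 Cxs; have F1 := F0 (chains_last GT00 Cxs).
  have p1 := pprod_ge0 trans_ge0 vert_ge0 pt GT00 Cxs fm.
  by repeat (apply: mulr_ge0 => //).
rewrite lst /level /= Psi_det_mulQ; last first.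
  by have := chains_last GT00 fm; rewrite lst.
rewrite flat_last// => H.
transitivity (\esum_(xs in Cfg) (V [::] [::] * wprod trans [::] ss xs * F (last [::] xs) *
    pprod level trans V [::] ss xs (flt mu))%:E); last first.
  rewrite H -EFinM /schur_weight chain_weightE; congr EFin; rewrite -/link_total; ring.
rewrite -esum_configs; last first.
  move=> xs Cxs; rewrite V00.
  have w1 := wprod_ge0 trans_ge0 pt GT00 Cxs; have F1 := F0 (chains_last GT00 Cxs).
  have p1 := pprod_ge0 trans_ge0 vert_ge0 pt GT00 Cxs fm.
  by repeat (apply: mulr_ge0 => //).
apply: eq_esum => lam cl; rewrite schur_weightE frakPE V00; congr EFin; ring.
Qed.

Lemma radius_exists : exists t : R, [/\ 1 < t,
  forall k l, (1 <= k <= N)%N -> (1 <= l <= c k)%N ->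
    asummable (fun n => M k l (- n) * rad_hi a t k ^ n) /\
    asummable (fun n => M k l (- n) * rad_lo a t k ^ n) &
  forall j, (1 <= j <= N)%N ->
    asummable (fun n => Psi_gen Psi j n * rad_hi a t N ^ n) /\
    asummable (fun n => Psi_gen Psi j n * rad_lo a t N ^ n)].
Proof.
apply: (@filter_ex _ (1 : R)^'+); near=> t; split.
- by near: t; exact: nbhs_right_gt.
- suff H : forall k, (k < N.+1)%N -> forall l, (l < (c k).+1)%N ->
      (1 <= k)%N -> (1 <= l)%N ->
      asummable (fun n => M k l (- n) * rad_hi a t k ^ n) /\
      asummable (fun n => M k l (- n) * rad_lo a t k ^ n).
    by move=> k l /andP[k1 k2] /andP[l1 l2]; exact: H.
  near: t; apply: near_forall_ltn => k kN; apply: near_forall_ltn => l lc.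
  have [k1|k1] := leqP 1 k; last by near=> t.
  have [l1|l1] := leqP 1 l; last by near=> t.
  have [i1 i2] := @amax_annulus R a (fun n => M k l (- n)) k k1
    (fun j jk => annM jk kN (introT andP (conj l1 lc))).
  by have := near_annulus k i1; have := near_annulus k i2; apply: filterS2 => t [_ ?] [].
- suff H : forall j, (j < N.+1)%N -> (1 <= j)%N ->
      asummable (fun n => Psi_gen Psi j n * rad_hi a t N ^ n) /\
      asummable (fun n => Psi_gen Psi j n * rad_lo a t N ^ n).
    by move=> j /andP[j1 j2]; exact: H.
  near: t; apply: near_forall_ltn => j jN.
  have [j1|j1] := leqP 1 j; last by near=> t.
  have N1 : (1 <= N)%N by exact: leq_trans j1 jN.
  have [_ _ hP] := hPsi.
  have [i1 i2] := @amax_annulus R a (Psi_gen Psi j) N N1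
    (fun k kN => hP j k (introT andP (conj j1 jN)) kN).
  by have := near_annulus N i1; have := near_annulus N i2; apply: filterS2 => t [_ ?] [].
Unshelve. all: by end_near. Qed.

Definition growth t (s : nat * nat) x : R :=
  if (s.1 <= N)%N then Gro (rad_hi a t s.1) (rad_lo a t s.1) x else 0.

Let ak k : (k <= N)%N -> forall j, (1 <= j <= k)%N -> 0 < a j.
Proof. by move=> kN j /andP[j1 jk]; apply: a0; rewrite j1 (leq_trans jk). Qed.

Lemma growth_ge0 t s x : 1 < t -> 0 <= growth t s x.
Proof.
move=> t1; rewrite /growth; case: ifPn => [sN|_]; last exact: lexx.
by apply/ltW/Gro_gt0; [exact: rad_lo_gt0 t1 (ak sN)|exact: rad_lo_le_hi].
Qed.

(** The radii are widened in two moves: first [amax a k] and [amin a k] become those of [k.+1] with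
    t^k unchanged, which places [a k.+1] between them; then [skew_schur1_bound] spends one factor
    t. *)
Lemma growth_step1 t k : 1 < t -> (k < N)%N ->
  exists2 C : R, 0 <= C & forall x, GT k.+1 x ->
  (\esum_(x' in GT k) (skew_schur1 (a k.+1) x x' * Gro (rad_hi a t k) (rad_lo a t k) x')%:E
    <= (C * Gro (rad_hi a t k.+1) (rad_lo a t k.+1) x)%:E)%E.
Proof.
move=> t1 kN; have t0 : 0 < t by exact: lt_trans t1.
have tk : 1 <= t ^+ k by exact: exprn_ege1 (ltW t1).
have tk0 : 0 < t ^+ k by exact: exprn_gt0.
have ak1 : 0 < a k.+1 by exact: a0.
have q0 : 0 < amin a k.+1 / t ^+ k.
  by rewrite divr_gt0//; exact: amin_gt0 (ak kN).
have qa : amin a k.+1 / t ^+ k <= a k.+1.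
  rewrite ler_pdivrMr//; apply: (@le_trans _ _ (a k.+1)); first by rewrite /= ge_min lexx orbT.
  by rewrite ler_peMr// ltW.
have aP : a k.+1 <= amax a k.+1 * t ^+ k.
  apply: (@le_trans _ _ (amax a k.+1)); first by rewrite /= le_max lexx orbT.
  by rewrite ler_peMr// ltW// amax_gt0.
have [C C0 HC] := skew_schur1_bound k q0 qa aP t1; exists C => // x lx.
apply: (@le_trans _ _ (\esum_(x' in GT k) (skew_schur1 (a k.+1) x x' *
    Gro (amax a k.+1 * t ^+ k) (amin a k.+1 / t ^+ k) x')%:E)%E).
  apply: le_esum => x' Gx'; rewrite lee_fin ler_wpM2l ?skew_schur1_ge0//.
  apply: Gro_mono q0 _ (rad_lo_le_hi _ _ t1) _.
  - by rewrite ler_wpM2r ?invr_ge0 ?(ltW tk0)//= ge_min lexx.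
  - by rewrite ler_wpM2r ?(ltW tk0)//= le_max lexx.
by have := HC x lx; rewrite /rad_hi /rad_lo !exprSr invfM !mulrA.
Qed.

(** The constant exists for every [s], with the vacuous value 0 off the chain, so that [choice]
    turns it into a function of [s]. *)
Lemma growth_step t s : 1 < t ->
  (forall k l, (1 <= k <= N)%N -> (1 <= l <= c k)%N ->
    asummable (fun n => M k l (- n) * rad_hi a t k ^ n) /\
    asummable (fun n => M k l (- n) * rad_lo a t k ^ n)) ->
  exists C : R, 0 <= C /\ forall s' x, e s' s -> level s x ->
  (\esum_(x' in level s') (trans s x x' * growth t s' x')%:E <= (C * growth t s x)%:E)%E.
Proof.
move=> t1 tM; have [|ns] := boolP (e (prev c s) s); last first.
  exists 0; split; first exact: lexx.
  by move=> s' x es; case/negP: ns; rewrite (follows_prev es).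
case: s => k [|l] /and3P[_ /= k1 l1].
  case: k => // k in k1 l1 *; have kN : (k < N)%N := k1.
  have [C C0 HC] := growth_step1 t1 k1; exists C; split; first exact: C0.
  move=> s' x /follows_prev <- lx; rewrite /prev /trans /level /growth /= kN (ltnW kN).
  exact: HC.
have [k2 k3] := andP k1; have [s1 s2] := tM k l.+1 k1 l1.
have [C C0 HC] := skew_schur_bound k (rad_lo_gt0 t1 (ak k3)) (rad_lo_le_hi a k t1)
  (@tnM k l.+1 k1 l1) s1 s2.
exists C; split; first exact: C0.
by move=> s' x /follows_prev <- lx; rewrite /growth /= k3; exact: HC.
Qed.

Lemma schur_weight_fin :
  (\esum_(lam in configs N c) (schur_weight N a c M Psi lam)%:E < +oo)%E.
Proof.
have [t [t1 tM tP]] := radius_exists.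
pose G := growth t; have G0 s x : level s x -> 0 <= G s x by move=> _; exact: growth_ge0.
have [C CP] := choice (fun s => growth_step s t1 tM); clear tM.
have Cb s' s x : e s' s -> level s x ->
    (\esum_(x' in level s') (trans s x x' * G s' x')%:E <= (C s * G s x)%:E)%E.
  exact: (CP s).2.
have pt := pth.
have cb := chain_bound trans_ge0 pt G0 (fun _ s _ => (CP s).1) Cb F0.
apply: (@le_lt_trans _ _ (\esum_(x' in level (0, 0)%N) \esum_(xs in Cfg)
    (G (0, 0)%N x' * wprod trans x' ss xs * F (last x' xs))%:E)%E).
  rewrite /level /= GT0 esum_set1; last first.
    apply: esum_ge0 => xs Cxs; rewrite lee_fin.
    have w1 := wprod_ge0 trans_ge0 pt GT00 Cxs; have F1 := F0 (chains_last GT00 Cxs).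
    have g1 := G0 _ _ GT00.
    by repeat (apply: mulr_ge0 => //).
  rewrite -esum_configs; last first.
    move=> xs Cxs; have w1 := wprod_ge0 trans_ge0 pt GT00 Cxs.
    have F1 := F0 (chains_last GT00 Cxs); have g1 := G0 _ _ GT00.
    by repeat (apply: mulr_ge0 => //).
  apply: le_esum => lam cl; rewrite lee_fin schur_weightE /G /growth /Gro /= big_nil mul1r mulrC.
  exact: lexx.
apply: le_lt_trans cb _; rewrite lst /level /=.
have C0 : 0 <= \prod_(s <- ss) C s by apply: prodr_ge0 => s _; exact: (CP s).1.
apply: lte_mul_pinfty; rewrite ?lee_fin//.
have [tP' _ _] := hPsi.
have := Psi_det_bound (rad_lo_gt0 t1 (ak (leqnn N))) (rad_lo_le_hi a N t1) tP'
  (fun j jN => (tP j jN).1) (fun j jN => (tP j jN).2).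
by under eq_esum do rewrite mulrC; rewrite /G /growth leqnn.
Qed.

Lemma schur_process_calX (mu0 : config) : configs N c mu0 ->
    schur_weight N a c M Psi mu0 != 0 ->
  normalizable (configs N c) (schur_weight N a c M Psi) /\
  distribution_on (calX N a c M) (schur_process N a c M Psi).
Proof.
move=> cm wm.
have nm : normalizable (configs N c) (schur_weight N a c M Psi).
  split; first exact: schur_weight_ge0.
  rewrite schur_weight_fin andbT.
  have w0 : 0 < schur_weight N a c M Psi mu0 by rewrite lt0r wm schur_weight_ge0.
  apply: (@lt_le_trans _ _ (schur_weight N a c M Psi mu0)%:E); first by rewrite lte_fin.
  apply: (@esum_ge_term R _ (configs N c) (fun mu => (schur_weight N a c M Psi mu)%:E)) => //.
  by rewrite lee_fin ltW.
have p0 lam : configs N c lam -> 0 <= schur_process N a c M Psi lam.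
  by move=> cl; apply: normalized_ge0 => //; exact: schur_weight_ge0.
split=> //; split; first by move=> lam [cl _]; exact: p0.
rewrite (@esum_eq_support R _ _ (configs N c)) => //; first exact: esum_normalized.
- by move=> lam [].
- by move=> lam cl nX; rewrite /schur_process /normalized schur_weight_calX// mul0r.
Qed.

End boundary.

(** Summing [schur_weight_frakP] over [mu] and exchanging the sums leaves the row sums of [frakP],
    which are 1 wherever the weight of [lam] is nonzero. This gives both the normalization for Q Psi
    and the existence of that process. *)
Lemma schur_weight_total Psi : Psi_valid N a Psi ->
  (\esum_(mu in configs N c) (schur_weight N a c M (mulQPsi Q Psi) mu)%:E =
   link_total%:E * \esum_(lam in configs N c) (schur_weight N a c M Psi lam)%:E)%E.
Proof.
move=> hPsi; have H0 := link_total_gt0.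
transitivity (\esum_(mu in configs N c) (link_total%:E * \esum_(lam in configs N c)
    (schur_weight N a c M Psi lam * frakP N a c M Q lam mu)%:E))%E.
  apply: eq_esum => mu cm; rewrite schur_weight_frakP// -EFinM mulrA mulfV ?mul1r// gt_eqF//.
have t0 lam mu : configs N c lam -> configs N c mu ->
    0 <= schur_weight N a c M Psi lam * frakP N a c M Q lam mu.
  by move=> cl cm; rewrite mulr_ge0 ?schur_weight_ge0 ?frakP_ge0.
rewrite (ge0_esumZl (ltW H0)); last first.
  by move=> mu cm; apply: esum_ge0 => lam cl; rewrite lee_fin t0.
congr (_ * _)%E; rewrite esum_swap; last by move=> mu lam cm cl; rewrite lee_fin t0.
apply: eq_esum => lam cl.
under eq_esum do rewrite EFinM.
rewrite ge0_esumZl ?schur_weight_ge0//; last by move=> mu cm; rewrite lee_fin frakP_ge0.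
have [X|nX] := pselect (calX N a c M lam); first by rewrite frakP_sum// mule1.
by rewrite schur_weight_calX// mul0e.
Qed.

Lemma schur_process_frakP Psi mu : Psi_valid N a Psi ->
  normalizable (configs N c) (schur_weight N a c M Psi) -> calX N a c M mu ->
  \esum_(lam in calX N a c M)
     (schur_process N a c M Psi lam * frakP N a c M Q lam mu)%:E =
  (schur_process N a c M (mulQPsi Q Psi) mu)%:E.
Proof.
move=> hPsi nm [cm _]; have H0 := link_total_gt0.
have p0 lam : configs N c lam -> 0 <= schur_process N a c M Psi lam.
  by move=> cl; apply: normalized_ge0 => //; exact: schur_weight_ge0.
rewrite (@esum_eq_support R _ _ (configs N c)); last 3 first.
- by move=> lam [].
- by move=> lam cl; rewrite mulr_ge0 ?p0 ?frakP_ge0.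
- by move=> lam cl nX; rewrite /schur_process /normalized schur_weight_calX// !mul0r.
have [w0 /andP[Zgt Zlt]] := nm; have ZE := fin_esum w0 Zlt.
set Z := \esum_(lam in configs N c) (schur_weight N a c M Psi lam)%:E in Zgt Zlt ZE.
have Z0 : 0 < fine Z by rewrite -lte_fin -ZE.
under eq_esum => lam _.
  have -> : schur_process N a c M Psi lam * frakP N a c M Q lam mu =
    (fine Z)^-1 * (schur_weight N a c M Psi lam * frakP N a c M Q lam mu).
    by rewrite /schur_process /normalized -/Z mulrAC mulrC.
  rewrite EFinM; over.
rewrite ge0_esumZl ?invr_ge0 ?(ltW Z0)//; last first.
  by move=> lam cl; rewrite lee_fin mulr_ge0 ?w0 ?frakP_ge0.
rewrite schur_weight_frakP// -EFinM; congr EFin.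
rewrite /schur_process /normalized schur_weight_total// -/Z ZE -EFinM /= invfM.
by rewrite mulrA mulrC [_^-1 * _^-1]mulrC.
Qed.

End process.

Theorem theorem13 (R : realType) (N : nat) (hN : (1 <= N)%N)
  (a : nat -> R) (ha : forall k, (1 <= k <= N)%N -> 0 < a k)
  (c : nat -> nat) (hc0 : c 0%N = 0%N)
  (M : nat -> nat -> int -> R)
  (hM : forall k l, (1 <= k <= N)%N -> (1 <= l <= c k)%N ->
     admissible (M k l))
  (haM : forall j k l, (1 <= j <= k)%N -> (k <= N)%N -> (1 <= l <= c k)%N ->
     in_analyticity_annulus (fun n => M k l (- n)) (a j))
  (Psi : int -> int -> R) (hPsi : Psi_valid N a Psi)
  (Q : int -> R) (hQ : admissible Q)
  (haQ : forall j, (1 <= j <= N)%N -> in_analyticity_annulus Q (a j)) :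
  [/\ frakP_well_defined N a c M Q,
      stochastic (calX N a c M) (frakP N a c M Q),
      (* the matrix product Q Psi converges and Q Psi again satisfies
         the conditions imposed on Psi *)
      (forall i j : int, - N%:Z <= j <= -1 ->
         bicvg (fun m => Q (i - m) * Psi m j)) /\
      Psi_valid N a (mulQPsi Q Psi) &
      (* the process with parameter Psi exists unless its weights all vanish *)
      (exists2 lam, configs N c lam & schur_weight N a c M Psi lam != 0) ->
      [/\ normalizable (configs N c) (schur_weight N a c M Psi),
          normalizable (configs N c) (schur_weight N a c M (mulQPsi Q Psi)),
          distribution_on (calX N a c M) (schur_process N a c M Psi),
          distribution_on (calX N a c M)
            (schur_process N a c M (mulQPsi Q Psi)) &
          forall mu, calX N a c M mu ->
            \esum_(lam in calX N a c M)
              (schur_process N a c M Psi lam * frakP N a c M Q lam mu)%:E =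
            (schur_process N a c M (mulQPsi Q Psi) mu)%:E]].
Proof.
have [tQ sQ Q1] := admissible_tn hQ.
have tM k l : (1 <= k <= N)%N -> (1 <= l <= c k)%N -> tn setT (toep (M k l)).
  by move=> k1 l1; have [] := admissible_tn (hM k l k1 l1).
have sM k l : (1 <= k <= N)%N -> (1 <= l <= c k)%N -> asummable (M k l).
  by move=> k1 l1; have [] := admissible_tn (hM k l k1 l1).
have [cQ vQ] := mulQPsi_valid tQ sQ haQ hPsi.
split=> //.
- exact: frakP_is_well_defined.
- exact: frakP_stochastic.
move=> [lam cl wl].
have [n1 d1] := schur_process_calX Q ha hc0 tM haM hPsi cl wl.
(* If all weights for Q Psi vanished, so would their total, which is a positive multiple of the
   positive total for Psi. *)
have [mu cm wm] : exists2 mu, configs N c mu & schur_weight N a c M (mulQPsi Q Psi) mu != 0.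
  apply: contrapT => nmu.
  have := schur_weight_total ha hc0 tM sM tQ sQ Q1 haQ hPsi.
  rewrite esum1; last first.
    move=> mu cm; congr EFin; apply/eqP; apply: contra_notT nmu => wm; by exists mu.
  move/esym/eqP; rewrite gt_eqF// mule_gt0 ?lte_fin//; last by case: n1 => _ /andP[].
  by apply: link_total_gt0.
have [n2 d2] := schur_process_calX Q ha hc0 tM haM vQ cm wm.
split=> // mu' Xmu; exact: schur_process_frakP.
Qed.
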